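(* Let $(\mathcal T_i)_{i\in\mathbb N_0}$ be a generalised preferential attachment tree with random attachment weights as in the context, and let $(F(k))_{k\in\mathbb N_0}$ have the common law of the sequences $(F_j(k))_{k\in\mathbb N_0}$. Then: \begin{enumerate} \item If $\sum_{j=0}^\infty F(j)^{-2}=\infty$ almost surely, then almost surely $(\mathcal T_i)_{i\in\mathbb N_0}$ does not have a persistent hub. \item Suppose that (a) there is a sequence $(x_j)_{j\in\mathbb N_0}$ with $\sum_{j=0}^\infty x_j^{-2}<\infty$ such that $F(j)\ge x_j$ almost surely for every $j$, and (b) there exists $\lambda>0$ such that \[\sum_{i=0}^\infty\prod_{j=0}^i\mathbb E\Big[\frac{F(j)}{F(j)+\lambda}\Big]<\infty.\] Then almost surely $(\mathcal T_i)_{i\in\mathbb N_0}$ has a unique persistent hub. \end{enumerate}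
   Context: Generalised preferential attachment tree: for each $j\in\mathbb N_0$ let $(F_j(k))_{k\in\mathbb N_0}$ be a sequence of mutually independent positive random variables, these sequences being independent and identically distributed over $j$. $\mathcal T_0$ consists of a single node labelled $0$. Given $\mathcal T_k$ (with nodes $0,\dots,k$), form $\mathcal T_{k+1}$ by choosing a node $j$ of $\mathcal T_k$ with probability $F_j(\deg^+(j,\mathcal T_k))/\mathcal Z_k$, where $\mathcal Z_k=\sum_{j=0}^kF_j(\deg^+(j,\mathcal T_k))$, and adding a new node $k+1$ with an edge directed from $j$ to $k+1$. Here $\deg^+(u,T)$ denotes the out-degree of $u$ in the directed tree $T$ (and $-\infty$ if $u\notin T$). For a sequence of directed trees $(\mathcal T_n)_{n\in\mathbb N_0}$, $u$ is a persistent hub if $\deg^+(u,\mathcal T_n)=\max_{v\in\mathcal T_n}\deg^+(v,\mathcal T_n)$ for all but finitely many $n$; it is a unique persistent hub if, moreover, every persistent hub equals $u$.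
   Formalization: In part 2(a) the numbers x_j are required to be positive; with negative x_j allowed the claim fails (F(j)=1, x_j=-(j+1), λ=1 satisfies (a) and (b), yet part 1 rules out a persistent hub). *)

(* Defs.v *)
From HB Require Import structures.
From mathcomp Require Import all_boot all_order all_algebra.
From mathcomp Require Import all_classical all_reals all_analysis.
Set Implicit Arguments. Unset Strict Implicit. Unset Printing Implicit Defensive.
Import Order.TTheory GRing.Theory Num.Theory.

(* A growing directed tree with nodes 0,1,2,... is encoded by its parent
   sequence [par : nat -> nat]: node k+1 is attached to node [par k].
   Thus T_n has nodes 0..n and edges par k -> k+1 for k < n. *)

(* out-degree of node u in T_n (meaningful for u <= n) *)
Definition outdeg (par : nat -> nat) (u n : nat) : nat :=
  count (fun i => par i == u) (iota 0 n).

(* u is a node of maximal out-degree in T_n.  Since deg^+(u,T_n) = -oo for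
   u not in T_n, maximality forces u <= n. *)
Definition is_max_deg (par : nat -> nat) (u n : nat) : bool :=
  (u <= n)%N && [forall v : 'I_n.+1, (outdeg par v n <= outdeg par u n)%N].

Definition persistent_hub (par : nat -> nat) (u : nat) : Prop :=
  exists N, forall n, (N <= n)%N -> is_max_deg par u n.

Definition has_persistent_hub (par : nat -> nat) : Prop :=
  exists u, persistent_hub par u.

Definition unique_persistent_hub (par : nat -> nat) : Prop :=
  exists u, persistent_hub par u /\ forall v, persistent_hub par v -> v = u.

Local Open Scope classical_set_scope.
Local Open Scope ring_scope.

Definition Zweight {T : Type} {R : realType} (F : nat -> nat -> T -> R)
  (par : nat -> T -> nat) (n : nat) (w : T) : R :=
  \sum_(j < n.+1) F j (outdeg (par^~ w) j n) w.

Definition mutually_independent {d} {T : measurableType d} {R : realType}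
  (P : probability T R) (F : nat -> nat -> T -> R) : Prop :=
  forall (s : seq (nat * nat)) (B : nat * nat -> set R),
    uniq s -> (forall x, measurable (B x)) ->
    P (\bigcap_(x in [set x | x \in s]) (F x.1 x.2 @^-1` B x)) =
    (\prod_(x <- s) P (F x.1 x.2 @^-1` B x))%E.

(* Cylinder events of sigma(F_j(k) : j,k ; par_0,...,par_{n-1}):
   finitely many weights lie in given Borel sets and the first n
   attachment choices take prescribed values. *)
Definition cylinder {T : Type} {R : realType} (F : nat -> nat -> T -> R)
  (par : nat -> T -> nat) (n : nat) (s : seq (nat * nat))
  (B : nat * nat -> set R) (v : nat -> nat) : set T :=
  [set w | (forall x, x \in s -> B x (F x.1 x.2 w)) /\
           (forall i, (i < n)%N -> par i w = v i)].

(* The generalised preferential attachment tree with random weights F: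
   conditionally on all weights and on T_0,...,T_n, node n+1 is attached to
   node j <= n with probability F_j(deg^+(j,T_n)) / Z_n.  The conditional
   probability is expressed through the defining identity on the pi-system
   of cylinder events generating the conditioning sigma-algebra. *)
Definition gpa_tree {d} {T : measurableType d} {R : realType}
  (P : probability T R) (F : nat -> nat -> T -> R) (par : nat -> T -> nat)
  : Prop :=
  (forall k j, measurable [set w | par k w = j]) /\
  forall (n j : nat) (s : seq (nat * nat)) (B : nat * nat -> set R)
         (v : nat -> nat),
    (j <= n)%N -> (forall x, measurable (B x)) ->
    P (cylinder F par n s B v `&` [set w | par n w = j]) =
    (\int[P]_(w in cylinder F par n s B v)
        (F j (outdeg (par^~ w) j n) w / Zweight F par n w)%:E)%E.

(* Main.v *)
(** Given the weights, the parent sequence is a Markov chain, and everything is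
    read off (super)martingales of that chain.  Put a_u(k) = sum_(j<k) 1/F_u(j),
    q_u(k) = sum_(j<k) 1/F_u(j)^2, and let t_n = sum_(i<n) 1/Z_i be a clock
    (the compensator of a_u(deg u), for each node u).

    A pair of nodes u, v: X = a_u(deg u) - a_v(deg v) - Delta is a martingale and
    so is Y = X^2 + V - q_u(deg u) - q_v(deg v), while E[Y^2] <= 17 y^2 for Y
    started at y, so Y has a definite chance of staying above y/2.
    - If q diverges, take for Delta and V the values reached at a common remote
      degree K: whoever is behind has a definite chance of reaching degree K
      first, as soon as the fresh weights dominate the present gap.  By a
      zero-one argument no node leads another one forever.
    - If q converges, take for Delta and V the limits: at a tie of large degree
      Y is close to 0, so infinitely many ties have probability bounded away
      from 1 given any finite history, hence probability 0.

    The number of relevant nodes is controlled by C_n = prod_(i<n) Z_i/(Z_i+lam).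
    With H_u(k) the expected discounted number of children still to be born, the
    potential C_n * sum_u H_u(deg u) shows that sum_n E[C_n] < oo when (b) holds
    (or on the event that all degrees stay bounded); hence t_n -> oo, and then
    every degree tends to infinity.  In part 2, a_0(deg 0) - t_n is bounded, and
    the martingale prod_(j<deg u) (1 + lam/F_u(j)) * C_n makes the probability
    that node u ever ties with node 0 of order E[C_u], which is summable: by
    Borel-Cantelli only finitely many nodes compete. *)
Require Import Defs.
From HB Require Import structures.
From mathcomp Require Import all_boot all_order all_algebra.
From mathcomp Require Import ring lra zify.
From mathcomp Require Import all_classical all_reals all_analysis measurable_realfun.
Import Order.TTheory GRing.Theory Num.Theory.
Import numFieldNormedType.Exports HBNNSimple.
Set Implicit Arguments. Unset Strict Implicit. Unset Printing Implicit Defensive.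
Local Open Scope ring_scope.

(** * The chain with frozen weights: expectations, stopping, path sums *)

Section quenched.
Context {R : realFieldType}.
Implicit Types (f : nat -> nat -> R) (s : seq nat) (g Y : seq nat -> R).
Implicit Types (S : pred (seq nat)).

(** Conditioning on the weights is never carried out by conditional expectations. The quenched
    expectation [Ex] is a finite sum, defined for every array [f], and [integral_Ex] transports it
    to [P]; that bridge is the identity of [gpa_tree] on cylinders, extended by a pi-system
    argument. The familiar way to decouple the nodes is to embed the tree in continuous time with
    exponential clocks. Here the time [tS] is read off the jump chain itself, and the exponentials
    of the embedding become the products [CS] and [Pu], which fit the jump chain exactly.
    Independence enters through locality: n steps from the start consult only weights whose node and
    degree indices are below n. In part 1 the weights at high degrees are therefore fresh for a
    given history, in part 2 the weights of a young node are. The zero-one argument is finitary too: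
    if P(B \ A) >= c P(B) for every event B of a finite history, approximating A by such events B
    forces P(A) = 0. *)

Definition posw f := forall j k, 0 < f j k.

Definition Zw f s : R := \sum_(j < (size s).+1) f j (count_mem (j : nat) s).

Definition pr f s j : R := f j (count_mem j s) / Zw f s.

Definition step f g s : R :=
  \sum_(j < (size s).+1) pr f s j * g (rcons s j).

(* Expectation, given the weights [f], of [g] at the path that starts at [s]
   and is stopped on entering [S], or after [n] steps. *)
Fixpoint Ex f S n g s : R :=
  if n is n'.+1 then (if S s then g s else step f (Ex f S n' g) s) else g s.

Section fixed_weights.
Variable f : nat -> nat -> R.
Hypothesis f_gt0 : posw f.

Lemma Zw_gt0 s : 0 < Zw f s.
Proof.
rewrite /Zw big_ord_recl; apply: ltr_pwDl; first exact: f_gt0.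
by apply: sumr_ge0 => i _; exact/ltW/f_gt0.
Qed.

Lemma pr_gt0 s j : 0 < pr f s j.
Proof. by apply: divr_gt0; [exact: f_gt0|exact: Zw_gt0]. Qed.

Lemma sum_pr s : \sum_(j < (size s).+1) pr f s j = 1.
Proof. by rewrite -mulr_suml divff // gt_eqF // Zw_gt0. Qed.

Lemma ler_step g g' s :
  (forall j, (j <= size s)%N -> g (rcons s j) <= g' (rcons s j)) ->
  step f g s <= step f g' s.
Proof.
move=> gg'; apply: ler_sum => j _; rewrite ler_wpM2l ?(ltW (pr_gt0 _ _))//.
by apply: gg'; rewrite -ltnS.
Qed.

Lemma eq_step g g' s :
  (forall j, (j <= size s)%N -> g (rcons s j) = g' (rcons s j)) ->
  step f g s = step f g' s.
Proof. by move=> e; apply: eq_bigr => j _; rewrite e// -ltnS. Qed.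

Lemma step_cst c s : step f (fun=> c) s = c.
Proof. by rewrite /step -mulr_suml sum_pr mul1r. Qed.

Lemma step_lin a b g g' s :
  step f (fun s => a * g s + b * g' s) s = a * step f g s + b * step f g' s.
Proof.
rewrite /step !mulr_sumr -big_split; apply: eq_bigr => j _ /=.
by rewrite mulrDr !(mulrCA (pr _ _ _)).
Qed.

(** An observable of the degrees of u and v changes in a special way only when the new node is
    attached to one of them; most one-step computations below reduce to this. *)
Lemma step_affine2 g s u v c0 c1 c2 : (u <= size s)%N -> (v <= size s)%N ->
  (forall j, (j <= size s)%N ->
    g (rcons s j) = c0 + c1 *+ (j == u) + c2 *+ (j == v)) ->
  step f g s = c0 + pr f s u * c1 + pr f s v * c2.
Proof.
move=> us vs gE.
have pick w c : (w <= size s)%N ->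
    \sum_(j < (size s).+1) pr f s j * (c *+ ((j : nat) == w)) = pr f s w * c.
  move=> ws; have ws' : (w < (size s).+1)%N by [].
  rewrite (bigD1 (Ordinal ws'))//= eqxx mulr1n big1 ?addr0// => j.
  by rewrite -val_eqE /= => /negPf ->; rewrite mulr0n mulr0.
have -> : step f g s = \sum_(j < (size s).+1)
    (pr f s j * c0 + pr f s j * (c1 *+ ((j : nat) == u))
      + pr f s j * (c2 *+ ((j : nat) == v))).
  by apply: eq_bigr => j _; rewrite (gE _ (ltn_ord j)) !mulrDr.
by rewrite !big_split /= -mulr_suml sum_pr mul1r !pick.
Qed.

Lemma step_affine g s u c0 c1 : (u <= size s)%N ->
  (forall j, (j <= size s)%N -> g (rcons s j) = c0 + c1 *+ (j == u)) ->
  step f g s = c0 + pr f s u * c1.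
Proof.
move=> us gE; rewrite (@step_affine2 g s u u c0 c1 0)// ?mulr0 ?addr0//.
by move=> j js; rewrite gE// mul0rn addr0.
Qed.

Section stopped.
Variable S : pred (seq nat).

Lemma Ex_cst n c s : Ex f S n (fun=> c) s = c.
Proof.
elim: n s => //= n IH s; case: ifP => // _.
by rewrite (@eq_step _ (fun=> c)) ?step_cst.
Qed.

Lemma Ex_lin n a b g g' s : Ex f S n (fun s => a * g s + b * g' s) s =
  a * Ex f S n g s + b * Ex f S n g' s.
Proof.
elim: n s => //= n IH s; case: ifP => // _; rewrite -step_lin.
exact: eq_step.
Qed.

Section invariant.
Variable Inv : pred (seq nat).
Hypothesis Inv_step : forall s j,
  Inv s -> ~~ S s -> (j <= size s)%N -> Inv (rcons s j).

Lemma ler_Ex n g g' s : (forall s, Inv s -> g s <= g' s) -> Inv s ->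
  Ex f S n g s <= Ex f S n g' s.
Proof.
move=> gg'; elim: n s => [|n IH] s Is /=; first exact: gg'.
case: ifPn => Ss; first exact: gg'.
by apply: ler_step => j js; apply: IH; exact: Inv_step.
Qed.

Lemma Ex_super n Y s :
  (forall s, Inv s -> ~~ S s -> step f Y s <= Y s) -> Inv s ->
  Ex f S n Y s <= Y s.
Proof.
move=> sY; elim: n s => [|n IH] s Is //=.
case: ifPn => Ss //; apply: le_trans (sY _ Is Ss).
by apply: ler_step => j js; apply: IH; exact: Inv_step.
Qed.

Lemma Ex_mart n Y s :
  (forall s, Inv s -> ~~ S s -> step f Y s = Y s) -> Inv s ->
  Ex f S n Y s = Y s.
Proof.
move=> sY; elim: n s => [|n IH] s Is //=.
case: ifPn => Ss //; rewrite -[RHS]sY//.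
by apply: eq_step => j js; apply: IH; exact: Inv_step.
Qed.

End invariant.

Lemma eq_Ex n g g' s : (forall s, g s = g' s) -> Ex f S n g s = Ex f S n g' s.
Proof.
move=> gg'; elim: n s => [|n IH] s //=.
by case: ifPn => Ss //; apply: eq_step.
Qed.

(** Visits are sought among the prefixes, so that a hit is an observable of the unstopped history at
    one fixed time. *)
Definition hit n0 s : bool :=
  has (fun m => S (take m s)) (iota n0 ((size s).+1 - n0)).

Lemma hitP n0 s :
  reflect (exists2 m, (n0 <= m <= size s)%N & S (take m s)) (hit n0 s).
Proof.
apply: (iffP hasP) => [[m]|[m nm Sm]].
  rewrite mem_iota => nm Sm; exists m => //; lia.
by exists m => //; rewrite mem_iota; lia.
Qed.

End stopped.

Lemma Ex_pred0D n m g s :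
  Ex f pred0 (n + m) g s = Ex f pred0 n (Ex f pred0 m g) s.
Proof. by elim: n s => //= n IH s; exact: eq_step. Qed.

Lemma take_rconsW s s' (j : nat) :
  take (size (rcons s j)) s' = rcons s j -> take (size s) s' = s.
Proof.
move=> /(congr1 (take (size s))).
by rewrite size_rcons take_takel// -cats1 take_size_cat.
Qed.

Lemma ler_Ex0 n g g' s :
  (forall s', size s' = (size s + n)%N -> take (size s) s' = s ->
     g s' <= g' s') ->
  Ex f pred0 n g s <= Ex f pred0 n g' s.
Proof.
elim: n s => [|n IH] s gg' /=.
  by apply: gg'; rewrite ?addn0 ?take_size.
apply: ler_step => j js; apply: IH => s' ss' ts'; apply: gg'.
  by rewrite ss' size_rcons addnS.
exact: take_rconsW ts'.
Qed.

(** The martingale bounds concern the chain stopped on entering [S], while the tree is never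
    stopped; this lemma and the next pass between the two. *)
Lemma Ex_hit S n s :
  Ex f pred0 n (fun s' => (hit S (size s) s')%:R) s
  <= Ex f S n (fun s' => (S s')%:R) s.
Proof.
elim: n s => [|n IH] s.
  by rewrite /= /hit subSnn /= orbF take_size.
rewrite [X in _ <= X]/=; case: ifPn => Ss.
  rewrite Ss -[X in _ <= X](Ex_cst pred0 n.+1 1 s).
  by apply: ler_Ex0 => s' _ _; case: hit => //=; rewrite ler01.
rewrite /=; apply: ler_step => j js; apply: le_trans (IH _).
apply: ler_Ex0 => s' ss' ts'; rewrite ler_nat.
case: hitP => // -[m sm Sm]; rewrite size_rcons.
have [] : size s = m \/ (size s < m)%N by lia.
  move=> sm'; move: Ss; rewrite (_ : s = take m s') ?Sm// -sm'.
  by rewrite (take_rconsW ts').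
move=> sm'; case: hitP => // -[]; exists m => //; lia.
Qed.

(** A stopped path resting in [S'] is a prefix of free paths, all of which visit [S']. Only this
    direction holds: a free path may also visit [S'] after the stopped one has come to rest in [S]
    outside [S']. *)
Lemma Ex_hit_ge S S' n s : (forall s, S' s -> S s) ->
  Ex f S n (fun s' => (S' s')%:R) s
  <= Ex f pred0 n (fun s' => (hit S' (size s) s')%:R) s.
Proof.
move=> SS'; elim: n s => [|n IH] s.
  by rewrite /= /hit subSnn /= orbF take_size.
rewrite [X in X <= _]/=; case: ifPn => Ss.
  rewrite -[X in X <= _](Ex_cst pred0 n.+1 _ s).
  apply: ler_Ex0 => s' ss' ts'; rewrite ler_nat.
  case S's: (S' s) => //; case: hitP => // -[]; exists (size s); first lia.
  by rewrite ts'.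
rewrite /=; apply: ler_step => j js; apply: (le_trans (IH _)).
apply: ler_Ex0 => s' ss' ts'; rewrite ler_nat.
case: hitP => // -[m]; rewrite size_rcons => sm Sm.
by case: hitP => // -[]; exists m => //; lia.
Qed.

(** The legal histories: entry i, the parent of node i+1, is at most i. *)
Fixpoint paths n : seq (seq nat) :=
  if n is n'.+1 then [seq rcons s j | s <- paths n', j <- iota 0 n'.+1]
  else [:: [::]].

Lemma size_paths n s : s \in paths n -> size s = n.
Proof.
elim: n s => [|n IH] s; first by rewrite inE => /eqP ->.
by move=> /allpairsP[[s' j] [/= /IH ss' _ ->]]; rewrite size_rcons ss'.
Qed.

Lemma uniq_paths n : uniq (paths n).
Proof.
elim: n => // n IH; apply: allpairs_uniq => //; first exact: iota_uniq.
by move=> [s j] [s' j'] _ _ /= /rcons_inj [-> ->].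
Qed.

Lemma nil_notin_paths n : [::] \in paths n.+1 = false.
Proof. by apply/negbTE/negP => /size_paths. Qed.

Lemma rcons_in_paths n s j :
  (rcons s j \in paths n.+1) = (s \in paths n) && (j <= n)%N.
Proof.
apply/idP/andP => [/allpairsP[[s' j'] [/= sp]]|[sp jn]].
  rewrite -[0%N :: _]/(iota 0 n.+1) mem_iota add0n /= ltnS.
  by move=> j'n /rcons_inj[-> ->].
by apply/allpairsP; exists (s, j); split => //; rewrite mem_iota.
Qed.

Lemma mem_paths n s : (s \in paths n) =
  (size s == n) && all (fun i => nth 0%N s i <= i)%N (iota 0 n).
Proof.
elim: n s => [|n IH] s; first by rewrite /= inE; case: s.
case/lastP: s => [|s j]; first by rewrite nil_notin_paths.
rewrite rcons_in_paths IH size_rcons eqSS -(addn1 n) iotaD all_cat.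
rewrite [all _ (iota (0 + n) 1)]/= andbT add0n.
case: eqP => //= sn; rewrite nth_rcons sn ltnn eqxx; congr (_ && _).
apply: eq_in_all => i; rewrite mem_iota => /andP[_ ilt].
by rewrite nth_rcons sn (_ : (i < n)%N).
Qed.

Definition pw s : R := \prod_(i < size s) pr f (take i s) (nth 0%N s i).

Lemma pw_rcons s j : pw (rcons s j) = pw s * pr f s j.
Proof.
rewrite /pw size_rcons big_ord_recr /= nth_rcons ltnn eqxx.
rewrite -cats1 take_size_cat//; congr (_ * _).
apply: eq_bigr => i _; rewrite takel_cat ?(ltnW (ltn_ord i))//.
by rewrite nth_cat ltn_ord.
Qed.

Lemma Ex_recr n g s : Ex f pred0 n.+1 g s = Ex f pred0 n (step f g) s.
Proof. by rewrite -addn1 Ex_pred0D. Qed.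

Lemma Ex_pw n g : Ex f pred0 n g [::] = \sum_(s <- paths n) pw s * g s.
Proof.
elim: n g => [|n IH] g; first by rewrite /= big_seq1 /pw big_ord0 mul1r.
rewrite Ex_recr IH big_allpairs_dep.
rewrite !big_seq; apply: eq_bigr => s /size_paths ss.
rewrite -/(index_iota 0 n.+1) big_mkord /step ss mulr_sumr.
by apply: eq_bigr => j _; rewrite pw_rcons mulrA.
Qed.

End fixed_weights.
End quenched.

Lemma count_rcons (w : nat) (s : seq nat) (j : nat) :
  count_mem w (rcons s j) = (count_mem w s + (j == w))%N.
Proof. by rewrite -cats1 count_cat /= addn0. Qed.

(** * The race of two nodes: moments, ties and overtaking *)

Section race.
Context {R : realType}.
Variable f : nat -> nat -> R.
Hypothesis f_gt0 : posw f.

Definition aS (u k : nat) : R := \sum_(j < k) (f u j)^-1.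
Definition qS (u k : nat) : R := \sum_(j < k) (f u j) ^- 2.

Lemma aS_S u k : aS u k.+1 = aS u k + (f u k)^-1.
Proof. by rewrite /aS big_ord_recr. Qed.

Lemma qS_S u k : qS u k.+1 = qS u k + (f u k) ^- 2.
Proof. by rewrite /qS big_ord_recr. Qed.

Lemma aS_le u k l : (k <= l)%N -> aS u k <= aS u l.
Proof.
move=> /subnK <-; elim: (l - k)%N => // i IH.
by rewrite addSn aS_S (le_trans IH)// lerDl invr_ge0 ltW.
Qed.

Lemma qS_le u k l : (k <= l)%N -> qS u k <= qS u l.
Proof.
move=> /subnK <-; elim: (l - k)%N => // i IH.
by rewrite addSn qS_S (le_trans IH)// lerDl invr_ge0 exprn_ge0// ltW.
Qed.

(** A sum of squares of nonnegative terms is at most the square of their sum. When one racer has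
    arrived, this bounds the remaining variance by the squared gap. *)
Lemma qS_le_aS2 u k l : (k <= l)%N -> qS u l - qS u k <= (aS u l - aS u k) ^+ 2.
Proof.
move=> /subnK <-; elim: (l - k)%N => [|i IH]; first by rewrite add0n !subrr expr0n.
rewrite addSn qS_S aS_S -exprVn.
have := aS_le u (leq_addl i k); move: IH.
have : 0 <= (f u (i + k))^-1 by rewrite invr_ge0 ltW.
move: (f u _)^-1 (aS u _) (aS u _) (qS u _) (qS u _) => p a a' q q'.
by move=> *; nra.
Qed.

Section pair.
Variables (u v : nat) (Delta V : R).
Hypothesis uv : u != v.

Definition gapX s : R := aS u (count_mem u s) - aS v (count_mem v s) - Delta.
Definition varR s : R := V - qS u (count_mem u s) - qS v (count_mem v s).
Definition gapY s : R := gapX s ^+ 2 + varR s.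
(* The coefficients make [Phi gapX varR] a supermartingale that dominates
   [gapY ^+ 2] and is dominated by [17 * gapY ^+ 2]. *)
Let Phi x r : R := x ^+ 4 + 10 * x ^+ 2 * r + 17 * r ^+ 2.

Let al s := (f u (count_mem u s))^-1.
Let be s := (f v (count_mem v s))^-1.

Lemma step_gap (G : R -> R -> R) s : (u <= size s)%N -> (v <= size s)%N ->
  step f (fun s => G (gapX s) (varR s)) s = G (gapX s) (varR s)
    + pr f s u * (G (gapX s + al s) (varR s - al s ^+ 2) - G (gapX s) (varR s))
    + pr f s v * (G (gapX s - be s) (varR s - be s ^+ 2) - G (gapX s) (varR s)).
Proof.
move=> us vs; apply: step_affine2 => // j js.
rewrite /gapX /varR !count_rcons.
have [->|ju] := eqVneq j u.
  rewrite (negPf uv) addn0 addn1 aS_S qS_S mulr1n mulr0n addr0 [RHS]addrC subrK.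
  by rewrite /al exprVn; congr G; ring.
have [_|_] := eqVneq j v.
  rewrite addn0 addn1 aS_S qS_S mulr1n mulr0n addr0 [RHS]addrC subrK.
  by rewrite /be exprVn; congr G; ring.
by rewrite !addn0 !mulr0n !addr0.
Qed.

Let pr_al s : pr f s u * al s = (Zw f s)^-1.
Proof. by rewrite /pr /al mulrAC divff ?mul1r// gt_eqF. Qed.

Let pr_be s : pr f s v * be s = (Zw f s)^-1.
Proof. by rewrite /pr /be mulrAC divff ?mul1r// gt_eqF. Qed.

Variables (S : pred (seq nat)) (Inv : pred (seq nat)).
Hypothesis Inv_step : forall s j,
  Inv s -> ~~ S s -> (j <= size s)%N -> Inv (rcons s j).
Hypothesis Inv_size : forall s, Inv s -> (u <= size s)%N && (v <= size s)%N.
Hypothesis Inv_varR : forall s, Inv s -> ~~ S s ->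
  (f u (count_mem u s)) ^- 2 <= varR s /\ (f v (count_mem v s)) ^- 2 <= varR s.
Hypothesis Inv_varR0 : forall s, Inv s -> 0 <= varR s.

Let prE s : pr f s u * al s = pr f s v * be s.
Proof. by rewrite pr_al pr_be. Qed.

Lemma Ex_gapX n s : Inv s -> Ex f S n gapX s = gapX s.
Proof.
apply: Ex_mart => // {}s Is Ss; have /andP[us vs] := Inv_size Is.
rewrite (step_gap (fun x _ => x))//.
by move: (prE s) => e; lra.
Qed.

Lemma Ex_gapY n s : Inv s -> Ex f S n gapY s = gapY s.
Proof.
apply: Ex_mart => // {}s Is Ss; have /andP[us vs] := Inv_size Is.
rewrite (step_gap (fun x r => x ^+ 2 + r))// /gapY.
move: (pr f s u) (pr f s v) (gapX s) (varR s) (al s) (be s) (prE s).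
move=> p q x r a b e.
have -> : p * ((x + a) ^+ 2 + (r - a ^+ 2) - (x ^+ 2 + r)) = 2 * x * (p * a).
  by ring.
by rewrite e; ring.
Qed.

Lemma Ex_gapY2 n s : Inv s -> Ex f S n (fun s => gapY s ^+ 2) s <= 17 * gapY s ^+ 2.
Proof.
move=> Is; apply: (@le_trans _ _ (Ex f S n (fun s => Phi (gapX s) (varR s)) s)).
  apply: (ler_Ex f_gt0 Inv_step) => // {Is}s Is; rewrite /gapY /Phi.
  by have := Inv_varR0 Is; have := sqr_ge0 (gapX s); nra.
apply: (@le_trans _ _ (Phi (gapX s) (varR s))); last first.
  rewrite /gapY /Phi; have := Inv_varR0 Is; have := sqr_ge0 (gapX s); nra.
apply: (Ex_super f_gt0 Inv_step) => // {Is}s Is Ss.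
have /andP[us vs] := Inv_size Is; rewrite (step_gap Phi)//.
have [] := Inv_varR Is Ss; rewrite -!exprVn -/(al s) -/(be s).
move: (pr_gt0 f_gt0 s u) (pr_gt0 f_gt0 s v) (prE s).
move: (pr f s u) (pr f s v) (gapX s) (varR s) (al s) (be s).
move=> p q x r a b p0 q0 e ar br.
(* The terms linear in d cancel between u and v, because rate times step is the same for both
   ([prE]). The rest must be nonpositive: the coefficient 10 beats the 6 x^2 d^2 of the fourth
   power, and after completing the square (x + 2 d)^2 the coefficient 17 leaves exactly 24 (r -
   d^2), which is nonnegative as long as the jump is affordable. *)
have key d : d ^+ 2 <= r -> Phi (x + d) (r - d ^+ 2) - Phi x r
    <= (4 * x ^+ 3 + 20 * x * r) * d.
  move=> dr; have d2 := sqr_ge0 d; rewrite -subr_ge0 /Phi.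
  have -> : (4 * x ^+ 3 + 20 * x * r) * d - (((x + d) ^+ 4
    + 10 * (x + d) ^+ 2 * (r - d ^+ 2) + 17 * (r - d ^+ 2) ^+ 2)
    - (x ^+ 4 + 10 * x ^+ 2 * r + 17 * r ^+ 2))
    = d ^+ 2 * (4 * (x + 2 * d) ^+ 2 + 24 * (r - d ^+ 2)) by ring.
  apply: mulr_ge0 => //; apply: addr_ge0; last by rewrite mulr_ge0 ?subr_ge0.
  by rewrite mulr_ge0 ?sqr_ge0.
have ka := key _ ar; have kb := key (- b); rewrite sqrrN in kb.
have {kb}kb := kb br.
have h1 := ler_wpM2l (ltW p0) ka; have h2 := ler_wpM2l (ltW q0) kb.
have e' : p * ((4 * x ^+ 3 + 20 * x * r) * a)
    + q * ((4 * x ^+ 3 + 20 * x * r) * - b) = 0.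
  by rewrite mulrCA (mulrCA q) mulrN e mulrN subrr.
move: h1 h2 e'; move: (_ * a) (_ * - b) => *; lra.
Qed.

End pair.
(** A second moment argument in the style of Paley and Zygmund. The hypothesis on [V], applied to
    the next degree, keeps [Y] positive and every jump affordable. *)
Lemma tie_bound (u v n : nat) (Delta V : R) (s : seq nat) :
  u != v -> (u <= size s)%N -> (v <= size s)%N ->
  (forall k l, qS u k + qS v l < V) ->
  let Y := gapY u v Delta V in let S s' := Y s' <= Y s / 2 in
  Ex f S n (fun s' => (S s')%:R) s <= 67 / 68.
Proof.
move=> uv us vs qV; pose Y := gapY u v Delta V; pose S s' := Y s' <= Y s / 2.
change (Ex f S n (fun s' => (S s')%:R) s <= 67 / 68); set y := Y s.
have R0 s' : 0 < varR u v V s' by rewrite /varR; move: (qV (count_mem u s') (count_mem v s')); lra.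
have y0 : 0 < y by rewrite /y /Y /gapY ltr_wpDl ?sqr_ge0.
pose Inv (s : seq nat) := (u <= size s)%N && (v <= size s)%N.
have IS (s' : seq nat) (j : nat) : Inv s' -> ~~ S s' -> (j <= size s')%N -> Inv (rcons s' j).
  by move=> /andP[? ?] _ _; rewrite /Inv size_rcons !leqW.
have IR s' : Inv s' -> ~~ S s' -> (f u (count_mem u s')) ^- 2 <= varR u v V s' /\
    (f v (count_mem v s')) ^- 2 <= varR u v V s'.
  move=> _ _; rewrite /varR.
  have := qV (count_mem u s').+1 (count_mem v s').
  have := qV (count_mem u s') (count_mem v s').+1.
  by rewrite !qS_S; lra.
have Is : Inv s by apply/andP.
have EY := @Ex_gapY u v Delta V uv S Inv IS (fun s H => H) n s Is.
have EY2 := @Ex_gapY2 u v Delta V uv S Inv IS (fun s H => H) IR (fun s' _ => ltW (R0 s')) n s Is.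
(* With q = Y / y, the indicator of q <= 1/2 is at most 1 + 1/34 - (q - q^2 / 68) / 17: for q <= 1/2
   because q / 17 <= 1/34, otherwise because the right side equals ((q - 34)^2 + 34) / 1156. Since q
   has mean 1 and second moment at most 17, the mean of the bound is at most 67/68. *)
pose g (s' : seq nat) := 1 / (17 * y) * Y s' + (- 1 / (68 * 17 * y ^+ 2)) * Y s' ^+ 2.
have Eg : Ex f S n (fun s' => (S s')%:R) s <= Ex f S n (fun s' => 1 * (1 + 1 / 34) + (-1) * g s') s.
  apply: (ler_Ex f_gt0 (Inv := fun=> true)) => // s' _.
  have -> : 1 * (1 + 1 / 34) + -1 * g s'
    = 1 + 1 / 34 - (Y s' / y - (Y s' / y) ^+ 2 / 68) / 17.
    by rewrite /g; field; rewrite gt_eqF.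
  rewrite /S; case: (lerP (Y s') (Y s / 2)) => Yy /=; last first.
    by have := sqr_ge0 (Y s' / y - 34); move: (Y s' / y) => t; nra.
  have : Y s' / y <= 1 / 2 by rewrite ler_pdivrMr// mulrC mulrA mulr1 -/y.
  have : 0 <= (Y s' / y) ^+ 2 by exact: sqr_ge0.
  by lra.
apply: (le_trans Eg); rewrite Ex_lin// Ex_cst// Ex_lin// EY -/Y -/y.
have : -1 / (68 * 17 * y ^+ 2) * Ex f S n (fun s' => Y s' ^+ 2) s
   >= -1 / (68 * 17 * y ^+ 2) * (17 * y ^+ 2).
  apply: ler_wnM2l => //; rewrite mulN1r oppr_le0 invr_ge0.
  by move: (sqr_ge0 y); lra.
have -> : -1 / (68 * 17 * y ^+ 2) * (17 * y ^+ 2) = - 1 / 68.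
  by field; rewrite gt_eqF.
have -> : 1 / (17 * y) * y = 1 / 17 by field; rewrite gt_eqF.
by lra.
Qed.

(** If u arrives first, the gap [X] is nonnegative and at least of the order of the square root of
    [Y]. As [X] keeps a small mean while [Y] has a definite chance of staying large, u cannot almost
    always win. The two terms of the bound are a win of v and no arrival within n steps. *)
Lemma overtake_bound (u v K n : nat) (s : seq nat) :
  u != v -> (u <= size s)%N -> (v <= size s)%N ->
  (count_mem u s < K)%N -> (count_mem v s < K)%N ->
  let Delta := aS u K - aS v K in let V := qS u K + qS v K in
  28 * gapX u v Delta s <= Num.sqrt (gapY u v Delta V s) ->
  let S (s : seq nat) := (K <= count_mem u s)%N || (K <= count_mem v s)%N in
  let S' (s : seq nat) := (count_mem u s < K)%N && (K <= count_mem v s)%N in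
  1 / 704 <= Ex f S n (fun s' => (S' s')%:R) s
    + (1 - Ex f S n (fun s' => (S s')%:R) s).
Proof.
move=> uv us vs uK vK Delta V.
set X := gapX u v Delta; set Y := gapY u v Delta V; set r := Num.sqrt _ => Xr.
pose S (s : seq nat) := (K <= count_mem u s)%N || (K <= count_mem v s)%N.
pose S' (s : seq nat) := (count_mem u s < K)%N && (K <= count_mem v s)%N.
change (1 / 704 <= Ex f S n (fun s' => (S' s')%:R) s
    + (1 - Ex f S n (fun s' => (S s')%:R) s)); set y := Y s.
pose Inv (s : seq nat) := [&& (u <= size s)%N, (v <= size s)%N,
  (count_mem u s <= K)%N, (count_mem v s <= K)%N &
  (count_mem u s < K)%N || (count_mem v s < K)%N].
have IS (s' : seq nat) (j : nat) : Inv s' -> ~~ S s' -> (j <= size s')%N -> Inv (rcons s' j).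
  rewrite /Inv /S size_rcons !count_rcons => /and5P[? ? ? ? ?].
  rewrite negb_or -!ltnNge => /andP[? ?] _; move: uv.
  by have [->|] := eqVneq j u; have [//|] := eqVneq j v; lia.
have R0 s' : Inv s' -> 0 <= varR u v V s'.
  move=> /and5P[_ _ h1 h2 _]; rewrite /varR /V.
  have := qS_le u h1; have := qS_le v h2; lra.
have IR s' : Inv s' -> ~~ S s' -> (f u (count_mem u s')) ^- 2 <= varR u v V s' /\
    (f v (count_mem v s')) ^- 2 <= varR u v V s'.
  rewrite /S negb_or -!ltnNge => _ /andP[h1 h2]; rewrite /varR /V.
  have := qS_le u h1; have := qS_le v h2.
  have := qS_le u (ltnW h1); have := qS_le v (ltnW h2).
  by rewrite !qS_S; lra.
have Is : Inv s by rewrite /Inv us vs uK (ltnW uK) (ltnW vK).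
have y0 : 0 < y.
  rewrite /y /Y /gapY ltr_wpDl ?sqr_ge0//; have Ss : ~~ S s by rewrite /S negb_or -!ltnNge uK.
  apply: lt_le_trans (IR _ Is Ss).1; by rewrite invr_gt0 exprn_gt0.
have r0 : 0 < r by rewrite sqrtr_gt0.
have ry : y = r ^+ 2 by rewrite sqr_sqrtr// ltW.
have Isz s' : Inv s' -> (u <= size s')%N && (v <= size s')%N by move=> /and5P[-> ->].
have EX := @Ex_gapX u v Delta V uv S Inv IS Isz n s Is.
have EY := @Ex_gapY u v Delta V uv S Inv IS Isz n s Is.
have EY2 := @Ex_gapY2 u v Delta V uv S Inv IS Isz IR R0 n s Is.
(* With q = Y / y and t = X / r, the test function is h = (q - q^2 / 34 - 7 t) / 176. When u wins, t
   >= 0 and t^2 <= q <= 2 t^2 give h <= 0; in all other cases t^2 <= q gives h <= 1. Its mean is at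
   least (1 - 17/34 - 7/28) / 176 = 1/704, the factor 28 = 4 * 7 of the hypothesis being chosen for
   this. *)
pose g (s' : seq nat) := 1 / y * Y s' + (- 1 / (34 * y ^+ 2)) * Y s' ^+ 2.
pose h (s' : seq nat) := 1 / 176 * g s' + (- 7 / (176 * r)) * X s'.
have Eh : Ex f S n h s <= Ex f S n (fun s' => 1 * (S' s')%:R + 1 * (1 * 1 + (- 1) * (S s')%:R)) s.
  apply: (ler_Ex f_gt0 IS) => // s' Is'.
  have -> : h s' = (Y s' / y - (Y s' / y) ^+ 2 / 34 - 7 * (X s' / r)) / 176.
    by rewrite /h /g; field; rewrite gt_eqF// gt_eqF.
  have tq : (X s' / r) ^+ 2 <= Y s' / y.
    rewrite exprMn exprVn -ry ler_pM2r ?invr_gt0// /Y /gapY lerDl; exact: R0.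
  have [cS|cS] := boolP (S' s' || ~~ S s').
    apply: (@le_trans _ _ 1); last first.
      have h1 : (S s')%:R <= 1 :> R by rewrite lern1 leq_b1.
      have h2 : 0 <= (S' s')%:R :> R by rewrite ler0n.
      by case/orP: cS h1 h2 => [->|/negPf ->]; rewrite ?mulr1n ?mulr0n; lra.
    move: tq; move: (X s' / r) (Y s' / y) => t q tq.
    by have := sqr_ge0 (t + 1); have := sqr_ge0 (q - 153 / 2); lra.
  move: cS; rewrite negb_or negbK => /andP[/negPf S's Ss]; rewrite S's Ss.
  have {S's Ss} uK' : count_mem u s' = K.
    move: S's Ss Is'; rewrite /S' /S /Inv => *; lia.
  have vK' : (count_mem v s' <= K)%N by case/and5P: Is'.
  have XE : X s' = aS v K - aS v (count_mem v s').
    by rewrite /X /gapX uK' /Delta; ring.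
  have RX : varR u v V s' <= X s' ^+ 2.
    by rewrite XE (le_trans _ (qS_le_aS2 v vK'))// /varR uK' /V; lra.
  have t0 : 0 <= X s' / r.
    by apply: divr_ge0; [rewrite XE subr_ge0 aS_le|exact: ltW].
  have qt : Y s' / y <= 2 * (X s' / r) ^+ 2.
    rewrite exprMn exprVn -ry mulrA ler_pM2r ?invr_gt0// /Y /gapY -/X; lra.
  move: t0 qt tq; move: (X s' / r) (Y s' / y) => t q t0 qt tq.
  have t2 := sqr_ge0 t.
  have tq2 : t ^+ 4 <= q ^+ 2.
    by rewrite (exprM _ 2 2) ler_sqr// nnegrE (le_trans _ tq).
  (* What is required is t^3 - 68 t + 238 >= 0 for t >= 0. The minimum lies at the square root of
     68/3, close to 4.8, and the cubic with double root 4.8 is a lower bound. *)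
  have : 0 <= t * ((t - 48 / 10) ^+ 2 * (t + 96 / 10)).
    by apply: mulr_ge0 => //; apply: mulr_ge0; [exact: sqr_ge0|lra].
  by rewrite mulr0n mulr1n; lra.
move: Eh; rewrite !Ex_lin// !Ex_cst// EX EY -/X -/Y -/y => Eh.
have : -1 / (34 * y ^+ 2) * Ex f S n (fun s' => Y s' ^+ 2) s
   >= -1 / (34 * y ^+ 2) * (17 * y ^+ 2).
  apply: ler_wnM2l => //; rewrite mulN1r oppr_le0 invr_ge0.
  by move: (sqr_ge0 y); lra.
have -> : -1 / (34 * y ^+ 2) * (17 * y ^+ 2) = - 1 / 2.
  by field; rewrite gt_eqF.
move: Eh; have -> : 1 / y * y = 1 by field; rewrite gt_eqF.
have -> : -7 / (176 * r) * X s = - (7 / 176) * (X s / r) by field; rewrite gt_eqF.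
have : X s / r <= 1 / 28 by rewrite ler_pdivrMr//; lra.
by lra.
Qed.

End race.

(** * The discount and the (super)martingales of the jump chain *)

Section potentials.
Context {R : realType}.

Fixpoint Hrec (e : nat -> R) (n k : nat) : R :=
  if n is n'.+1 then e k * (1 + Hrec e n' k.+1) else 0.

Lemma HrecE e n k :
  Hrec e n k = \sum_(i < n) \prod_(j < i.+1) e (k + j)%N.
Proof.
elim: n k => [|n IH] k /=; first by rewrite big_ord0.
rewrite IH big_ord_recl big_ord1 addn0 mulrDr mulr1 mulr_sumr; congr (_ + _).
apply: eq_bigr => i _; rewrite [RHS]big_ord_recl addn0; congr (_ * _).
by apply: eq_bigr => j _; rewrite addSnnS.
Qed.

Lemma Hrec_ge0 e n k : (forall j, 0 <= e j) -> 0 <= Hrec e n k.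
Proof. by move=> e0; elim: n k => //= n IH k; rewrite mulr_ge0 ?addr_ge0. Qed.

Variable f : nat -> nat -> R.
Hypothesis f_gt0 : posw f.

Definition tS (s : seq nat) : R := \sum_(i < size s) (Zw f (take i s))^-1.
(* The exact counterpart, for the jump chain, of the discount [exp (- lam * tS)]. *)
Definition CS (lam : R) (s : seq nat) : R :=
  \prod_(i < size s) (Zw f (take i s) / (Zw f (take i s) + lam)).

Lemma big_take_rcons (A : Type) (idx : A) (op : Monoid.law idx)
  (G : seq nat -> A) s (j : nat) :
  \big[op/idx]_(i < size (rcons s j)) G (take i (rcons s j)) =
  op (\big[op/idx]_(i < size s) G (take i s)) (G s).
Proof.
rewrite size_rcons big_ord_recr /= -cats1 take_size_cat//; congr (op _ _).
by apply: eq_bigr => i _; rewrite takel_cat// ltnW.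
Qed.

Lemma tS_rcons s j : tS (rcons s j) = tS s + (Zw f s)^-1.
Proof. exact: (big_take_rcons _ (fun s => (Zw f s)^-1)). Qed.

Lemma CS_rcons lam s j :
  CS lam (rcons s j) = CS lam s * (Zw f s / (Zw f s + lam)).
Proof. exact: (big_take_rcons _ (fun s => Zw f s / (Zw f s + lam))). Qed.

Lemma tS_ge0 s : 0 <= tS s.
Proof. by apply: sumr_ge0 => i _; rewrite invr_ge0 ltW// Zw_gt0. Qed.

Section discount.
Variable lam : R.
Hypothesis lam_gt0 : 0 < lam.

Lemma CS_gt0 s : 0 < CS lam s.
Proof.
apply: prodr_gt0 => i _; have Z0 := Zw_gt0 f_gt0 (take i s).
by rewrite divr_gt0// addr_gt0.
Qed.

Lemma CS_le1 s : CS lam s <= 1.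
Proof.
apply: prodr_ile1 => i _; have Z0 := Zw_gt0 f_gt0 (take i s).
apply/andP; split; first by apply: divr_ge0; apply: ltW; rewrite ?addr_gt0.
by rewrite ler_pdivrMr ?addr_gt0// mul1r lerDl ltW.
Qed.

Lemma CS_ge_exp s : expR (- (lam * tS s)) <= CS lam s.
Proof.
rewrite /tS /CS mulr_sumr -sumrN expR_sum.
apply: ler_prod => i _; rewrite expR_ge0 /=.
have Z0 := Zw_gt0 f_gt0 (take i s); set Z := Zw f _ in Z0 *.
rewrite expRN -[X in _ <= X]invrK lef_pV2 ?posrE ?expR_gt0 ?invr_gt0 ?divr_gt0 ?addr_gt0//.
rewrite invf_div mulrDl divff ?gt_eqF//; exact: expR_ge1Dx.
Qed.

Definition Pu (u k : nat) : R := \prod_(j < k) (1 + lam / f u j).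

(** Factor by factor, 1 + y >= exp(y - y^2), because (1 + y)(1 - y + y^2) = 1 + y^3 >= 1. *)
Lemma Pu_ge_exp u k : expR (lam * aS f u k - lam ^+ 2 * qS f u k) <= Pu u k.
Proof.
rewrite /aS /qS /Pu !mulr_sumr -sumrB expR_sum.
apply: ler_prod => j _; rewrite expR_ge0 /=.
rewrite -exprVn -exprMn; have : 0 < lam / f u j by rewrite divr_gt0.
move: (lam / f u j) => y y0.
have h : 1 - (y - y ^+ 2) <= expR (- (y - y ^+ 2)) by exact: expR_ge1Dx.
rewrite -[y - y ^+ 2]opprK expRN -[X in _ <= X]invrK.
rewrite lef_pV2 ?posrE ?expR_gt0 ?invr_gt0 ?addr_gt0//.
apply: le_trans h; rewrite -[X in X <= _]mul1r ler_pdivrMr ?addr_gt0//.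
by have := exprn_gt0 3 y0; nra.
Qed.

(** A birth at u has probability f / Z and multiplies [Pu] by 1 + lam / f, so [Pu] grows on average
    by the factor 1 + lam / Z, the inverse of the next factor of [CS]. *)
Lemma Ex_PuCS u n S s : (u <= size s)%N ->
  Ex f S n (fun s => Pu u (count_mem u s) * CS lam s) s
  = Pu u (count_mem u s) * CS lam s.
Proof.
move=> us; apply: (@Ex_mart _ f S (fun s => (u <= size s)%N)) => //.
  by move=> s' j us' _ _; rewrite size_rcons leqW.
move=> {us}s us _; have Z0 := Zw_gt0 f_gt0 s; have fu := f_gt0 u (count_mem u s).
rewrite (@step_affine _ _ f_gt0 _ s u
  (Pu u (count_mem u s) * (CS lam s * (Zw f s / (Zw f s + lam))))
  (lam / f u (count_mem u s) * Pu u (count_mem u s) *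
    (CS lam s * (Zw f s / (Zw f s + lam)))))//.
  rewrite /pr; set c := CS _ _; set p := Pu _ _.
  by field; rewrite !gt_eqF ?addr_gt0.
move=> j js; rewrite CS_rcons count_rcons.
case: eqP => _; rewrite ?addn0 ?addr0// addn1 mulr1n /Pu big_ord_recr /=.
by ring.
Qed.

Section potential.
Variable M : nat.
Hypothesis M_gt0 : (0 < M)%N.

Definition alive (s : seq nat) := all (fun p => count_mem p s < M)%N s.

Lemma aliveP s : reflect (forall p, (count_mem p s < M)%N) (alive s).
Proof.
apply: (iffP allP) => [h p|h p _ //].
have [/h//|ps] := boolP (p \in s).
by rewrite (count_memPn ps).
Qed.

Lemma alive_rcons s j : alive (rcons s j) -> alive s.
Proof.
move=> /aliveP h; apply/aliveP => p; apply: leq_ltn_trans (h p).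
by rewrite count_rcons leq_addr.
Qed.

(** The Laplace transform at [lam] of an exponential waiting time of rate [f u j], that is, the mean
    discount between two births at u in the continuous-time picture. *)
Definition ratio u j : R := f u j / (f u j + lam).

Definition Hu u k : R := Hrec (ratio u) (M - k) k.

Lemma ratio_ge0 u j : 0 <= ratio u j.
Proof. by apply: divr_ge0; apply: ltW; rewrite ?addr_gt0. Qed.

Lemma Hu_ge0 u k : 0 <= Hu u k.
Proof. by apply: Hrec_ge0 => j; exact: ratio_ge0. Qed.

Lemma Hu_rec u k : (k < M)%N ->
  f u k * (Hu u k.+1 - Hu u k) = lam * Hu u k - f u k.
Proof.
move=> kM; have e : (M - k)%N = (M - k.+1).+1 by lia.
rewrite /Hu e /=.
have := f_gt0 u k; rewrite /ratio; move: (Hrec _ _ _) (f u k) => h x x0.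
by field; rewrite gt_eqF// addr_gt0.
Qed.

Definition HS (s : seq nat) : R := \sum_(p < (size s).+1) Hu p (count_mem (p : nat) s).

Definition Pot (s : seq nat) : R := (alive s)%:R * (CS lam s * HS s).

(* [step Pot] decreases by the discounted mass of the new node, up to the
   potential [Hu (size s).+1 0] which that node brings in. *)
Lemma step_Pot s j0 : count_mem (size s).+1 s = 0%N ->
  step f Pot s + (alive s)%:R * CS lam (rcons s j0)
  <= Pot s + (alive s)%:R * CS lam (rcons s j0) * Hu (size s).+1 0.
Proof.
move=> new; have Z0 := Zw_gt0 f_gt0 s; rewrite CS_rcons.
have HSE j : (j <= size s)%N -> HS (rcons s j) = HS s
   + (Hu j (count_mem j s).+1 - Hu j (count_mem j s)) + Hu (size s).+1 0.
  move=> js; rewrite /HS size_rcons big_ord_recr /= count_rcons new.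
  have -> : (j == (size s).+1) = false by lia.
  congr (_ + _); have js' : (j < (size s).+1)%N by [].
  rewrite (bigD1 (Ordinal js'))//= [in RHS](bigD1 (Ordinal js'))//=.
  rewrite count_rcons eqxx addn1 [RHS]addrAC; congr (_ + _); first by ring.
  apply: eq_bigr => p pj; rewrite count_rcons.
  have -> : (j == p) = false by apply: contra_neqF pj => /eqP jp; exact/val_inj.
  by rewrite addn0.
case al : (alive s); last first.
  rewrite !mul0r /Pot al mul0r !addr0 -[X in _ <= X](step_cst f_gt0 0 s).
  apply: ler_step => // j js; case al' : (alive _); last by rewrite mul0r.
  by rewrite (alive_rcons al') in al.
rewrite !mul1r; set C' := CS lam s * _.
have C'0 : 0 < C' by rewrite mulr_gt0 ?CS_gt0// divr_gt0// addr_gt0.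
apply: (@le_trans _ _ (step f (fun s' => C' * HS s') s + C')).
  rewrite lerD2r; apply: ler_step => // j js; rewrite /Pot CS_rcons -/C'.
  have : 0 <= C' * HS (rcons s j).
    apply: mulr_ge0; first exact: ltW.
    by apply: sumr_ge0 => p _; exact: Hu_ge0.
  by case: (alive _); rewrite ?mul1r ?mul0r.
(* Averaged over the chosen node, [Hu_rec] turns the increments of [Hu] into lam * HS / Zw - 1: the
   sum of the rates is [Zw] itself. Multiplied by C', the factor 1 + lam / Zw just restores
   [CS lam s]. *)
have -> : step f (fun s' => C' * HS s') s = C' * (HS s * (1 + lam / Zw f s) - 1
     + Hu (size s).+1 0).
  have -> : step f (fun s' => C' * HS s') s = \sum_(j < (size s).+1)
     (pr f s j * (C' * (HS s + Hu (size s).+1 0)) + C' / Zw f s * lam *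
       Hu j (count_mem (j : nat) s) - C' / Zw f s * f j (count_mem (j : nat) s)).
    apply: eq_bigr => j _; rewrite (HSE _ (ltn_ord j)).
    have := Hu_rec j (elimT (aliveP s) al j); rewrite /pr.
    set k := count_mem _ s; move: (Hu j k.+1) (Hu j k) (f j k) => h1 h0 x e.
    transitivity (x / Zw f s * (C' * (HS s + Hu (size s).+1 0))
      + C' / Zw f s * (x * (h1 - h0))); first by field; rewrite gt_eqF.
    by rewrite e; field; rewrite gt_eqF.
  rewrite sumrB big_split /= -mulr_suml sum_pr// mul1r -!mulr_sumr -/(HS s) -/(Zw f s).
  by field; rewrite gt_eqF.
rewrite /Pot al mul1r /C'; set z := Zw f s in Z0 *.
have -> : CS lam s * (z / (z + lam)) * (HS s * (1 + lam / z) - 1 + Hu (size s).+1 0)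
  = CS lam s * HS s - CS lam s * (z / (z + lam))
    + CS lam s * (z / (z + lam)) * Hu (size s).+1 0.
  by field; rewrite !gt_eqF// addr_gt0.
by rewrite addrAC subrK.
Qed.

End potential.
End discount.

(** With x = f u k, z = 1 / Z and t the clock, staying at degree k has probability 1 - x z, and (1 -
    x z)(1 + x (t + z)) <= 1 + x t. If this supermartingale stays bounded, u cannot remain at degree
    k while the clock diverges. *)
Lemma step_stuck u k s : (u <= size s)%N -> (k <= count_mem u s)%N ->
  let Y s := (count_mem u s == k)%:R * (1 + f u k * tS s) in
  step f Y s <= Y s.
Proof.
move=> us ks /=; have Z0 := Zw_gt0 f_gt0 s; have t0 := tS_ge0 s.
have fk := f_gt0 u k; have [uk|uk] := eqVneq (count_mem u s) k; last first.
  rewrite mul0r -[X in _ <= X](step_cst f_gt0 0 s).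
  apply: ler_step => // j js; rewrite count_rcons.
  have -> : (count_mem u s + (j == u) == k)%N = false by lia.
  by rewrite mul0r.
rewrite mul1r (@step_affine _ _ f_gt0 _ s u (1 + f u k * (tS s + (Zw f s)^-1))
  (- (1 + f u k * (tS s + (Zw f s)^-1))))//; last first.
  move=> j js; rewrite count_rcons tS_rcons uk; case: (eqVneq j u) => _.
    have -> : (k + true == k)%N = false by lia.
    by rewrite mulr1n subrr mul0r.
  by rewrite addn0 eqxx mul1r mulr0n addr0.
rewrite /pr uk; move: (tS s) (f u k) t0 fk => t x t0 x0.
have z0 : 0 < (Zw f s)^-1 by rewrite invr_gt0.
move: (Zw f s)^-1 z0 => z z0; have xz := mulr_gt0 x0 z0; have xt := mulr_ge0 (ltW x0) t0.
have := mulr_ge0 (ltW xz) xt; have := mulr_gt0 xz xz.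
by lra.
Qed.

(** The compensated sum is a martingale, and a birth at u adds at most (f u k)^-2 to its variance;
    [r] pays at least that amount at each birth. *)
Lemma step_drift u (r : nat -> R) s : (u <= size s)%N ->
  (forall k, (f u k) ^- 2 <= r k - r k.+1) ->
  let Y s := (aS f u (count_mem u s) - tS s) ^+ 2 + r (count_mem u s) in
  step f Y s <= Y s.
Proof.
move=> us rf /=; have Z0 := Zw_gt0 f_gt0 s; set k := count_mem u s.
have fk := f_gt0 u k; set X := aS f u k - tS s; set z := (Zw f s)^-1.
rewrite (@step_affine _ _ f_gt0 _ s u ((X - z) ^+ 2 + r k)
  (2 * (X - z) * (f u k)^-1 + (f u k)^-1 ^+ 2 + r k.+1 - r k))//; last first.
  move=> j js; rewrite count_rcons tS_rcons -/k -/z; case: eqP => _.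
    by rewrite addn1 aS_S mulr1n /X; ring.
  by rewrite addn0 mulr0n addr0 /X; ring.
have pz : pr f s u * (f u k)^-1 = z by rewrite /pr -/k mulrAC divff ?mul1r// gt_eqF.
have p0 := pr_gt0 f_gt0 s u.
have : pr f s u * ((f u k)^-1 ^+ 2 + r k.+1 - r k) <= 0.
  by rewrite pmulr_rle0// exprVn; have := rf k; lra.
have -> : pr f s u * (2 * (X - z) * (f u k)^-1 + (f u k)^-1 ^+ 2 + r k.+1 - r k)
  = 2 * (X - z) * (pr f s u * (f u k)^-1)
    + pr f s u * ((f u k)^-1 ^+ 2 + r k.+1 - r k) by ring.
by rewrite pz; have := sqr_ge0 z; lra.
Qed.

End potentials.

Local Open Scope classical_set_scope.
Local Open Scope ring_scope.
Local Open Scope ereal_scope.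

(** * Integrals of products, determined on a pi-system *)

Lemma measurable_funV d (T : measurableType d) (R : realType) (D : set T)
  (f : T -> R) : measurable D ->
  measurable_fun D f -> measurable_fun D (fun x => (f x)^-1%R).
Proof.
move=> mD mf.
(* Squaring first makes the base nonnegative, and the outer factor f x handles zeros, where both
   sides vanish by the convention for inverses. *)
have -> : (fun x => (f x)^-1%R) = (fun x => f x * (f x ^+ 2) `^ (- 1))%R.
  apply/funext => x; rewrite powR_inv1 ?sqr_ge0//.
  have [->|x0] := eqVneq (f x) 0%R; first by rewrite mul0r invr0.
  by rewrite expr2 invfM mulrA divff// mul1r.
apply: measurable_funM => //.
apply: (measurableT_comp (measurable_powR _)).
exact: measurable_funX.
Qed.

Section weighted_integrals.
Context d (T : measurableType d) (R : realType) (P : {measure set T -> \bar R}).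
Context d' (S : measurableType d') (Phi : T -> S).
Hypothesis mPhi : measurable_fun setT Phi.

(** The hypothesis says that [q1] and [q2] have the same conditional expectation given [Phi]. Simple
    approximations of [g] and monotone convergence insert an arbitrary nonnegative function of
    [Phi]. *)
Lemma ge0_integralM_ext (q1 q2 : T -> R) (g : S -> R) :
  measurable_fun setT q1 -> measurable_fun setT q2 ->
  (forall x, 0 <= q1 x)%R -> (forall x, 0 <= q2 x)%R ->
  (forall A, measurable A -> \int[P]_(x in Phi @^-1` A) (q1 x)%:E =
                             \int[P]_(x in Phi @^-1` A) (q2 x)%:E) ->
  measurable_fun setT g -> (forall y, 0 <= g y)%R ->
  \int[P]_x (g (Phi x) * q1 x)%:E = \int[P]_x (g (Phi x) * q2 x)%:E.
Proof.
move=> mq1 mq2 q10 q20 q12 mg g0.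
have mEg : measurable_fun setT (EFin \o g) by exact/measurable_EFinP.
pose h n := nnsfun_approx measurableT mEg n.
have mhq (q : T -> R) n : measurable_fun setT q ->
    measurable_fun setT (fun x => (h n (Phi x) * q x)%:E).
  move=> mq; apply/measurable_EFinP; apply: measurable_funM => //.
  exact: measurableT_comp.
have cvgh (q : T -> R) : measurable_fun setT q -> (forall x, 0 <= q x)%R ->
    \int[P]_x (h n (Phi x) * q x)%:E @[n --> \oo] --> \int[P]_x (g (Phi x) * q x)%:E.
  move=> mq q0.
  have -> : \int[P]_x (g (Phi x) * q x)%:E =
      \int[P]_x limn (fun n => (h n (Phi x) * q x)%:E).
    apply: eq_integral => x _; apply/esym/cvg_lim => //.
    rewrite EFinM; under eq_fun do rewrite EFinM.
    apply: cvgeZr => //.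
    exact: (@cvg_nnsfun_approx _ _ _ _ measurableT _ mEg (fun x _ => g0 x)).
  apply: cvg_monotone_convergence => //.
  - by move=> n; exact: mhq.
  - by move=> n x _; rewrite lee_fin mulr_ge0.
  - move=> x _ m n mn; rewrite lee_fin ler_wpM2r//.
    exact/lefP/nd_nnsfun_approx.
have simp (q : T -> R) n : measurable_fun setT q -> (forall x, 0 <= q x)%R ->
    \int[P]_x (h n (Phi x) * q x)%:E =
    \sum_(y \in range (h n)) y%:E * \int[P]_(x in Phi @^-1` (h n @^-1` [set y])) (q x)%:E.
  move=> mq q0.
  have mpre y : measurable (Phi @^-1` (h n @^-1` [set y])).
    by rewrite -[X in measurable X]setTI; apply: mPhi.
  have Ey0 y x : 0 <= (y * \1_(h n @^-1` [set y]) (Phi x))%:E * (q x)%:E.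
    by rewrite mule_ge0 ?lee_fin// -lee_fin EFinM nnfun_muleindic_ge0.
  under eq_integral => x _.
    rewrite EFinM fimfunE -fsumEFin// ge0_mule_fsuml; last first.
      by move=> y; rewrite EFinM nnfun_muleindic_ge0.
    over.
  rewrite ge0_integral_fsum//; last first.
    move=> y; apply/measurable_EFinP; apply: measurable_funM => //.
    apply: measurable_funM => //; apply: (measurableT_comp _ mPhi).
    by apply: measurable_indic.
  apply: eq_fsbigr => y; rewrite inE => -[t _ ty].
  have y0 : (0 <= y)%R by rewrite -ty.
  rewrite -ge0_integralZl_EFin//=; last 2 first.
  - by move=> x _; rewrite lee_fin.
  - by apply/measurable_EFinP; exact: measurable_funTS.
  rewrite [RHS]integral_mkcond; apply: eq_integral => x _.
  rewrite patchE indicE.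
  have -> : (x \in Phi @^-1` (h n @^-1` [set y])) = (Phi x \in h n @^-1` [set y]).
    by apply/idP/idP; rewrite !inE.
  by case: (_ \in _); rewrite ?mulr1// mulr0 mul0e.
have e : (fun n => \int[P]_x (h n (Phi x) * q1 x)%:E)
    = (fun n => \int[P]_x (h n (Phi x) * q2 x)%:E).
  by apply/funext => n; rewrite !simp//; apply: eq_fsbigr => y _; rewrite q12.
by rewrite -(cvg_lim _ (cvgh _ mq1 q10))// e; exact: cvg_lim (cvgh _ mq2 q20).
Qed.

End weighted_integrals.

Section pi_system_integrals.
Context d (T : measurableType d) (R : realType) (P : {measure set T -> \bar R}).
Context (S : pointedType) (G : set (set S)).
Hypotheses (GI : setI_closed G) (GT : G setT).
Variable Phi : T -> g_sigma_algebraType G.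
Hypothesis mPhi : measurable_fun setT Phi.

(** Dynkin's lemma; finiteness of the integral of [q1] permits the subtraction in the complement
    case. *)
Lemma ge0_integralM_ext_pi (q1 q2 : T -> R) (g : g_sigma_algebraType G -> R) :
  measurable_fun setT q1 -> measurable_fun setT q2 ->
  (forall x, 0 <= q1 x)%R -> (forall x, 0 <= q2 x)%R ->
  \int[P]_x (q1 x)%:E < +oo ->
  (forall A, G A -> \int[P]_(x in Phi @^-1` A) (q1 x)%:E =
                   \int[P]_(x in Phi @^-1` A) (q2 x)%:E) ->
  measurable_fun setT g -> (forall y, 0 <= g y)%R ->
  \int[P]_x (g (Phi x) * q1 x)%:E = \int[P]_x (g (Phi x) * q2 x)%:E.
Proof.
move=> mq1 mq2 q10 q20 q1oo q12; apply: ge0_integralM_ext => // A.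
have mpre (B : set (g_sigma_algebraType G)) : measurable B -> measurable (Phi @^-1` B).
  by move=> mB; rewrite -[X in measurable X]setTI; apply: mPhi.
pose C := [set A : set S | \int[P]_(x in Phi @^-1` A) (q1 x)%:E =
                           \int[P]_(x in Phi @^-1` A) (q2 x)%:E].
suff : forall A, <<s G >> A -> C A by apply.
apply: (@dynkin_induction _ (g_sigma_algebraType G)) => //.
- exact: q12.
- move=> B mB CB; rewrite /C /=.
  have split (q : T -> R) : measurable_fun setT q -> (forall x, 0 <= q x)%R ->
      \int[P]_x (q x)%:E = \int[P]_(x in Phi @^-1` B) (q x)%:E
        + \int[P]_(x in Phi @^-1` (~` B)) (q x)%:E.
    move=> mq q0; rewrite -[in LHS](setUv (Phi @^-1` B)) -preimage_setC.
    rewrite ge0_integral_setU//.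
    + by apply: mpre.
    + by apply: measurableC; apply: mpre.
    + by apply/measurable_EFinP; exact: measurable_funTS.
    + by move=> x _; rewrite lee_fin.
    + by rewrite disj_set2E setICr.
  have e := q12 _ GT; rewrite !preimage_setT (split _ mq1 q10) (split _ mq2 q20) in e.
  have fin : \int[P]_(x in Phi @^-1` B) (q1 x)%:E \is a fin_num.
    rewrite ge0_fin_numE; last by apply: integral_ge0 => x _; rewrite lee_fin.
    apply: le_lt_trans q1oo; apply: ge0_subset_integral => //; first exact: mpre.
    + by apply/measurable_EFinP.
    + by move=> x _; rewrite lee_fin.
  move: e; rewrite -[in RHS]CB addeC [RHS]addeC => /(congr1 (fun z => z - _)).
  by move=> /(_ (\int[P]_(x in Phi @^-1` B) (q1 x)%:E)); rewrite !addeK.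
- move=> F mF tF CF; rewrite /C /= preimage_bigcup.
  have mq (q : T -> R) : measurable_fun setT q -> (forall x, 0 <= q x)%R ->
      \int[P]_(x in \bigcup_i (Phi @^-1` (F i))) (q x)%:E
      = \sum_(i <oo) \int[P]_(x in Phi @^-1` (F i)) (q x)%:E.
    move=> mq q0; apply: ge0_integral_bigcup => //.
    + by move=> k; exact: mpre.
    + by apply/measurable_EFinP; exact: measurable_funTS.
    + by move=> x _; rewrite lee_fin.
    + apply/trivIsetP => i j _ _ ij; rewrite -preimage_setI.
      by move/trivIsetP : tF => ->//; rewrite preimage_set0.
  by rewrite !mq//; apply: eq_eseriesr => i _; exact: CF.
Qed.

End pi_system_integrals.

(** * The space of weights, its partial sigma-algebras, and independence *)

Definition weights (R : realType) := nat -> nat -> R.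

HB.instance Definition _ (R : realType) := gen_eqMixin (weights R).
HB.instance Definition _ (R : realType) := gen_choiceMixin (weights R).
HB.instance Definition _ (R : realType) :=
  isPointed.Build (weights R) (fun _ _ => 0%R).

(** The dependence of a functional on part of the weights is always expressed as measurability for
    the coordinates in some [J], and independence as [J] against [predC J]. *)
Definition wcyl {R : realType} (J : pred (nat * nat)) : set (set (weights R)) :=
  [set A | exists (s : seq (nat * nat)) (B : nat * nat -> set R),
    [/\ all J s, forall x, measurable (B x) &
        A = [set f | forall x, x \in s -> B x (f x.1 x.2)]]].

(* Weights with the sigma-algebra generated by the coordinates in [J]. *)
Notation wT R J := (g_sigma_algebraType (@wcyl R J)).

Section weight_space.
Context {R : realType}.
Local Notation W := (weights R).

Lemma wcylT J : wcyl J (setT : set W).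
Proof.
by exists [::], (fun=> setT); split => //; apply/seteqP; split.
Qed.

Lemma wcylI J : setI_closed (wcyl J : set (set W)).
Proof.
move=> _ _ [s [B [Js mB ->]]] [s' [B' [Js' mB' ->]]].
exists (s ++ s'), (fun x => (if x \in s then B x else setT)
  `&` (if x \in s' then B' x else setT)); split.
- by rewrite all_cat Js.
- by move=> x; apply: measurableI; case: ifP.
- apply/seteqP; split => f /=.
    by move=> [h h'] x; split; case: ifP => // /[dup]; [move=> _ /h|move=> _ /h'].
  move=> h; split => x xs.
    by have := h x; rewrite mem_cat xs => /(_ isT)[].
  by have := h x; rewrite mem_cat xs orbT => /(_ isT)[].
Qed.

Lemma measurable_coord (J : pred (nat * nat)) j k : J (j, k) ->
  measurable_fun setT (fun f : wT R J => (f : W) j k).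
Proof.
move=> Jjk _ B mB; rewrite setTI; apply: sub_sigma_algebra.
exists [:: (j, k)], (fun=> B); split => //=; first by rewrite Jjk.
apply/seteqP; split => f /= h; last by have := h (j, k) (mem_head _ _).
by move=> x; rewrite inE => /eqP ->.
Qed.

Definition wmap d (T : measurableType d) (F : nat -> nat -> T -> R) (w : T) : W :=
  fun j k => F j k w.

Lemma measurable_wmap d (T : measurableType d) (F : nat -> nat -> T -> R) J :
  (forall j k, measurable_fun setT (F j k)) ->
  measurable_fun setT (wmap F : T -> wT R J).
Proof.
move=> mF; apply: (@measurability _ _ T (wT R J) setT (wmap F) (wcyl J) erefl).
move=> _ [_ [s [B [Js mB ->]]] <-]; rewrite setTI.
have -> : wmap F @^-1` [set f | forall x, x \in s -> B x (f x.1 x.2)] =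
    \bigcap_(x in [set x | x \in s]) (F x.1 x.2 @^-1` B x).
  by apply/seteqP; split => w /= h x xs; exact: h.
apply: fin_bigcap_measurable; first exact: finite_seq.
by move=> x _; rewrite -[X in measurable X]setTI; apply: mF.
Qed.

Section measurable_functionals.
Variable J : pred (nat * nat).
Implicit Types (s : seq nat).

Lemma measurable_Zw s :
  (forall j k, (j <= size s)%N -> (k <= size s)%N -> J (j, k)) ->
  measurable_fun setT (fun f : wT R J => Zw f s).
Proof.
move=> Js; apply: measurable_sum => j; apply: measurable_coord.
by apply: Js; [rewrite -ltnS|exact: count_size].
Qed.

Lemma measurable_pr s j : (j <= size s)%N ->
  (forall j k, (j <= size s)%N -> (k <= size s)%N -> J (j, k)) ->
  measurable_fun setT (fun f : wT R J => pr f s j).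
Proof.
move=> js Js; apply: measurable_funM; last first.
  by apply: measurable_funV => //; exact: measurable_Zw.
by apply: measurable_coord; apply: Js => //; exact: count_size.
Qed.

(** The locality that drives all uses of independence: apart from [g], n steps from the empty
    history consult only nodes and degrees below n. *)
Lemma measurable_Ex n (g : seq nat -> wT R J -> R) :
  (forall j k, (j < n)%N -> (k < n)%N -> J (j, k)) ->
  (forall s, s \in paths n -> measurable_fun setT (g s)) ->
  measurable_fun setT (fun f : wT R J => Ex f pred0 n (g^~ f) [::]).
Proof.
move=> Jn mg.
have -> : (fun f : wT R J => Ex f pred0 n (g^~ f) [::]) = (fun f : wT R J =>
    (* The membership test makes every summand measurable, also for [s] outside [paths n], about
       which nothing is assumed. *)
    \sum_(s <- paths n) (if s \in paths n then pw f s * g s f else 0))%R.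
  by apply/funext => f; rewrite Ex_pw big_seq big_mkcond.
apply: measurable_sum => s; case sp : (s \in paths n); last exact: measurable_cst.
apply: measurable_funM; last exact: mg.
rewrite /pw; apply: measurable_prod => i _.
have sn := size_paths sp; have ilt : (i < n)%N by rewrite -sn.
have szi : size (take i s) = i by rewrite size_takel// ltnW.
apply: measurable_pr; rewrite szi.
  move: sp; rewrite mem_paths => /andP[_ /allP h].
  by apply: h; rewrite mem_iota.
by move=> j k ji ki; apply: Jn; lia.
Qed.

End measurable_functionals.
End weight_space.

Section independence.
Context d (T : measurableType d) (R : realType) (P : probability T R).
Variable F : nat -> nat -> T -> R.
Hypothesis mF : forall j k, measurable_fun setT (F j k).
Hypothesis indF : mutually_independent P F.

Let wF := wmap F.

Lemma measurable_pre J (A : set (wT R J)) : measurable A -> measurable (wF @^-1` A).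
Proof.
by move=> mA; rewrite -[X in measurable X]setTI; exact: (@measurable_wmap _ _ _ F J mF measurableT _ mA).
Qed.

Lemma P_wcyl (s : seq (nat * nat)) (B : nat * nat -> set R) :
  (forall x, measurable (B x)) ->
  P (wF @^-1` [set f | forall x, x \in s -> B x (f x.1 x.2)]) =
  \prod_(x <- undup s) P (F x.1 x.2 @^-1` B x).
Proof.
move=> mB; rewrite -(indF (undup_uniq s) mB); congr (P _).
apply/seteqP; split => w /= h x.
  by rewrite /= mem_undup; exact: h.
by move=> xs; apply: h; rewrite /= mem_undup.
Qed.

Lemma P_wcylI J A C : wcyl J A -> wcyl (predC J) C ->
  P (wF @^-1` A `&` wF @^-1` C) = P (wF @^-1` A) * P (wF @^-1` C).
Proof.
move=> [s [B [/allP Js mB ->]]] [s' [B' [/allP Js' mB' ->]]].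
pose B'' x := if J x then B x else B' x.
have mB'' x : measurable (B'' x) by rewrite /B''; case: ifP.
have -> : wF @^-1` [set f | forall x, x \in s -> B x (f x.1 x.2)]
    `&` wF @^-1` [set f | forall x, x \in s' -> B' x (f x.1 x.2)]
  = wF @^-1` [set f | forall x, x \in s ++ s' -> B'' x (f x.1 x.2)].
  apply/seteqP; split => w /=.
    move=> [h h'] x; rewrite mem_cat /B'' => /orP[xs|xs].
      by rewrite Js//; exact: h.
    by have /= /negPf -> := Js' _ xs; exact: h'.
  move=> h; split => x xs.
    by have := h x; rewrite mem_cat xs /B'' Js//; apply.
  have := h x; rewrite mem_cat xs orbT /B''.
  by have /= /negPf -> := Js' _ xs; apply.
rewrite !P_wcyl// undup_cat big_cat /=; congr (_ * _).
  rewrite (_ : [seq x <- undup s | x \notin s'] = undup s).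
    rewrite big_seq [RHS]big_seq; apply: eq_bigr => x.
    by rewrite mem_undup /B'' => /Js ->.
  apply/all_filterP/allP => x; rewrite mem_undup => /Js Jx.
  by apply/negP => /Js' /=; rewrite Jx.
rewrite big_seq [RHS]big_seq; apply: eq_bigr => x.
by rewrite mem_undup /B'' => /Js' /= /negPf ->.
Qed.

Lemma integral_setE (q : T -> R) (A : set T) : measurable A ->
  \int[P]_(x in A) (q x)%:E = \int[P]_x (\1_A x * q x)%:E.
Proof.
move=> mA; rewrite integral_mkcond; apply: eq_integral => x _.
by rewrite patchE indicE; case: (_ \in _); rewrite ?mul1r ?mul0r.
Qed.

(** The pi-system argument runs twice: [step1] admits a general [g] against a fixed cylinder [C],
    and then [h] replaces the indicator of [C]. *)
Lemma integral_indep J (g h : weights R -> R) :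
  measurable_fun (setT : set (wT R J)) g ->
  measurable_fun (setT : set (wT R (predC J))) h ->
  (forall f, 0 <= g f)%R -> (forall f, 0 <= h f)%R ->
  \int[P]_w (g (wF w))%:E < +oo ->
  \int[P]_w (g (wF w) * h (wF w))%:E =
  (\int[P]_w (g (wF w))%:E) * (\int[P]_w (h (wF w))%:E).
Proof.
move=> mg mh g0 h0 goo.
have mgw : measurable_fun setT (fun w => g (wF w)).
  exact: (measurableT_comp mg (@measurable_wmap _ _ _ F J mF)).
have mhw : measurable_fun setT (fun w => h (wF w)).
  exact: (measurableT_comp mh (@measurable_wmap _ _ _ F (predC J) mF)).
have ig0 : 0 <= \int[P]_w (g (wF w))%:E.
  by apply: integral_ge0 => w _; rewrite lee_fin.
have gfin : \int[P]_w (g (wF w))%:E \is a fin_num by rewrite ge0_fin_numE.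
have step1 C : wcyl (predC J) C -> \int[P]_w (g (wF w) * \1_(wF @^-1` C) w)%:E
    = \int[P]_w (g (wF w) * fine (P (wF @^-1` C)))%:E.
  move=> cC; have mC : measurable (wF @^-1` C).
    by apply: (@measurable_pre (predC J)); exact: sub_sigma_algebra.
  apply: (@ge0_integralM_ext_pi _ _ _ P _ (wcyl J) (@wcylI _ J) (@wcylT _ J) wF) => //.
  - exact: measurable_wmap.
  - by move=> _; rewrite fine_ge0.
  - by rewrite integral_indic// setIT ltey_eq fin_num_measure.
  - move=> A cA; have mA : measurable (wF @^-1` A).
      by apply: (@measurable_pre J); exact: sub_sigma_algebra.
    rewrite integral_indic// integral_cst// setIC.
    apply: (etrans (P_wcylI cA cC)).
    by rewrite muleC fineK// fin_num_measure.
transitivity (\int[P]_w (h (wF w) * g (wF w))%:E).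
  by apply: eq_integral => w _; rewrite mulrC.
transitivity (\int[P]_w (h (wF w) * fine (\int[P]_w (g (wF w))%:E))%:E).
  apply: (@ge0_integralM_ext_pi _ _ _ P _ (wcyl (predC J)) (@wcylI _ _) (@wcylT _ _) wF) => //.
  - exact: measurable_wmap.
  - by move=> w; rewrite fine_ge0.
  - move=> C cC; have mC : measurable (wF @^-1` C).
      by apply: (@measurable_pre (predC J)); exact: sub_sigma_algebra.
    apply: (etrans (integral_setE (fun w => g (wF w)) mC)).
    transitivity (\int[P]_w (g (wF w) * \1_(wF @^-1` C) w)%:E).
      by apply: eq_integral => w _; rewrite mulrC.
    rewrite step1// integral_cst//.
    under eq_integral do rewrite mulrC EFinM.
    rewrite ge0_integralZl_EFin//; last 3 first.
    + by move=> w _; rewrite lee_fin.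
    + by apply/measurable_EFinP.
    + by rewrite fine_ge0.
    by rewrite muleC !fineK// fin_num_measure.
under eq_integral do rewrite mulrC EFinM.
rewrite ge0_integralZl_EFin//; last 3 first.
+ by move=> w _; rewrite lee_fin.
+ by apply/measurable_EFinP.
+ by rewrite fine_ge0.
by rewrite fineK.
Qed.

Hypothesis idF : forall j k (B : set R), measurable B ->
  P (F j k @^-1` B) = P (F 0%N k @^-1` B).

(** Independence and equal laws make the array exchangeable in the nodes. For an involution the
    preimage of a cylinder is again an explicit cylinder; only transpositions are applied later. *)
Lemma P_law (pi : nat -> nat) (A : set (weights R)) : involutive pi ->
  (wcyl predT).-sigma.-measurable A ->
  P (wmap (fun j => F (pi j)) @^-1` A) = P (wF @^-1` A).
Proof.
move=> piK.
have mF' j k : measurable_fun setT (F (pi j) k) by exact: mF.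
have mpre (A0 : set (wT R predT)) : measurable A0 ->
    measurable (wmap (fun j => F (pi j)) @^-1` A0).
  by move=> mA; rewrite -[X in measurable X]setTI; exact: (@measurable_wmap _ _ _ _ predT mF' measurableT _ mA).
apply: (@dynkin_induction _ (wT R predT) (wcyl predT)
  [set A | P (wmap (fun j => F (pi j)) @^-1` A) = P (wF @^-1` A)]) => //.
- exact: wcylI.
- move=> _ [s [B [_ mB ->]]] /=.
  have -> : wmap (fun j => F (pi j)) @^-1` [set f | forall x, x \in s -> B x (f x.1 x.2)]
    = wF @^-1` [set f | forall x, x \in [seq (pi x.1, x.2) | x <- s] ->
        B (pi x.1, x.2) (f x.1 x.2)].
    apply/seteqP; split => w /= h x.
      by case/mapP => y ys ->; rewrite /= piK -surjective_pairing; exact: h.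
    move=> xs; have := h (pi x.1, x.2); rewrite /= piK -surjective_pairing; apply.
    by apply/mapP; exists x.
  rewrite (P_wcyl _ (fun x => mB (pi x.1, x.2))) P_wcyl//.
  rewrite undup_map_inj; last first.
    by move=> [a b] [a' b'] /= [/(can_inj piK) -> ->].
  rewrite big_map; apply: eq_bigr => x _ /=; rewrite piK -surjective_pairing.
  by rewrite idF// [RHS]idF.
- move=> A0 mA0 /= e; rewrite 2!preimage_setC.
  have mA := @measurable_pre predT _ mA0.
  by rewrite (probability_setC P (mpre _ mA0)) (probability_setC P mA) e.
- move=> A0 mA0 tA0 /= e; rewrite !preimage_bigcup.
  rewrite !measure_bigcup//.
  + by apply: eq_eseriesr => i _; exact: e.
  + by move=> i _; exact: (@measurable_pre predT).
  + apply/trivIsetP => i j _ _ ij; rewrite -preimage_setI.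
    by move/trivIsetP : tA0 => ->//; rewrite preimage_set0.
  + by move=> i _; exact: mpre.
  + apply/trivIsetP => i j _ _ ij; rewrite -preimage_setI.
    by move/trivIsetP : tA0 => ->//; rewrite preimage_set0.
Qed.

End independence.

(** * From frozen weights to the probability space *)

Definition hist {T : Type} (par : nat -> T -> nat) (n : nat) (w : T) : seq nat :=
  [seq par i w | i <- iota 0 n].

Lemma size_hist T (par : nat -> T -> nat) n w : size (hist par n w) = n.
Proof. by rewrite size_map size_iota. Qed.

Lemma hist_rcons T (par : nat -> T -> nat) n w :
  hist par n.+1 w = rcons (hist par n w) (par n w).
Proof. by rewrite /hist -addn1 iotaD map_cat /= cats1. Qed.

Lemma nth_hist T (par : nat -> T -> nat) n w i :
  (i < n)%N -> nth 0%N (hist par n w) i = par i w.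
Proof. by move=> ilt; rewrite (nth_map 0%N) ?size_iota// nth_iota. Qed.

Lemma take_hist T (par : nat -> T -> nat) m n w :
  (m <= n)%N -> take m (hist par n w) = hist par m w.
Proof. by move=> mn; rewrite /hist -map_take take_iota (minn_idPl mn). Qed.

Lemma outdeg_hist T (par : nat -> T -> nat) u n w :
  outdeg (par^~ w) u n = count_mem u (hist par n w).
Proof. by rewrite /outdeg /hist count_map. Qed.

Section process.
Context d (T : measurableType d) (R : realType) (P : probability T R).
Variables (F : nat -> nat -> T -> R) (par : nat -> T -> nat).
Hypothesis mF : forall j k, measurable_fun setT (F j k).
Hypothesis F_gt0 : forall j k w, (0 < F j k w)%R.
Hypothesis gpa : gpa_tree P F par.

Let wF := wmap F.
Local Notation path n w := (hist par n w).

Lemma posF w : posw (wF w).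
Proof. by move=> j k; exact: F_gt0. Qed.

Lemma measurable_hist n s : measurable [set w | path n w = s].
Proof.
have -> : [set w | path n w = s] = if size s == n then
    \bigcap_(i in [set i | (i < n)%N]) [set w | par i w = nth 0%N s i] else set0.
  case: eqP => sn; apply/seteqP; split => w //=; last by move=> e; case: sn; rewrite -e size_hist.
    by move=> <- i /= ilt; rewrite nth_hist.
  move=> h; apply: (@eq_from_nth _ 0%N); rewrite size_hist// => i ilt.
  by rewrite nth_hist//; exact: h.
case: ifP => // _; apply: fin_bigcap_measurable => [|i _]; last exact: gpa.1.
exact: finite_II.
Qed.

Lemma measurable_hist_fun d' (U : measurableType d') n (g : seq nat -> T -> U) :
  (forall s, measurable_fun setT (g s)) ->
  measurable_fun setT (fun w => g (path n w) w).
Proof.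
move=> mg _ B mB; rewrite setTI.
have -> : (fun w => g (path n w) w) @^-1` B =
    \bigcup_(s : seq nat) ([set w | path n w = s] `&` (g s @^-1` B)).
  apply/seteqP; split => w /=; first by move=> ?; exists (path n w).
  by move=> [s _ [/= <-]].
apply: countable_bigcupT_measurable => // s; apply: measurableI.
  exact: measurable_hist.
by rewrite -[X in measurable X]setTI; apply: mg.
Qed.

(** The identity of [gpa_tree] says that, given all weights and the history s, the next parent is j
    with probability [pr]. Here the cylinder in the weights is replaced by an arbitrary nonnegative
    functional. *)
Let one_step (g : weights R -> R) n s j : size s = n -> (j <= n)%N ->
  measurable_fun (setT : set (wT R predT)) g -> (forall f, 0 <= g f)%R ->
  \int[P]_w (g (wF w) * \1_[set w | path n.+1 w = rcons s j] w)%:E =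
  \int[P]_w (g (wF w) * pr (wF w) s j * \1_[set w | path n w = s] w)%:E.
Proof.
move=> sn jn mg g0.
have mh := measurable_hist n s; have mh' := measurable_hist n.+1 (rcons s j).
have mpr : measurable_fun setT (fun w => pr (wF w) s j).
  apply: (@measurableT_comp _ _ _ _ (wT R predT) _ (fun f : wT R predT => pr f s j)).
    by apply: measurable_pr => //; rewrite sn.
  exact: measurable_wmap.
transitivity (\int[P]_w (g (wF w) * (pr (wF w) s j * \1_[set w | path n w = s] w))%:E);
  last by apply: eq_integral => w _; rewrite mulrA.
apply: (@ge0_integralM_ext_pi _ _ _ P _ (wcyl predT) (@wcylI _ _) (@wcylT _ _) wF) => //.
- exact: measurable_wmap.
- by apply: measurable_funM.
- by move=> w; rewrite mulr_ge0// ltW// pr_gt0//; exact: posF.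
- by rewrite integral_indic// setIT ltey_eq fin_num_measure.
- move=> _ [s' [B [_ mB ->]]]; set A := _ @^-1` _.
  have mA : measurable A.
    apply: (@measurable_pre _ _ _ F mF predT); apply: sub_sigma_algebra.
    by exists s', B; split => //; exact: all_predT.
  have := gpa.2 n j s' B (nth 0%N s) jn mB.
  have -> : cylinder F par n s' B (nth 0%N s) = A `&` [set w | path n w = s].
    apply/seteqP; split => w [h1 h2]; split => //.
      apply: (@eq_from_nth _ 0%N); rewrite size_hist// => i ilt.
      by rewrite nth_hist// h2.
    by move=> i ilt; rewrite -h2 nth_hist.
  have -> : A `&` [set w | path n w = s] `&` [set w | par n w = j] =
      [set w | path n.+1 w = rcons s j] `&` A.
    apply/seteqP; split => w /=.
      by move=> [[? <-] <-]; rewrite hist_rcons.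
    by rewrite hist_rcons => -[/rcons_inj[<- <-]].
  move=> e; rewrite integral_indic//; apply: (etrans e).
  rewrite integral_mkcondr; apply: eq_integral => w _.
  rewrite patchE indicE; case: (boolP (w \in _)) => [|_]; last by rewrite mulr0.
  rewrite inE /= => hs; rewrite mulr1 /pr /Zweight /Zw sn outdeg_hist hs.
  by congr (_ / _)%:E; apply: eq_bigr => i _; rewrite outdeg_hist hs.
Qed.

Lemma measurable_pw s n : s \in paths n ->
  measurable_fun (setT : set (wT R predT)) (fun f : weights R => pw f s).
Proof.
move=> sp; rewrite /pw; apply: measurable_prod => i _.
have sn := size_paths sp; have ilt : (i < n)%N by rewrite -sn.
have szi : size (take i s) = i by rewrite size_takel// ltnW.
apply: measurable_pr => //; rewrite szi.
by move: sp; rewrite mem_paths => /andP[_ /allP]; apply; rewrite mem_iota.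
Qed.

Lemma pw_ge0 w s : (0 <= pw (wF w) s)%R.
Proof. by apply: prodr_ge0 => i _; apply/ltW/pr_gt0/posF. Qed.

Lemma integral_hist (g : weights R -> R) n s : s \in paths n ->
  measurable_fun (setT : set (wT R predT)) g -> (forall f, 0 <= g f)%R ->
  \int[P]_w (g (wF w) * \1_[set w | path n w = s] w)%:E =
  \int[P]_w (g (wF w) * pw (wF w) s)%:E.
Proof.
elim: n g s => [|n IH] g s sp mg g0.
  apply: eq_integral => w _; move: sp; rewrite inE => /eqP ->.
  by rewrite indicE mem_set// /pw big_ord0.
case/lastP: s sp => [|s j]; first by rewrite nil_notin_paths.
rewrite rcons_in_paths => /andP[sp jn].
have sn := size_paths sp.
rewrite one_step//.
(* The induction hypothesis asks for nonnegativity at every array, and [pr] is nonnegative only at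
   positive ones; the absolute value changes nothing on the actual weights. *)
pose h (f : weights R) := (g f * `|pr f s j|)%R.
transitivity (\int[P]_w (h (wF w) * \1_[set w | path n w = s] w)%:E).
  by apply: eq_integral => w _; rewrite /h ger0_norm// ltW// pr_gt0//; exact: posF.
rewrite IH//.
- apply: eq_integral => w _; rewrite pw_rcons /h ger0_norm; first by congr (_%:E); ring.
  by rewrite ltW// pr_gt0//; exact: posF.
- apply: measurable_funM => //; apply: (measurableT_comp (@normr_measurable _ _)).
  by apply: measurable_pr => //; rewrite sn.
- by move=> f; rewrite mulr_ge0.
Qed.

Lemma indic_paths (h : seq nat -> R) n w : path n w \in paths n ->
  (\sum_(s <- paths n) h s * \1_[set w | path n w = s] w = h (path n w))%R.
Proof.
move=> wp; rewrite (bigD1_seq (path n w)) ?uniq_paths//= indicE mem_set//.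
rewrite mulr1 big1 ?addr0// => s sw; rewrite indicE memNset ?mulr0//= => e.
by rewrite e eqxx in sw.
Qed.

Lemma integral_Ex_sum (g : seq nat -> weights R -> R) n :
  (forall s, s \in paths n -> measurable_fun (setT : set (wT R predT)) (g s)) ->
  (forall s f, 0 <= g s f)%R ->
  \int[P]_w (\sum_(s <- paths n) g s (wF w) * \1_[set w | path n w = s] w)%R%:E =
  \int[P]_w (Ex (wF w) pred0 n (g^~ (wF w)) [::])%:E.
Proof.
move=> mg g0.
have comp (h : weights R -> R) : measurable_fun (setT : set (wT R predT)) h ->
    measurable_fun setT (fun w => h (wF w)).
  by move=> mh; exact: (measurableT_comp mh (@measurable_wmap _ _ _ F predT mF)).
transitivity (\int[P]_w \sum_(s <- paths n) if s \in paths n then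
    (g s (wF w) * \1_[set w | path n w = s] w)%:E else 0).
  by apply: eq_integral => w _; rewrite -sumEFin big_seq [LHS]big_mkcond.
transitivity (\int[P]_w \sum_(s <- paths n) if s \in paths n then
    (pw (wF w) s * g s (wF w))%:E else 0); last first.
  by apply: eq_integral => w _; rewrite Ex_pw -sumEFin [in RHS]big_seq [RHS]big_mkcond.
rewrite !ge0_integral_sum//.
- apply: eq_bigr => s _; case sp : (s \in paths n); last by rewrite !integral0.
  rewrite integral_hist//; last exact: mg.
  by apply: eq_integral => w _; rewrite mulrC.
- move=> s; case sp : (s \in paths n); last exact: measurable_cst.
  apply/measurable_EFinP; apply: measurable_funM.
    by apply: (comp (fun f => pw f s)); exact: measurable_pw sp.
  by apply: (comp (g s)); exact: mg.
- by move=> s w _; case: ifP => // _; rewrite lee_fin mulr_ge0// pw_ge0.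
- move=> s; case sp : (s \in paths n); last exact: measurable_cst.
  apply/measurable_EFinP; apply: measurable_funM; first by apply: (comp (g s)); exact: mg.
  by apply: measurable_indic; exact: measurable_hist.
- by move=> s w _; case: ifP => // _; rewrite lee_fin mulr_ge0.
Qed.

(** [gpa_tree] does not state that [par n] is at most n. It follows because the probabilities of the
    nodes up to n sum to 1, so that the legal histories already carry the full mass. *)
Lemma as_paths : {ae P, forall w, forall n, path n w \in paths n}.
Proof.
apply: ae_foralln => n.
have mn : measurable [set w | path n w \in paths n].
  have -> : [set w | path n w \in paths n] =
      \bigcup_(s in [set s | s \in paths n]) [set w | path n w = s].
    apply/seteqP; split => w /=; first by move=> ?; exists (path n w).
    by move=> [s /= sp ->].
  apply: fin_bigcup_measurable => [|s _]; last exact: measurable_hist.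
  exact: finite_seq.
have P1 : P [set w | path n w \in paths n] = 1.
  have := @integral_Ex_sum (fun _ _ => 1%R) n (fun _ _ => @measurable_cst _ _ _ _ _ _) (fun _ _ => ler01).
  have -> : \int[P]_w (Ex (wF w) pred0 n (fun=> 1%R) [::])%:E = 1.
    under eq_integral do rewrite (Ex_cst (posF _)).
    by rewrite integral_cst// mul1e; exact: probability_setT.
  move=> <-; transitivity (\int[P]_w (\1_[set w | path n w \in paths n] w)%:E).
    by rewrite integral_indic// setIT.
  apply: eq_integral => w _; congr (_%:E).
  have [wp|wp] := boolP (path n w \in paths n).
    by rewrite (indic_paths (fun=> 1%R) wp) indicE mem_set.
  rewrite indicE memNset; last by move=> /=; exact/negP.
  rewrite big_seq big1// => s sp; rewrite indicE memNset ?mulr0//= => e.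
  by rewrite e sp in wp.
exists (~` [set w | path n w \in paths n]); split => //; first exact: measurableC.
by apply: (etrans (probability_setC P mn)); rewrite P1 subee.
Qed.

Lemma integral_Ex (g : seq nat -> weights R -> R) n :
  (forall s, measurable_fun (setT : set (wT R predT)) (g s)) ->
  (forall s f, 0 <= g s f)%R ->
  \int[P]_w (g (path n w) (wF w))%:E =
  \int[P]_w (Ex (wF w) pred0 n (g^~ (wF w)) [::])%:E.
Proof.
move=> mg g0; rewrite -integral_Ex_sum//.
apply: ge0_ae_eq_integral => //.
- apply/measurable_EFinP; apply: (@measurable_hist_fun _ _ n (fun s w => g s (wF w))) => s.
  exact: (measurableT_comp (mg s) (@measurable_wmap _ _ _ F predT mF)).
- apply/measurable_EFinP; apply: measurable_sum => s; apply: measurable_funM.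
    exact: (measurableT_comp (mg s) (@measurable_wmap _ _ _ F predT mF)).
  by apply: measurable_indic; exact: measurable_hist.
- by move=> w _; rewrite lee_fin.
- by move=> w _; rewrite lee_fin sumr_ge0// => s _; rewrite mulr_ge0.
- apply: filterS as_paths => w wp _.
  by rewrite (indic_paths (fun s => g s (wF w)) (wp n)).
Qed.

End process.

Lemma ler_Ex_paths (R : realFieldType) (f : nat -> nat -> R) n g g' : posw f ->
  (forall s, s \in paths n -> g s <= g' s)%R ->
  (Ex f pred0 n g [::] <= Ex f pred0 n g' [::])%R.
Proof.
move=> f0 gg'; rewrite !Ex_pw big_seq [leRHS]big_seq; apply: ler_sum => s sp.
by rewrite ler_wpM2l ?gg'//; apply: prodr_ge0 => i _; exact/ltW/pr_gt0.
Qed.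

Lemma Ex_mul_prefix (R : realFieldType) (f : nat -> nat -> R) n (b g : seq nat -> R) s :
  posw f ->
  (Ex f pred0 n (fun s' => b (take (size s) s') * g s') s = b s * Ex f pred0 n g s)%R.
Proof.
move=> f0; apply/eqP; rewrite eq_le; apply/andP; split.
  rewrite -[leRHS]addr0 -[X in (_ <= _ + X)%R](mul0r (Ex f pred0 n g s)).
  rewrite -Ex_lin//; apply: ler_Ex0 => // s' _ ->; by rewrite mul0r addr0.
rewrite -[leLHS]addr0 -[X in (_ + X <= _)%R](mul0r (Ex f pred0 n g s)).
rewrite -Ex_lin//; apply: ler_Ex0 => // s' _ ->; by rewrite mul0r addr0.
Qed.

(** The Markov property at time n0, with a factor [b] known at that time. *)
Lemma Ex_split (R : realFieldType) (f : nat -> nat -> R) n0 n (b g : seq nat -> R) :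
  posw f ->
  (Ex f pred0 (n0 + n) (fun s => b (take n0 s) * g s) [::] =
   Ex f pred0 n0 (fun s => b s * Ex f pred0 n g s) [::])%R.
Proof.
move=> f0; rewrite Ex_pred0D; apply/eqP; rewrite eq_le.
by apply/andP; split; apply: ler_Ex_paths => // s sp;
  rewrite -(size_paths sp) Ex_mul_prefix.
Qed.

Section measurable_bool.
Context d (T : measurableType d) (R : realType).

Lemma measurable_natmulb (e : T -> bool) : measurable_fun setT e ->
  measurable_fun setT (fun w => (e w)%:R : R).
Proof.
move=> me; apply: (@measurableT_comp _ _ _ _ _ _ (fun b : bool => b%:R : R)) => //.
Qed.

Lemma measurable_setb (e : T -> bool) : measurable_fun setT e -> measurable [set w | e w].
Proof.
move=> me; rewrite -[X in measurable X]setTI.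
exact: (me measurableT [set true]).
Qed.

Lemma measurable_has (I : Type) (r : seq I) (e : I -> T -> bool) :
  (forall i, measurable_fun setT (e i)) ->
  measurable_fun setT (fun w => has (e^~ w) r).
Proof.
move=> me; elim: r => [|i r IH] /=; first exact: measurable_cst.
exact: measurable_or.
Qed.

End measurable_bool.

(** * Almost sure consequences of quenched stopped bounds *)

Section process.
Context d (T : measurableType d) (R : realType) (P : probability T R).
Variables (F : nat -> nat -> T -> R) (par : nat -> T -> nat).
Hypothesis mF : forall j k, measurable_fun setT (F j k).
Hypothesis F_gt0 : forall j k w, (0 < F j k w)%R.
Hypothesis gpa : gpa_tree P F par.

Let wF := wmap F.
Local Notation path n w := (hist par n w).
Local Notation wmeas h := (measurable_fun (setT : set (wT R predT)) h).
Let posF w : posw (wF w). Proof. exact: (posF F_gt0). Qed.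

Lemma measurable_path dU (U : measurableType dU) n (g : seq nat -> weights R -> U) :
  (forall s, wmeas (g s)) -> measurable_fun setT (fun w => g (path n w) (wF w)).
Proof.
move=> mg; apply: (@measurable_hist_fun _ _ _ _ _ _ gpa _ _ n (fun s w => g s (wF w))) => s.
exact: (measurableT_comp (mg s) (@measurable_wmap _ _ _ F predT mF)).
Qed.

Lemma P_bigcup_le (A : (set T)^nat) c : (forall n, measurable (A n)) ->
  nondecreasing_seq A -> (forall n, P (A n) <= c) -> P (\bigcup_n A n) <= c.
Proof.
move=> mA ndA Ac; apply: (cvge_to_le (f := P \o A) (a := \oo)).
  by apply: nondecreasing_cvg_mu => //; exact: bigcup_measurable.
exact: nearW.
Qed.

Lemma P_boolE (e : T -> bool) : measurable_fun setT e ->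
  P [set w | e w] = \int[P]_w ((e w)%:R)%:E.
Proof.
move=> me; transitivity (\int[P]_w (\1_[set w | e w] w)%:E).
  by rewrite integral_indic ?setIT//; exact: measurable_setb.
apply: eq_integral => w _; rewrite indicE; congr (_%:R%:E); congr nat_of_bool.
by apply/idP/idP; rewrite inE.
Qed.

Lemma measurable_hit (S : seq nat -> weights R -> bool) n0 s :
  (forall s, wmeas (S s)) -> wmeas (fun f => hit (S^~ f) n0 s).
Proof. by move=> mS; apply: measurable_has. Qed.

Lemma measurable_Ex_wF n (g : seq nat -> weights R -> R) :
  (forall s, wmeas (g s)) ->
  measurable_fun setT (fun w => (Ex (wF w) pred0 n (g^~ (wF w)) [::])%:E).
Proof.
move=> mg; apply/measurable_EFinP.
have mE : wmeas (fun f => Ex f pred0 n (g^~ f) [::]) by apply: measurable_Ex.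
exact: (measurableT_comp mE (@measurable_wmap _ _ _ F predT mF)).
Qed.

(** The quenched bound is uniform in the horizon n, and the events of a hit within n steps increase
    to that of a hit at any later time. *)
Lemma hit_le n0 (b S : seq nat -> weights R -> bool) (Y : seq nat -> weights R -> R) :
  (forall s, wmeas (b s)) -> (forall s, wmeas (S s)) -> (forall s, wmeas (Y s)) ->
  (forall s f, 0 <= Y s f)%R ->
  (forall w s n, s \in paths n0 -> b s (wF w) ->
    Ex (wF w) (S^~ (wF w)) n (fun s' => (S s' (wF w))%:R) s <= Y s (wF w))%R ->
  P [set w | b (path n0 w) (wF w) /\ exists2 m, (n0 <= m)%N & S (path m w) (wF w)]
  <= \int[P]_w ((b (path n0 w) (wF w))%:R * Y (path n0 w) (wF w))%:E.
Proof.
move=> mb mS mY Y0 bS.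
pose A n w := b (path n0 w) (wF w) && hit (S^~ (wF w)) n0 (path (n0 + n) w).
have mA n : measurable_fun setT (A n).
  apply: measurable_and; first exact: measurable_path.
  by apply: (@measurable_path _ _ _ (fun s f => hit (S^~ f) n0 s)) => s; exact: measurable_hit.
have -> : [set w | b (path n0 w) (wF w) /\ exists2 m, (n0 <= m)%N & S (path m w) (wF w)]
    = \bigcup_n [set w | A n w].
  apply/seteqP; split => w /=.
    move=> [bw [m n0m Sm]]; exists (m - n0)%N => //=; rewrite /A bw/=.
    apply/hitP; exists m; first by rewrite size_hist; lia.
    by rewrite take_hist//; lia.
  move=> [n _ /= /andP[bw /hitP[m]]]; rewrite size_hist => nm.
  by rewrite take_hist; [|lia]; split => //; exists m => //; lia.
pose g s f : R := ((b (take n0 s) f)%:R * (hit (S^~ f) n0 s)%:R)%R.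
have mg s : wmeas (g s).
  apply: measurable_funM; apply: measurable_natmulb => //.
  exact: measurable_hit.
have g0 s f : (0 <= g s f)%R by rewrite mulr_ge0.
have An n : P [set w | A n w] <=
    \int[P]_w ((b (path n0 w) (wF w))%:R * Y (path n0 w) (wF w))%:E.
  rewrite P_boolE//.
  have -> : \int[P]_w ((A n w)%:R)%:E = \int[P]_w (g (path (n0 + n) w) (wF w))%:E.
    by apply: eq_integral => w _; rewrite /A /g take_hist ?leq_addr// -mulnb natrM.
  rewrite (integral_Ex mF F_gt0 gpa _ mg)//.
  rewrite (integral_Ex mF F_gt0 gpa (g := fun s f => (b s f)%:R * Y s f)%R); last 2 first.
  - by move=> s; apply: measurable_funM => //; exact: measurable_natmulb.
  - by move=> s f; rewrite mulr_ge0.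
  apply: ge0_le_integral => //.
  - move=> w _; rewrite lee_fin -(Ex_cst (posF w) pred0 (n0 + n) 0%R [::]).
    exact: ler_Ex_paths.
  - exact: measurable_Ex_wF.
  - apply: (@measurable_Ex_wF _ (fun s f => (b s f)%:R * Y s f)%R) => s.
    by apply: measurable_funM => //; exact: measurable_natmulb.
  - move=> w _; rewrite lee_fin /g (@Ex_split _ _ n0 n (fun s => (b s (wF w))%:R)
      (fun s => (hit (S^~ (wF w)) n0 s)%:R))//; apply: ler_Ex_paths => // s sp.
    case: (boolP (b s (wF w))) => bs; rewrite ?mul0r// !mul1r.
    apply: le_trans (bS w s n sp bs).
    by rewrite -(size_paths sp); exact: Ex_hit.
have mA' n : measurable [set w | A n w] by exact: measurable_setb.
have ndA : nondecreasing_seq (fun n => [set w | A n w]).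
  move=> m n mn; apply/subsetPset => w /= /andP[bw /hitP[i]].
  rewrite size_hist => ni Si; rewrite /A bw /=; apply/hitP; exists i.
    by rewrite size_hist; lia.
  by move: Si; rewrite !take_hist//; lia.
exact: P_bigcup_le.
Qed.

Let mpath dU (U : measurableType dU) n (g : seq nat -> weights R -> U)
  (mg : forall s, wmeas (g s)) : measurable_fun setT (fun w => g (path n w) (wF w)) :=
  measurable_path n mg.

Lemma P_integral_cst (c : R) : \int[P]_w c%:E = c%:E.
Proof.
by rewrite integral_cst// -[RHS]mule1; congr (_ * _); exact: probability_setT.
Qed.

Lemma P_small0 (A : set T) : (forall n : nat, P A <= (n.+1%:R^-1)%:E) -> P A = 0.
Proof.
move=> h; apply/eqP; rewrite eq_le measure_ge0 andbT.
apply/lee_addgt0Pr => e e0; rewrite add0e.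
have [n en] := ltr_add_invr e0; rewrite add0r in en.
exact: le_trans (h n) (ltW _).
Qed.

Lemma measurable_hitset n0 (b S : seq nat -> weights R -> bool) :
  (forall s, wmeas (b s)) -> (forall s, wmeas (S s)) ->
  measurable [set w | b (path n0 w) (wF w) /\
    exists2 m, (n0 <= m)%N & S (path m w) (wF w)].
Proof.
move=> mb mS.
have -> : [set w | b (path n0 w) (wF w) /\ exists2 m, (n0 <= m)%N & S (path m w) (wF w)]
   = [set w | b (path n0 w) (wF w)] `&`
     \bigcup_(m in [set m | (n0 <= m)%N]) [set w | S (path m w) (wF w)].
  apply/seteqP; split => w /=; first by move=> [? [m ? ?]]; split => //; exists m.
  by move=> [? [m ? ?]]; split => //; exists m.
apply: measurableI; first by apply: measurable_setb; exact: (mpath _ mb).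
apply: bigcup_measurable => m _; apply: measurable_setb; exact: (mpath _ mS).
Qed.

(** The maximal inequality for nonnegative supermartingales, started at time n0 on the event [b].
    The starting value need not be integrable, so it is first cut at a level L, and then L exhausts
    all cases. *)
Lemma ae_supermart_bounded n0 (b : seq nat -> weights R -> bool)
    (Y : seq nat -> weights R -> R) :
  (forall s, wmeas (b s)) -> (forall s, wmeas (Y s)) -> (forall w s, 0 <= Y s (wF w))%R ->
  (forall w s, (n0 <= size s)%N -> b (take n0 s) (wF w) ->
     step (wF w) (Y^~ (wF w)) s <= Y s (wF w))%R ->
  {ae P, forall w, b (path n0 w) (wF w) ->
     exists a : R, forall m, (n0 <= m)%N -> (Y (path m w) (wF w) <= a)%R}.
Proof.
move=> mb mY Y0 sY.
pose bL (L : nat) s f := b s f && (Y s f <= L%:R)%R.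
pose S (a : nat) s f := (a.+1%:R < Y s f)%R.
pose E L a := [set w | bL L (path n0 w) (wF w) /\
    exists2 m, (n0 <= m)%N & S a (path m w) (wF w)].
have mbL L s : wmeas (bL L s).
  by apply: measurable_and => //; exact: measurable_fun_ler.
have mS a s : wmeas (S a s) by exact: measurable_fun_ltr.
have mE L a : measurable (E L a) by apply: measurable_hitset.
have PE L a : P (E L a) <= (L%:R / a.+1%:R)%:E.
  apply: (le_trans (@hit_le n0 (bL L) (S a)
    (fun s f => `|Y s f| / a.+1%:R)%R _ _ _ _ _)) => //.
  - move=> s; apply: measurable_funM => //.
    exact: (measurableT_comp (@normr_measurable _ _)).
  - move=> w s n sp /andP[bs YL].
    pose Inv s' := (n0 <= size s')%N && b (take n0 s') (wF w).
    have IS (s' : seq nat) (j : nat) : Inv s' -> ~~ S a s' (wF w) -> (j <= size s')%N -> Inv (rcons s' j).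
      move=> /andP[ns bs'] _ _; apply/andP; split; first by rewrite size_rcons leqW.
      by rewrite -cats1 takel_cat.
    have Is : Inv s.
      rewrite /Inv (size_paths sp) leqnn /= take_oversize//; by rewrite (size_paths sp).
    apply: (@le_trans _ _ (Ex (wF w) ((S a)^~ (wF w)) n
        (fun s' => a.+1%:R^-1 * Y s' (wF w) + 0 * Y s' (wF w))%R s)).
      apply: (ler_Ex (posF w) IS) => // s' _; rewrite mul0r addr0 /S.
      case: ltP => [aY|_]; last by rewrite mulr_ge0.
      by rewrite ler_pdivlMl// mulr1 ltW.
    rewrite Ex_lin// mul0r addr0 mulrC ger0_norm//.
    rewrite ler_wpM2r ?invr_ge0//; apply: (Ex_super (posF w) IS) => // s' /andP[n0s bs'] _.
    exact: sY.
  - apply: (@le_trans _ _ (\int[P]_w (L%:R / a.+1%:R)%:E)).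
      apply: ge0_le_integral => //.
      + apply/measurable_EFinP; apply: measurable_funM.
          by apply: measurable_natmulb; exact: (mpath _ (mbL L)).
        apply: measurable_funM => //.
        apply: (measurableT_comp (@normr_measurable _ _)); exact: (mpath _ mY).
      + move=> w _; rewrite lee_fin /bL; case: (boolP (b _ _ && _)) => [/andP[_ YL]|_].
          by rewrite mul1r ler_wpM2r ?invr_ge0// ger0_norm.
        by rewrite mul0r mulr_ge0.
    by rewrite P_integral_cst.
have N0 L : P.-negligible (\bigcap_a E L a).
  have mI : measurable (\bigcap_a E L a) by apply: bigcapT_measurable.
  apply: (iffRL (negligibleP _ mI)); apply: P_small0 => n.
  (* At this level the bound L / (L (n+1) + 1) is at most 1 / (n+1), also for L = 0. *)
  have : P (\bigcap_a E L a) <= P (E L (L * n.+1)%N).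
    by apply: le_measure; rewrite ?inE//; exact: bigcap_inf.
  move=> /le_trans; apply; apply: le_trans (PE _ _) _; rewrite lee_fin.
  by rewrite ler_pdivrMr// ler_pdivlMl// mulrC -natrM ler_nat leqW.
apply: negligibleS (negligible_bigcup N0) => w /= /not_implyP[bw h].
have [L YL] : exists L : nat, (Y (path n0 w) (wF w) <= L%:R)%R.
  by exists (Num.truncn (Y (path n0 w) (wF w))).+1; rewrite ltW// truncnS_gt.
exists L => // a _; split; first by rewrite /bL bw.
apply: contrapT => hm; apply: h; exists a.+1%:R => m nm.
rewrite leNgt; apply/negP => aY; apply: hm; by exists m.
Qed.

End process.

Lemma P_bigcap_le d (T : measurableType d) (R : realType) (P : probability T R)
  (D : (set T)^nat) c : (forall n, measurable (D n)) -> nonincreasing_seq D ->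
  P (\bigcap_n D n) < c -> exists n, P (D n) <= c.
Proof.
move=> mD niD Dc; apply: contrapT => h; move: Dc; apply/negP; rewrite -leNgt.
apply: (cvge_ge (f := P \o D) (F := \oo)).
  by apply: nearW => n; rewrite leNgt; apply/negP => /ltW Dn; apply: h; exists n.
apply: nonincreasing_cvg_mu => //.
- by rewrite ltey_eq fin_num_measure.
- exact: bigcapT_measurable.
Qed.

(** * A zero-one argument for events of the history *)

Section zero_one.
Context d (T : measurableType d) (R : realType) (P : probability T R).
Variables (F : nat -> nat -> T -> R) (par : nat -> T -> nat).
Hypothesis gpa : gpa_tree P F par.
Variable n1 : nat.

Local Notation path n w := (hist par n w).

Definition pathset n (beta : pred (seq nat)) := [set w | beta (path n w)].

Lemma measurable_pathset n beta : measurable (pathset n beta).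
Proof.
have -> : pathset n beta = \bigcup_(s in [set s | beta s]) [set w | path n w = s].
  apply/seteqP; split => w /=; first by move=> ?; exists (path n w).
  by move=> [s /= bs e]; rewrite /pathset /= e.
rewrite bigcup_mkcond; apply: countable_bigcupT_measurable => // s.
by case: ifP => // _; exact: (measurable_hist gpa).
Qed.

Lemma pathset_widen n m beta : (n <= m)%N ->
  pathset n beta = pathset m (fun s => beta (take n s)).
Proof. by move=> nm; apply/seteqP; split => w; rewrite /pathset /= take_hist. Qed.

Local Notation sdiff A B := ((A `\` B) `|` (B `\` A)).

(** The bound [n1] on the time costs nothing, since a history can be read off any longer one; it
    guarantees that the nodes in question have been born. *)
Definition path_approx (A : set T) := measurable A /\
  forall e : R, (0 < e)%R -> exists n beta, (n1 <= n)%N /\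
    P (sdiff A (pathset n beta)) <= e%:E.

Lemma path_approx_pathset n beta : path_approx (pathset n beta).
Proof.
split; first exact: measurable_pathset.
move=> e e0; exists (maxn n1 n), (fun s => beta (take n s)); split; first by rewrite leq_maxl.
by rewrite -pathset_widen ?leq_maxr// setDv setU0 measure0 lee_fin ltW.
Qed.

Lemma path_approxC A : path_approx A -> path_approx (~` A).
Proof.
move=> [mA hA]; split; first exact: measurableC.
move=> e /hA[n [beta [n1n h]]]; exists n, (predC beta); split => //.
have -> : pathset n (predC beta) = ~` pathset n beta.
  by apply/seteqP; split => w /=; rewrite /pathset /= => /negP.
by rewrite !setDE !setCK (setIC (~` A)) (setIC (~` pathset _ _)) setUC -!setDE.
Qed.

Lemma measurable_sdiff (A B : set T) : measurable A -> measurable B -> measurable (sdiff A B).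
Proof. by move=> mA mB; apply: measurableU; exact: measurableD. Qed.

Lemma path_approxU A A' : path_approx A -> path_approx A' -> path_approx (A `|` A').
Proof.
move=> [mA hA] [mA' hA']; split; first exact: measurableU.
move=> e e0; have e2 : (0 < e / 2)%R by rewrite divr_gt0.
have [n [beta [n1n h]]] := hA _ e2; have [n' [beta' [n1n' h']]] := hA' _ e2.
pose m := maxn n n'.
exists m, (fun s => beta (take n s) || beta' (take n' s)); split.
  by rewrite (leq_trans n1n)// leq_maxl.
have -> : pathset m (fun s => beta (take n s) || beta' (take n' s)) =
    pathset n beta `|` pathset n' beta'.
  rewrite (pathset_widen _ (leq_maxl n n')) (pathset_widen _ (leq_maxr n n')).
  by apply/seteqP; split => w /=; rewrite /pathset /= => /orP.
have mB := measurable_pathset n beta; have mB' := measurable_pathset n' beta'.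
apply: (@le_trans _ _ (P (sdiff A (pathset n beta) `|` sdiff A' (pathset n' beta')))).
  apply: le_measure; rewrite ?inE.
  - by apply: measurable_sdiff; exact: measurableU.
  - by apply: measurableU; exact: measurable_sdiff.
  - move=> w [[[Aw|Aw] /not_orP[h1 h2]]|[[Bw|Bw] /not_orP[h1 h2]]].
    + by left; left.
    + by right; left.
    + by left; right.
    + by right; right.
apply: (le_trans (@measureU2 _ _ _ P _ _ _ _)) => //; try exact: measurable_sdiff.
by rewrite (splitr e) EFinD; exact: leeD.
Qed.

Lemma path_approx_bigcup (A : (set T)^nat) :
  (forall i, path_approx (A i)) -> path_approx (\bigcup_i A i).
Proof.
move=> hA; have mA : measurable (\bigcup_i A i).
  by apply: bigcup_measurable => i _; exact: (hA i).1.
split=> // e e0; have e2 : (0 < e / 2)%R by rewrite divr_gt0.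
pose B n := \big[setU/set0]_(i < n) A i.
have hB n : path_approx (B n).
  rewrite /B; elim: n => [|n IH]; last by rewrite big_ord_recr; exact: path_approxU.
  rewrite big_ord0 (_ : set0 = pathset 0 pred0); last by apply/seteqP; split.
  exact: path_approx_pathset.
have [n hn] : exists n, P ((\bigcup_i A i) `\` B n) <= (e / 2)%:E.
  apply: P_bigcap_le.
  - by move=> n; apply: measurableD => //; exact: (hB n).1.
  - move=> m n mn; apply/subsetPset => w [Aw Bw]; split => //.
    by move: Bw; apply: contra_not; exact: subset_bigsetU.
  - rewrite (_ : \bigcap_n _ = set0) ?measure0 ?lte_fin//.
    apply/seteqP; split => // w h; have [[i _ Ai] _] := h 0%N I.
    have [_ +] := h i.+1 I; apply; rewrite /B big_ord_recr /=; by right.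
have [m [beta [n1m h]]] := (hB n).2 _ e2.
exists m, beta; split => //; have mB := measurable_pathset m beta.
have mBn := (hB n).1.
apply: (@le_trans _ _ (P (((\bigcup_i A i) `\` B n) `|` sdiff (B n) (pathset m beta)))).
  apply: le_measure; rewrite ?inE.
  - exact: measurable_sdiff.
  - by apply: measurableU; [exact: measurableD|exact: measurable_sdiff].
  - move=> w [[Aw nb]|[bw nA]].
      by have [Bw|Bw] := pselect (B n w); [right; left|left].
    right; right; split => // Bw; apply: nA.
    move: Bw; rewrite /B -bigcup_mkord => -[i _ Ai]; by exists i.
apply: (le_trans (@measureU2 _ _ _ P _ _ _ _)) => //; try exact: measurable_sdiff.
  exact: measurableD.
by rewrite (splitr e) EFinD; exact: leeD.
Qed.

Lemma path_approx_bigcap (A : (set T)^nat) :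
  (forall i, path_approx (A i)) -> path_approx (\bigcap_i A i).
Proof.
move=> hA; rewrite -[X in path_approx X]setCK setC_bigcap.
by apply: path_approxC; apply: path_approx_bigcup => i; exact: path_approxC.
Qed.

(** If B is within e' of A, then c P(A) <= c P(B) + c e' <= P(B \ A) + c e' <= (1 + c) e', whence
    the choice e' = e / (1 + c). *)
Lemma path_zero_one (A : set T) (c : R) : (0 < c)%R -> path_approx A ->
  (forall n beta, (n1 <= n)%N -> c%:E * P (pathset n beta) <= P (pathset n beta `\` A)) ->
  P A = 0.
Proof.
move=> c0 [mA hA] h; apply/eqP; rewrite eq_le measure_ge0 andbT.
suff : c%:E * P A <= 0 by rewrite pmule_rle0// lte_fin.
apply/lee_addgt0Pr => e e0; rewrite add0e.
have e1 : (0 < e / (1 + c))%R by rewrite divr_gt0// addr_gt0.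
have [n [beta [n1n hn]]] := hA _ e1; have mB := measurable_pathset n beta.
have le1 : P A <= P (pathset n beta) + (e / (1 + c))%:E.
  apply: (@le_trans _ _ (P (pathset n beta `|` sdiff A (pathset n beta)))).
    apply: le_measure; rewrite ?inE//.
      by apply: measurableU => //; exact: measurable_sdiff.
    by move=> w Aw; have [?|?] := pselect (pathset n beta w); [left|right; left].
  apply: (le_trans (@measureU2 _ _ _ P _ _ _ _)) => //; first exact: measurable_sdiff.
  exact: leeD2l.
apply: (@le_trans _ _ (c%:E * (P (pathset n beta) + (e / (1 + c))%:E))).
  by rewrite lee_pmul2l// lte_fin.
rewrite ge0_muleDr//; last by rewrite lee_fin ltW.
apply: (@le_trans _ _ ((e / (1 + c))%:E + c%:E * (e / (1 + c))%:E)).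
  apply: leeD2r; apply: (le_trans (h n beta n1n)); apply: le_trans hn.
  apply: le_measure; rewrite ?inE; [exact: measurableD|exact: measurable_sdiff|].
  by right.
rewrite -EFinM -EFinD lee_fin le_eqVlt; apply/orP; left; apply/eqP.
by field; rewrite gt_eqF// addr_gt0.
Qed.

End zero_one.

Section measurable_functionals.
Context {R : realType}.
Variable J : pred (nat * nat).
Local Notation wmeas h := (measurable_fun (setT : set (wT R J)) h).
Implicit Types (s : seq nat).

Lemma measurable_ratio lam u k : J (u, k) -> wmeas (fun f : weights R => ratio f lam u k).
Proof.
move=> Juk; apply: measurable_funM; first exact: measurable_coord.
apply: measurable_funV => //; apply: measurable_funD => //; exact: measurable_coord.
Qed.

Lemma measurable_Hrec (e : weights R -> nat -> R) n k :
  (forall j, (k <= j)%N -> wmeas (fun f => e f j)) ->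
  wmeas (fun f => Hrec (e f) n k).
Proof.
elim: n k => [|n IH] k me; first exact: measurable_cst.
apply: measurable_funM; first exact: me.
by apply: measurable_funD => //; apply: IH => j kj; apply: me; exact: ltnW.
Qed.

Lemma measurable_CS lam s :
  (forall j k, (j < size s)%N -> (k < size s)%N -> J (j, k)) ->
  wmeas (fun f : weights R => CS f lam s).
Proof.
move=> Js; apply: measurable_prod => i _.
have sz : size (take i s) = i by rewrite size_takel// ltnW.
have mZ : wmeas (fun f : weights R => Zw f (take i s)).
  apply: measurable_Zw; rewrite sz => j k ji ki; have := ltn_ord i.
  by move=> ilt; apply: Js; lia.
apply: measurable_funM => //; apply: measurable_funV => //.
exact: measurable_funD.
Qed.

Lemma measurable_tS s :
  (forall j k, (j < size s)%N -> (k < size s)%N -> J (j, k)) ->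
  wmeas (fun f : weights R => tS f s).
Proof.
move=> Js; apply: measurable_sum => i.
have sz : size (take i s) = i by rewrite size_takel// ltnW.
apply: measurable_funV => //; apply: measurable_Zw; rewrite sz => j k ji ki.
by have := ltn_ord i; move=> ilt; apply: Js; lia.
Qed.

Lemma measurable_Pot lam M s : J =1 predT -> wmeas (fun f : weights R => Pot f lam M s).
Proof.
move=> JT; apply: measurable_funM => //; apply: measurable_funM.
  by apply: measurable_CS => *; rewrite JT.
apply: measurable_sum => p; apply: measurable_Hrec => j _.
by apply: measurable_ratio; rewrite JT.
Qed.

End measurable_functionals.

(** * Mean discounts and the divergence of the clock *)

Section discount.
Context d (T : measurableType d) (R : realType) (P : probability T R).
Variables (F : nat -> nat -> T -> R) (par : nat -> T -> nat).
Hypothesis mF : forall j k, measurable_fun setT (F j k).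
Hypothesis F_gt0 : forall j k w, (0 < F j k w)%R.
Hypothesis indF : mutually_independent P F.
Hypothesis idF : forall j k (B : set R), measurable B ->
  P (F j k @^-1` B) = P (F 0%N k @^-1` B).
Hypothesis gpa : gpa_tree P F par.

Let wF := wmap F.
Local Notation path n w := (hist par n w).
Local Notation wmeas h := (measurable_fun (setT : set (wT R predT)) h).
Let posF w : posw (wF w). Proof. exact: (posF F_gt0). Qed.
Let mpath dU (U : measurableType dU) n (g : seq nat -> weights R -> U)
  (mg : forall s, wmeas (g s)) : measurable_fun setT (fun w => g (path n w) (wF w)) :=
  measurable_path mF gpa n mg.

(** Quenched quantities are nonnegative only at positive arrays. Passing to absolute values leaves
    them unchanged on the image of [wF]; the same device serves in [integral_Ex_pos]. *)
Lemma integral_indep_pos J (g h : weights R -> R) :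
  measurable_fun (setT : set (wT R J)) g ->
  measurable_fun (setT : set (wT R (predC J))) h ->
  (forall w, 0 <= g (wF w))%R -> (forall w, 0 <= h (wF w))%R ->
  \int[P]_w (g (wF w))%:E < +oo ->
  \int[P]_w (g (wF w) * h (wF w))%:E =
  (\int[P]_w (g (wF w))%:E) * (\int[P]_w (h (wF w))%:E).
Proof.
move=> mg mh g0 h0 goo.
have mn := @normr_measurable R setT.
have eg : \int[P]_w (`|g (wF w)|%R)%:E = \int[P]_w (g (wF w))%:E.
  by apply: eq_integral => w _; rewrite ger0_norm.
have eh : \int[P]_w (`|h (wF w)|%R)%:E = \int[P]_w (h (wF w))%:E.
  by apply: eq_integral => w _; rewrite ger0_norm.
transitivity (\int[P]_w (`|g (wF w)| * `|h (wF w)|)%:E).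
  by apply: eq_integral => w _; rewrite !ger0_norm.
rewrite -eg -eh; apply: (@integral_indep _ _ _ P F mF indF J
  (fun f => `|g f|)%R (fun f => `|h f|)%R) => //.
- exact: (measurableT_comp mn mg).
- exact: (measurableT_comp mn mh).
- by rewrite -/wF eg.
Qed.

Lemma integral_Ex_pos (g : seq nat -> weights R -> R) n :
  (forall s, wmeas (g s)) -> (forall s w, 0 <= g s (wF w))%R ->
  \int[P]_w (g (path n w) (wF w))%:E =
  \int[P]_w (Ex (wF w) pred0 n (g^~ (wF w)) [::])%:E.
Proof.
move=> mg g0; have mn := @normr_measurable R setT.
have := @integral_Ex _ _ _ P F par mF F_gt0 gpa (fun s f => `|g s f|)%R n
  (fun s => measurableT_comp mn (mg s)) (fun s f => normr_ge0 _).
move=> e; transitivity (\int[P]_w (`|g (path n w) (wF w)|%R)%:E).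
  by apply: eq_integral => w _; rewrite ger0_norm.
rewrite e; apply: eq_integral => w _; congr (_%:E); apply: eq_Ex => s.
by rewrite ger0_norm//; exact: g0.
Qed.

Lemma integral_id (phi : R -> R) j k : measurable_fun setT phi -> (forall y, 0 <= phi y)%R ->
  \int[P]_w (phi (F j k w))%:E = \int[P]_w (phi (F 0%N k w))%:E.
Proof.
move=> mphi phi0.
have mE : measurable_fun setT (EFin \o phi) by exact/measurable_EFinP.
have e i : \int[P]_w (phi (F i k w))%:E = \int[pushforward P (F i k)]_y (phi y)%:E.
  by rewrite ge0_integral_pushforward// => y _; rewrite lee_fin.
rewrite !e; apply: eq_measure_integral => A mA _; exact: idF.
Qed.

Definition er (lam : R) k := fine (\int[P]_w (ratio (wF w) lam 0 k)%:E).

Section fixed_lam.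
Variable lam : R.
Hypothesis lam0 : (0 < lam)%R.

Let ratio0 w u k : (0 <= ratio (wF w) lam u k)%R.
Proof. by apply: ratio_ge0. Qed.

Let ratio1 w u k : (ratio (wF w) lam u k <= 1)%R.
Proof.
rewrite /ratio ler_pdivrMr ?mul1r ?lerDl ?(ltW lam0)// addr_gt0//; exact: posF.
Qed.

Let mratio u k : wmeas (fun f : weights R => ratio f lam u k).
Proof. exact: measurable_ratio. Qed.

Let mcomp (h : weights R -> R) : wmeas h -> measurable_fun setT (fun w => h (wF w)).
Proof. by move=> mh; exact: (measurableT_comp mh (@measurable_wmap _ _ _ F predT mF)). Qed.

Lemma integral_ratio u k : \int[P]_w (ratio (wF w) lam u k)%:E = (er lam k)%:E.
Proof.
have e j : \int[P]_w (ratio (wF w) lam j k)%:E =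
    \int[P]_w ((fun y => `|y / (y + lam)|)%R (F j k w))%:E.
  by apply: eq_integral => w _; rewrite ger0_norm//; exact: ratio0.
rewrite /er fineK.
  rewrite !e; apply: (integral_id (phi := fun y => `|y / (y + lam)|%R)) => //.
  apply: (measurableT_comp (@normr_measurable _ _)).
  apply: measurable_funM => //; apply: measurable_funV => //; exact: measurable_funD.
rewrite ge0_fin_numE; last by apply: integral_ge0 => w _; rewrite lee_fin.
apply: (@le_lt_trans _ _ (\int[P]_w 1%:E)); last by rewrite P_integral_cst ltry.
apply: ge0_le_integral => //.
- by move=> w _; rewrite lee_fin.
- by apply/measurable_EFinP; apply: (mcomp (mratio 0 k)).
- by move=> w _; rewrite lee_fin.
Qed.

Lemma er_ge0 k : (0 <= er lam k)%R.
Proof. by rewrite /er fine_ge0// integral_ge0// => w _; rewrite lee_fin. Qed.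

(** The factor at degree k is independent of the rest, which involves only degrees above k, so the
    mean satisfies the recursion with the mean ratios. *)
Lemma integral_Hrec u n k :
  \int[P]_w (Hrec (ratio (wF w) lam u) n k)%:E = (Hrec (er lam) n k)%:E.
Proof.
elim: n k => [|n IH] k /=; first by rewrite integral0.
rewrite (@integral_indep_pos (fun x => x.2 <= k)%N (fun f => ratio f lam u k)
  (fun f => 1 + Hrec (ratio f lam u) n k.+1)%R).
- rewrite integral_ratio EFinM; congr (_ * _).
  under eq_integral do rewrite EFinD.
  rewrite ge0_integralD//.
  + by rewrite P_integral_cst IH.
  + by move=> w _; rewrite lee_fin; apply: Hrec_ge0 => j.
  + apply/measurable_EFinP; apply: (mcomp (h := fun f => Hrec (ratio f lam u) n k.+1)).
    by apply: measurable_Hrec => j _.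
- exact: measurable_ratio.
- apply: measurable_funD => //; apply: measurable_Hrec => j kj.
  by apply: measurable_ratio => /=; rewrite -ltnNge.
- by move=> w; exact: ratio0.
- by move=> w; rewrite addr_ge0// Hrec_ge0// => j; exact: ratio0.
- by rewrite integral_ratio ltry.
Qed.

Section potential.
Variable M : nat.
Hypothesis M0 : (0 < M)%N.

Definition dmass n := \int[P]_w ((alive M (path n w))%:R * CS (wF w) lam (path n.+1 w))%:E.

(** The next factor of the discount depends on the present history alone; the appended 0 is a
    placeholder for any parent. *)
Let CS' (f : weights R) s := CS f lam (rcons s 0%N).

Let CS'E w n : CS (wF w) lam (path n.+1 w) = CS' (wF w) (path n w).
Proof. by rewrite hist_rcons /CS' !CS_rcons. Qed.

Let mCS' s : wmeas (CS'^~ s).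
Proof. by apply: measurable_CS. Qed.

Let CS'0 w s : (0 <= CS' (wF w) s)%R.
Proof. by apply/ltW/CS_gt0 => //; exact: posF. Qed.

Let CS'1 w s : (CS' (wF w) s <= 1)%R.
Proof. by apply/CS_le1 => //; exact: posF. Qed.

Let Pot0 w s : (0 <= Pot (wF w) lam M s)%R.
Proof.
rewrite /Pot mulr_ge0// mulr_ge0//; first by apply/ltW/CS_gt0 => //; exact: posF.
by apply: sumr_ge0 => p _; apply: Hu_ge0 => //; exact: posF.
Qed.

Let pot n := \int[P]_w (Pot (wF w) lam M (path n w))%:E.

Lemma dmass_le1 n : dmass n <= 1.
Proof.
rewrite -(P_integral_cst P 1); apply: ge0_le_integral => //.
- by move=> w _; rewrite lee_fin mulr_ge0// CS'E.
- under eq_fun do rewrite CS'E.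
  apply/measurable_EFinP; apply: measurable_funM.
    apply: measurable_natmulb.
    by apply: (@mpath _ _ _ (fun s _ => alive M s)).
  exact: (mpath _ mCS').
- move=> w _; rewrite lee_fin CS'E mulr_ile1//.
  by rewrite lern1 leq_b1.
Qed.

Lemma dmass_ge0 n : 0 <= dmass n.
Proof. by apply: integral_ge0 => w _; rewrite lee_fin mulr_ge0// CS'E. Qed.

(** The potential brought in by node n+1 depends on the weights of that node only, while the
    discounted mass involves nodes up to n; by independence its mean factors out. *)
Lemma pot_step n : pot n.+1 + dmass n <= pot n + dmass n * (Hrec (er lam) M 0)%:E.
Proof.
pose g s f : R := ((alive M s)%:R * CS' f s)%R.
pose H (f : weights R) := Hu f lam M n.+1 0.
have mg s : wmeas (g s) by apply: measurable_funM.
have g0 s w : (0 <= g s (wF w))%R by rewrite mulr_ge0.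
have mPot s : wmeas (fun f : weights R => Pot f lam M s) by exact: measurable_Pot.
have mH : wmeas H by apply: measurable_Hrec => j _; exact: measurable_ratio.
have H0 w : (0 <= H (wF w))%R by apply: Hu_ge0 => //; exact: posF.
have eP m : pot m = \int[P]_w (Ex (wF w) pred0 m (Pot (wF w) lam M) [::])%:E.
  exact: (@integral_Ex_pos (fun s f => Pot f lam M s)).
have ed : dmass n = \int[P]_w (Ex (wF w) pred0 n (g^~ (wF w)) [::])%:E.
  rewrite -(integral_Ex_pos n mg)//.
  by apply: eq_integral => w _; rewrite /g CS'E.
have Ex0 m (h : seq nat -> R) w : (forall s, 0 <= h s)%R -> (0 <= Ex (wF w) pred0 m h [::])%R.
  by move=> h0; rewrite -(Ex_cst (posF w) pred0 m 0%R [::]); exact: ler_Ex_paths.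
have edH : dmass n * (Hrec (er lam) M 0)%:E =
    \int[P]_w (Ex (wF w) pred0 n (g^~ (wF w)) [::] * H (wF w))%:E.
  rewrite (@integral_indep_pos (fun x => x.1 <= n)%N
    (fun f => Ex f pred0 n (g^~ f) [::]) H)//.
  - rewrite -ed; congr (_ * _); rewrite /H /Hu subn0; exact/esym/integral_Hrec.
  - apply: measurable_Ex => [j k jn _|s sp]; first exact: ltnW.
    apply: measurable_funM => //; apply: measurable_CS => j k.
    by rewrite size_rcons (size_paths sp).
  - apply: measurable_Hrec => j _; apply: measurable_ratio => /=; by rewrite ltnn.
  - by move=> w; apply: Ex0 => s; exact: g0.
  - by rewrite -ed (le_lt_trans (dmass_le1 n))// ltry.
have mE m (h : seq nat -> weights R -> R) : (forall s, wmeas (h s)) ->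
    measurable_fun setT (fun w => (Ex (wF w) pred0 m (h^~ (wF w)) [::])%:E).
  by move=> mh; exact: (measurable_Ex_wF mF).
rewrite edH ed !eP -!ge0_integralD//; last 8 first.
- by move=> w _; rewrite lee_fin; apply: Ex0 => s; exact: Pot0.
- exact: (mE n (fun s f => Pot f lam M s)).
- by move=> w _; rewrite lee_fin mulr_ge0//; apply: Ex0 => s; exact: g0.
- apply/measurable_EFinP; apply: measurable_funM; last exact: mcomp.
  by apply/measurable_EFinP; exact: mE.
- by move=> w _; rewrite lee_fin; apply: Ex0 => s; exact: Pot0.
- exact: (mE n.+1 (fun s f => Pot f lam M s)).
- by move=> w _; rewrite lee_fin; apply: Ex0 => s; exact: g0.
- exact: mE.
apply: ge0_le_integral => //.
- by move=> w _; rewrite -EFinD lee_fin addr_ge0//; apply: Ex0 => s; [exact: Pot0|exact: g0].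
- by apply: emeasurable_funD; [exact: (mE n.+1 (fun s f => Pot f lam M s))|exact: mE].
- apply: emeasurable_funD; first exact: (mE n (fun s f => Pot f lam M s)).
  apply/measurable_EFinP; apply: measurable_funM; last exact: mcomp.
  by apply/measurable_EFinP; exact: mE.
move=> w _; rewrite -!EFinD lee_fin Ex_recr [(_ * H _)%R]mulrC.
rewrite -[X in (X + _ <= _)%R]mul1r -[X in (_ + X <= _)%R]mul1r.
rewrite -[X in (_ <= X + _)%R]mul1r -!Ex_lin//; try exact: posF.
apply: ler_Ex_paths => // s sp; rewrite !mul1r /g.
have := @step_Pot _ (wF w) (posF w) lam lam0 M M0 s 0%N.
rewrite -/(CS' (wF w) s) (size_paths sp) -/(H (wF w)) [(H _ * _)%R]mulrC; apply.
apply/count_memPn; apply/negP => /(nthP 0%N)[i]; rewrite (size_paths sp) => ilt e.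
move: sp; rewrite mem_paths => /andP[_ /allP /(_ i)].
by rewrite mem_iota /= e => /(_ ilt); lia.
Qed.

End potential.
End fixed_lam.
Let mcomp (h : weights R -> R) : wmeas h -> measurable_fun setT (fun w => h (wF w)).
Proof. by move=> mh; exact: (measurableT_comp mh (@measurable_wmap _ _ _ F predT mF)). Qed.

(** A newborn brings in at most half of the mass that its birth removes, so each step lowers the
    nonnegative mean potential by at least [dmass / 2], and the initial value is r <= 1/2. *)
Lemma dmass_sum lam M N : (0 < lam)%R -> (0 < M)%N ->
  (Hrec (er lam) M 0 <= 1 / 2)%R -> (\sum_(n < N) fine (dmass lam M n) <= 1)%R.
Proof.
move=> lam0 M0 rho; set r := Hrec _ _ _ in rho.
pose pot n := \int[P]_w (Pot (wF w) lam M (path n w))%:E.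
have r0 : (0 <= r)%R by apply: Hrec_ge0 => j; exact: er_ge0.
have pot0 n : 0 <= pot n.
  apply: integral_ge0 => w _; rewrite lee_fin /Pot mulr_ge0// mulr_ge0//.
    by apply/ltW/CS_gt0 => //; exact: posF.
  by apply: sumr_ge0 => p _; apply: Hu_ge0 => //; exact: posF.
have d0 n := dmass_ge0 lam0 M n.
have d1 n := dmass_le1 lam0 M n.
have dfin n : dmass lam M n \is a fin_num.
  by rewrite ge0_fin_numE// (le_lt_trans (d1 n))// ltry.
have step n : pot n.+1 + dmass lam M n <= pot n + dmass lam M n * r%:E.
  exact: pot_step.
have pot00 : pot 0%N = r%:E.
  rewrite -(integral_Hrec lam0 0); apply: eq_integral => w _.
  by rewrite /Pot /HS /CS /= big_ord0 big_ord1 !mul1r /Hu subn0.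
have pfin n : pot n \is a fin_num.
  elim: n => [|n IH]; first by rewrite pot00.
  rewrite ge0_fin_numE//; apply: le_lt_trans (leeDl (pot n.+1) (d0 n)) _.
  by apply: le_lt_trans (step n) _; rewrite ltey_eq fin_numD IH fin_numM.
have stepR n : (fine (pot n.+1) + fine (dmass lam M n) <=
    fine (pot n) + fine (dmass lam M n) * r)%R.
  by rewrite -lee_fin !EFinD EFinM !fineK.
have dR n : (0 <= fine (dmass lam M n))%R by rewrite fine_ge0.
have pR n : (0 <= fine (pot n))%R by rewrite fine_ge0.
have key : (\sum_(n < N) fine (dmass lam M n) + 2 * fine (pot N) <= 2 * r)%R.
  elim: N => [|N IH]; first by rewrite big_ord0 add0r pot00.
  rewrite big_ord_recr /=; have := stepR N; have := dR N; nra.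
have := pR N; lra.
Qed.

(** While the clock stays below B, [CS] stays above exp(- lam B); with positive probability this
    contradicts the summable means. [al] will be [alive M] in part 1 and always true in part 2. *)
Lemma ae_tS_unbounded_summable (lam : R) (al : pred (seq nat)) : (0 < lam)%R ->
  (forall N, \sum_(n < N) fine (\int[P]_w ((al (path n w))%:R
    * CS (wF w) lam (path n.+1 w))%:E) <= 1)%R ->
  {ae P, forall w, (forall n, al (path n w)) ->
     forall B, exists n, (B < tS (wF w) (path n w))%R}.
Proof.
move=> lam0 rho; pose dm n := \int[P]_w ((al (path n w))%:R * CS (wF w) lam (path n.+1 w))%:E.
pose A (B : nat) := \bigcap_n [set w | al (path n w) &&
  (tS (wF w) (path n.+1 w) <= B%:R)%R].
have mb n B : measurable_fun setT (fun w => al (path n w) &&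
    (tS (wF w) (path n.+1 w) <= B%:R)%R).
  apply: measurable_and; first exact: (@mpath _ _ n (fun s _ => al s)).
  apply: measurable_fun_ler => //.
  by apply: (@mpath _ _ n.+1 (fun s f => tS f s)) => s; exact: measurable_tS.
have mA B : measurable (A B).
  by apply: bigcapT_measurable => n; apply: measurable_setb.
have A0 B : P (A B) = 0.
  pose c := expR (- (lam * B%:R)); have c0 : (0 < c)%R by exact: expR_gt0.
  have Pfin : P (A B) \is a fin_num by rewrite fin_num_measure.
  have le n : (c * fine (P (A B)) <= fine (dm n))%R.
    have dfin : dm n \is a fin_num.
      rewrite ge0_fin_numE; last first.
        by apply: integral_ge0 => w _; rewrite lee_fin mulr_ge0//; apply/ltW/CS_gt0.
      apply: (@le_lt_trans _ _ (\int[P]_w 1%:E)); last by rewrite P_integral_cst ltry.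
      apply: ge0_le_integral => //.
      - by move=> w _; rewrite lee_fin mulr_ge0//; apply/ltW/CS_gt0.
      - apply/measurable_EFinP; apply: measurable_funM.
          by apply: measurable_natmulb; exact: (@mpath _ _ n (fun s _ => al s)).
        by apply: (@mpath _ _ n.+1 (fun s f => CS f lam s)) => s; exact: measurable_CS.
      - move=> w _; rewrite lee_fin mulr_ile1// ?lern1 ?leq_b1//.
          by apply/ltW/CS_gt0.
        exact: CS_le1.
    rewrite -lee_fin EFinM !fineK//.
    have -> : c%:E * P (A B) = \int[P]_w (c * \1_(A B) w)%:E.
      under eq_integral do rewrite EFinM.
      rewrite ge0_integralZl_EFin//; last 2 first.
      + by apply/measurable_EFinP; exact: measurable_indic.
      + exact: ltW.
      by rewrite integral_indic// setIT.
    have mCS : measurable_fun setT (fun w => CS (wF w) lam (path n.+1 w)).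
      by apply: (@mpath _ _ n.+1 (fun s f => CS f lam s)) => s; exact: measurable_CS.
    apply: ge0_le_integral => //.
    - by move=> w _; rewrite lee_fin mulr_ge0// ltW.
    - apply/measurable_EFinP; apply: measurable_funM => //; exact: measurable_indic.
    - apply/measurable_EFinP; apply: measurable_funM => //; apply: measurable_natmulb.
      exact: (@mpath _ _ n (fun s _ => al s)).
    move=> w _; rewrite lee_fin indicE; case: (boolP (w \in A B)) => [|_]; last first.
      rewrite mulr0 mulr_ge0//; apply/ltW/CS_gt0 => //; exact: posF.
    rewrite inE => /(_ n I) /= /andP[-> tB]; rewrite mulr1 mul1r.
    apply: le_trans (CS_ge_exp (posF w) lam0 _).
    by rewrite ler_expR lerN2 ler_wpM2l// ltW.
  apply: P_small0 => n; rewrite -(fineK Pfin) lee_fin.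
  have [N hN] : exists N, (n.+1%:R <= N%:R * c)%R.
    exists (Num.truncn (n.+1%:R / c)).+1.
    by rewrite -ler_pdivrMr// ltW// truncnS_gt.
  have := rho N.
  have : (\sum_(n0 < N) (c * fine (P (A B))) <= \sum_(n0 < N) fine (dm n0))%R.
    by apply: ler_sum => i _; exact: le.
  rewrite sumr_const card_ord -[(_ *+ N)%R]mulr_natl mulrA => h1 h2.
  have p0 : (0 <= fine (P (A B)))%R by rewrite fine_ge0.
  rewrite -[leRHS]mul1r ler_pdivlMr// mulrC.
  apply: (le_trans _ (le_trans h1 h2)).
  by rewrite ler_wpM2r.
have N0 B : P.-negligible (A B).
  by apply: (iffRL (negligibleP _ (mA B))); exact: A0.
apply: negligibleS (negligible_bigcup N0) => w /= /not_implyP[alw h].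
have [B hB] : exists B, forall n, (tS (wF w) (path n w) <= B)%R.
  apply: contrapT => h'; apply: h => B; apply: contrapT => hB; apply: h'.
  by exists B => n; rewrite leNgt; apply/negP => lt; apply: hB; exists n.
exists (Num.truncn B).+1 => // n _ /=; rewrite alw /=.
by apply: le_trans (hB n.+1) _; rewrite ltW// truncnS_gt.
Qed.

Lemma ae_tS_unbounded lam M : (0 < lam)%R -> (0 < M)%N ->
  (Hrec (er lam) M 0 <= 1 / 2)%R ->
  {ae P, forall w, (forall n, alive M (path n w)) ->
     forall B, exists n, (B < tS (wF w) (path n w))%R}.
Proof.
move=> lam0 M0 rho; apply: (@ae_tS_unbounded_summable lam (alive M)) => // N.
exact: dmass_sum.
Qed.

(** Within the horizon no degree can reach N + 1, so truncation at that degree is invisible. *)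
Lemma CS_sum lam N : (0 < lam)%R -> (forall M, Hrec (er lam) M 0 <= 1 / 2)%R ->
  (\sum_(n < N) fine (\int[P]_w (CS (wF w) lam (path n.+1 w))%:E) <= 1)%R.
Proof.
move=> lam0 rho; apply: le_trans (dmass_sum N lam0 (ltn0Sn N) (rho N.+1)).
apply: ler_sum => n _; rewrite le_eqVlt; apply/orP; left; apply/eqP; congr fine.
apply: eq_integral => w _; have -> : alive N.+1 (path n w); last by rewrite mul1r.
apply/aliveP => // p; apply: leq_ltn_trans (count_size _ _) _.
by rewrite size_hist; have := ltn_ord n; lia.
Qed.

Lemma er_le_lam lam lam' k : (0 < lam)%R -> (lam <= lam')%R -> (er lam' k <= er lam k)%R.
Proof.
move=> l0 ll'; have l0' := lt_le_trans l0 ll'.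
rewrite -lee_fin -!(integral_ratio _ 0)//.
have mr l : measurable_fun setT (fun w => (ratio (wmap F w) l 0 k)%:E).
  apply/measurable_EFinP; apply: (mcomp (h := fun f => ratio f l 0 k)).
  exact: measurable_ratio.
apply: ge0_le_integral => //.
- by move=> w _; rewrite lee_fin; apply: ratio_ge0 => //; exact: posF.
- move=> w _; rewrite lee_fin /ratio; have f0 := posF w 0%N k.
  rewrite ler_wpM2l ?(ltW f0)// lef_pV2 ?posrE ?addr_gt0//; exact: lerD.
Qed.

Lemma er_le1 lam k : (0 < lam)%R -> (er lam k <= 1)%R.
Proof.
move=> l0; rewrite -lee_fin -(integral_ratio l0 0).
rewrite -(P_integral_cst P 1); apply: ge0_le_integral => //.
- by move=> w _; rewrite lee_fin; apply: ratio_ge0 => //; exact: posF.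
- apply/measurable_EFinP; apply: (mcomp (h := fun f => ratio f lam 0 k)).
  exact: measurable_ratio.
- move=> w _; rewrite lee_fin /ratio; have f0 := posF w 0%N k.
  by rewrite ler_pdivrMr ?addr_gt0// mul1r lerDl ltW.
Qed.

(** Every product in [HrecE] started at degree 0 contains the factor [er lam 0]; making it small by
    a large [lam] controls any finite number of terms. *)
Lemma er_small (e : R) : (0 < e)%R ->
  exists2 L : R, (0 < L)%R & forall lam, (L <= lam)%R -> (er lam 0 <= e)%R.
Proof.
move=> e0; have e2 : (0 < e / 2)%R by rewrite divr_gt0.
pose D (K : nat) := [set w | (K%:R < F 0%N 0%N w)%R].
have mD K : measurable (D K) by apply: measurable_setb; exact: measurable_fun_ltr.
have [K hK] : exists K, P (D K) <= (e / 2)%:E.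
  apply: P_bigcap_le => //.
    by move=> m n mn; apply/subsetPset => w; apply: le_lt_trans; rewrite ler_nat.
  rewrite (_ : \bigcap_n _ = set0) ?measure0 ?lte_fin//.
  apply/seteqP; split => // w h; have := h (Num.truncn (F 0%N 0%N w)).+1 I.
  by rewrite /D /= ltNge ltW// truncnS_gt.
exists (2 * K.+1%:R / e)%R; first by rewrite divr_gt0// mulr_gt0.
move=> lam hlam; have l0 : (0 < lam)%R.
  by apply: lt_le_trans hlam; rewrite divr_gt0// mulr_gt0.
rewrite -lee_fin -(integral_ratio l0 0).
apply: (@le_trans _ _ (\int[P]_w ((\1_(D K) w)%:E + (e / 2)%:E))).
  apply: ge0_le_integral => //.
  - by move=> w _; rewrite lee_fin; apply: ratio_ge0 => //; exact: posF.
  - apply/measurable_EFinP; apply: (mcomp (h := fun f => ratio f lam 0 0)).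
    exact: measurable_ratio.
  - apply: emeasurable_funD => //; apply/measurable_EFinP; exact: measurable_indic.
  - move=> w _; rewrite -EFinD lee_fin indicE; have f0 := F_gt0 0 0 w.
    rewrite /ratio /wF /wmap.
    case: (boolP (w \in D K)) => [_|].
      apply: (@le_trans _ _ 1%R); last by rewrite lerDl ltW.
      by rewrite ler_pdivrMr ?addr_gt0// mul1r lerDl ltW.
    rewrite notin_setE /D /= => /negP; rewrite -leNgt => FK; rewrite add0r.
    rewrite ler_pdivrMr ?addr_gt0//; move: hlam; rewrite ler_pdivrMr// => hlam.
    have KK : (K%:R <= K.+1%:R :> R)%R by rewrite ler_nat.
    by have := mulr_gt0 e2 f0; lra.
rewrite ge0_integralD//; last 2 first.
- by apply/measurable_EFinP; exact: measurable_indic.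
- by move=> w _; rewrite lee_fin ltW.
rewrite P_integral_cst integral_indic// setIT.
by rewrite [X in _ <= X%:E](splitr e) EFinD; exact: leeD.
Qed.

Lemma Hrec_er_bounded M : exists2 lam : R, (0 < lam)%R & (Hrec (er lam) M 0 <= 1 / 2)%R.
Proof.
have [|L L0 hL] := @er_small (1 / (2 * M.+1%:R)) _; first by rewrite divr_gt0// mulr_gt0.
exists L => //; rewrite HrecE.
apply: (@le_trans _ _ (\sum_(i < M) (1 / (2 * M.+1%:R)))%R).
  apply: ler_sum => i _; rewrite big_ord_recl; apply: le_trans (hL _ (lexx _)).
  rewrite ler_piMr ?er_ge0//; apply: prodr_ile1 => j _.
  by rewrite er_ge0//= er_le1.
rewrite sumr_const card_ord -[(_ *+ M)%R]mulr_natl mulrA mulr1 ler_pdivrMr ?mulr_gt0//.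
by rewrite mulrA divfK// mul1r ler_nat.
Qed.

(** Beyond I0 the tail is at most 1/4 at [lam0], and it only decreases when [lam] grows; a larger
    [lam] brings the first I0 terms below 1/4 as well. *)
Lemma Hrec_er_summable lam0 : (0 < lam0)%R ->
  \sum_(0 <= i <oo) (\prod_(j < i.+1) (er lam0 j)%:E) < +oo ->
  exists2 lam : R, (0 < lam)%R & forall M, (Hrec (er lam) M 0 <= 1 / 2)%R.
Proof.
move=> l0; pose a i : R := (\prod_(j < i.+1) er lam0 j)%R.
have a0 i : (0 <= a i)%R by apply: prodr_ge0 => j _; exact: er_ge0.
rewrite (eq_eseriesr (g := fun i => (a i)%:E)); last by move=> i _; rewrite /a prodEFin.
set S := \sum_(0 <= i <oo) _ => Soo.
have S0 : 0 <= S by apply: nneseries_ge0 => i _ _; rewrite lee_fin.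
have Sfin : S \is a fin_num by rewrite ge0_fin_numE.
have le n : (\sum_(i < n) a i <= fine S)%R.
  rewrite -lee_fin fineK// -sumEFin -(big_mkord predT (fun i => (a i)%:E)).
  by apply: nneseries_lim_ge => i _ _; rewrite lee_fin.
have [I0 hI] : exists I0, (fine S - 1 / 4 < \sum_(i < I0) a i)%R.
  apply: contrapT => h; have : S <= (fine S - 1 / 4)%:E.
    apply: lime_le; first by apply: is_cvg_nneseries => i _ _; rewrite lee_fin.
    apply: nearW => n; rewrite big_mkord sumEFin lee_fin leNgt; apply/negP => lt.
    by apply: h; exists n.
  by rewrite -[X in X <= _](fineK Sfin) lee_fin; lra.
have [|L L0 hL] := @er_small (1 / (4 * I0.+1%:R)) _; first by rewrite divr_gt0// mulr_gt0.
pose lam := Num.max L lam0; have ll0 : (lam0 <= lam)%R by rewrite le_max lexx orbT.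
have l1 : (0 < lam)%R by exact: lt_le_trans ll0.
exists lam => // M; rewrite HrecE.
have b0 i : (\prod_(j < i.+1) er lam (0 + j) <= a i)%R.
  apply: ler_prod => j _; rewrite er_ge0//=; exact: er_le_lam.
have b1 i : (\prod_(j < i.+1) er lam (0 + j) <= 1 / (4 * I0.+1%:R))%R.
  rewrite big_ord_recl; apply: (@le_trans _ _ (er lam 0)); last first.
    by apply: hL; rewrite le_max lexx.
  rewrite ler_piMr ?er_ge0//; apply: prodr_ile1 => j _.
  by rewrite er_ge0//= er_le1.
apply: (@le_trans _ _ (\sum_(i < I0 + M) \prod_(j < i.+1) er lam (0 + j))%R).
  rewrite -!(big_mkord predT (fun i => \prod_(j < i.+1) er lam (0 + j))%R).
  rewrite [leRHS](big_cat_nat _ (n := M))//= ?leq_addl// lerDl.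
  by apply: sumr_ge0 => i _; apply: prodr_ge0 => j _; exact: er_ge0.
rewrite big_split_ord /=.
have h1 : (\sum_(i < I0) \prod_(j < i.+1) er lam (0 + j) <= 1 / 4)%R.
  apply: (@le_trans _ _ (\sum_(i < I0) (1 / (4 * I0.+1%:R)))%R).
    by apply: ler_sum => i _; exact: b1.
  rewrite sumr_const card_ord -[(_ *+ I0)%R]mulr_natl mulrA mulr1 ler_pdivrMr ?mulr_gt0//.
  by rewrite mulrA divfK// mul1r ler_nat.
have h2 : (\sum_(i < M) \prod_(j < (I0 + i).+1) er lam (0 + j) <= 1 / 4)%R.
  apply: (@le_trans _ _ (\sum_(i < M) a (I0 + i))%R).
    by apply: ler_sum => i _; exact: b0.
  by have := le (I0 + M)%N; rewrite big_split_ord /=; lra.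
lra.
Qed.

End discount.

Lemma count_take_le (u m : nat) (s : seq nat) : (count_mem u (take m s) <= count_mem u s)%N.
Proof. by rewrite -{2}(cat_take_drop m s) count_cat leq_addr. Qed.

Lemma count_hist_le T (par : nat -> T -> nat) u m n w : (m <= n)%N ->
  (count_mem u (hist par m w) <= count_mem u (hist par n w))%N.
Proof. by move=> mn; rewrite -(take_hist par w mn) count_take_le. Qed.

Lemma tS_hist_le (R : realType) (f : nat -> nat -> R) T (par : nat -> T -> nat) m n w :
  posw f -> (m <= n)%N -> (tS f (hist par m w) <= tS f (hist par n w))%R.
Proof.
move=> f0 /subnK <-; elim: (n - m)%N => // i IH.
by rewrite addSn hist_rcons tS_rcons (le_trans IH)// lerDl invr_ge0 ltW// Zw_gt0.
Qed.

(** * A divergent clock makes every degree unbounded *)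

Section degrees.
Context d (T : measurableType d) (R : realType) (P : probability T R).
Variables (F : nat -> nat -> T -> R) (par : nat -> T -> nat).
Hypothesis mF : forall j k, measurable_fun setT (F j k).
Hypothesis F_gt0 : forall j k w, (0 < F j k w)%R.
Hypothesis gpa : gpa_tree P F par.

Let wF := wmap F.
Local Notation path n w := (hist par n w).
Local Notation wmeas h := (measurable_fun (setT : set (wT R predT)) h).
Let posF w : posw (wF w). Proof. exact: (posF F_gt0). Qed.

Lemma ae_deg_unbounded : {ae P, forall w,
  (forall B, exists n, (B < tS (wF w) (path n w))%R) ->
  forall u k, exists n, (k <= count_mem u (path n w))%N}.
Proof.
pose Y u k s (f : weights R) : R := ((count_mem u s == k)%:R * (1 + f u k * tS f s))%R.
have H : {ae P, forall w, forall u k n0 : nat, (u <= n0)%N ->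
    (k <= count_mem u (path n0 w))%N ->
    exists a : R, forall m, (n0 <= m)%N -> (Y u k (path m w) (wF w) <= a)%R}.
  apply: ae_foralln => u; apply: ae_foralln => k; apply: ae_foralln => n0.
  have [un|un] := leqP u n0; last by apply: aeW => w un'; lia.
  have := @ae_supermart_bounded _ _ _ P F par mF F_gt0 gpa n0
    (fun s _ => k <= count_mem u s)%N (Y u k) _ _ _ _.
  move=> h; apply: filterS (h _ _ _ _) => //.
  - by move=> w hw _; exact: hw.
  - move=> s; apply: measurable_funM => //; apply: measurable_funD => //.
    by apply: measurable_funM; [exact: measurable_coord|exact: measurable_tS].
  - move=> w s; rewrite mulr_ge0// addr_ge0// mulr_ge0 ?tS_ge0//; exact/ltW/posF.
  - move=> w s ns ks; apply: step_stuck; first exact: posF.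
      exact: leq_trans ns.
    exact: leq_trans ks (count_take_le _ _ _).
apply: filterS H => w hw ht u; elim=> [|k [n0 hn0]]; first by exists 0%N.
apply: contrapT => h.
(* The supermartingale of [step_stuck] exists only once node u is born. *)
pose n1 := maxn n0 u; have un : (u <= n1)%N by rewrite leq_maxr.
have kn m : (n1 <= m)%N -> count_mem u (path m w) = k.
  move=> nm; apply/eqP; rewrite eqn_leq; apply/andP; split.
    by rewrite leqNgt; apply/negP => lt; apply: h; exists m.
  apply: leq_trans hn0 _; apply: count_hist_le; apply: leq_trans nm.
  exact: leq_maxl.
have [|a ha] := hw u k n1 un; first by rewrite kn.
have f0 : (0 < wF w u k)%R by exact: posF.
have [m hm] := ht (a / wF w u k)%R.
have := ha (maxn m n1) (leq_maxr _ _); rewrite /Y kn ?leq_maxr// eqxx mul1r.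
have := @tS_hist_le _ _ _ par m (maxn m n1) w (posF w) (leq_maxl m n1); move: hm; rewrite ltr_pdivrMr//.
by move: (tS _ (path m w)) (tS _ (path (maxn m n1) w)) => x y; nra.
Qed.

End degrees.

Section measurable_sums.
Context {R : realType}.
Variable J : pred (nat * nat).
Local Notation wmeas h := (measurable_fun (setT : set (wT R J)) h).

Lemma measurable_aS u k : (forall j, (j < k)%N -> J (u, j)) ->
  wmeas (fun f : weights R => aS f u k).
Proof.
move=> Ju; apply: measurable_sum => j; apply: measurable_funV => //.
by apply: measurable_coord; exact: Ju.
Qed.

Lemma measurable_qS u k : (forall j, (j < k)%N -> J (u, j)) ->
  wmeas (fun f : weights R => qS f u k).
Proof.
move=> Ju; apply: measurable_sum => j; apply: measurable_funV => //.
by apply: measurable_funX; apply: measurable_coord; exact: Ju.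
Qed.

Lemma aSB (f : nat -> nat -> R) u m k : (m <= k)%N ->
  aS f u k = (aS f u m + \sum_(m <= j < k) (f u j)^-1)%R.
Proof.
move=> mk; rewrite /aS -!(big_mkord predT (fun j => (f u j)^-1)%R).
by rewrite [LHS](big_cat_nat _ (n := m)).
Qed.

Lemma qSB (f : nat -> nat -> R) u m k : (m <= k)%N ->
  qS f u k = (qS f u m + \sum_(m <= j < k) (f u j) ^- 2)%R.
Proof.
move=> mk; rewrite /qS -!(big_mkord predT (fun j => (f u j) ^- 2)%R).
by rewrite [LHS](big_cat_nat _ (n := m)).
Qed.

Lemma measurable_sum_nat (h : weights R -> nat -> R) m k :
  (forall j, (m <= j < k)%N -> wmeas (fun f => h f j)) ->
  wmeas (fun f => \sum_(m <= j < k) h f j)%R.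
Proof.
move=> mh; have -> : (fun f => \sum_(m <= j < k) h f j)%R = (fun f =>
    \sum_(j <- index_iota m k) if (m <= j < k)%N then h f j else 0)%R.
  by apply/funext => f; rewrite big_nat [in LHS]big_mkcond.
apply: measurable_sum => j; case mjk : (m <= j < k)%N; last exact: measurable_cst.
exact: mh.
Qed.

End measurable_sums.

Definition swapn (u v x : nat) : nat := if x == u then v else if x == v then u else x.

Lemma swapnK u v : involutive (swapn u v).
Proof.
move=> x; rewrite /swapn; case: (eqVneq x u) => [->|xu].
  by rewrite eqxx; case: eqP.
by case: (eqVneq x v) => [->|xv]; rewrite ?eqxx// (negPf xu) (negPf xv).
Qed.

(** * Fresh weights favour either of two nodes with definite probability *)

Section fresh.
Context d (T : measurableType d) (R : realType) (P : probability T R).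
Variable F : nat -> nat -> T -> R.
Hypothesis mF : forall j k, measurable_fun setT (F j k).
Hypothesis F_gt0 : forall j k w, (0 < F j k w)%R.
Hypothesis indF : mutually_independent P F.
Hypothesis idF : forall j k (B : set R), measurable B ->
  P (F j k @^-1` B) = P (F 0%N k @^-1` B).

Let wF := wmap F.
Local Notation wmeas h := (measurable_fun (setT : set (wT R predT)) h).
Let posF w : posw (wF w). Proof. by move=> j k; exact: F_gt0. Qed.

Lemma ae_qS_unbounded u :
  {ae P, forall w, \sum_(0 <= j <oo) (((F 0%N j w) ^- 2)%R)%:E = +oo} ->
  P [set w | forall L : nat, exists k, (L%:R <= qS (wF w) u k)%R] = 1.
Proof.
move=> hF; pose A : set (weights R) := \bigcap_(L : nat) \bigcup_k
  [set f : weights R | (L%:R <= qS f 0 k)%R].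
have mA : (wcyl predT).-sigma.-measurable A.
  apply: bigcapT_measurable => L; apply: bigcupT_measurable => k.
  apply: (@measurable_setb _ (wT R predT) (fun f => L%:R <= qS f 0 k)%R).
  by apply: measurable_fun_ler => //; exact: measurable_qS.
have mpreA : measurable (wF @^-1` A) by exact: (@measurable_pre _ _ _ F mF predT).
transitivity (P (wmap (fun j => F (swapn 0 u j)) @^-1` A)).
  congr (P _); apply/seteqP; split => w h L.
    by move=> _; have [k hk] := h L; exists k.
  by have [k _ hk] := h L I; exists k.
rewrite (P_law mF indF idF (@swapnK 0 u) mA).
apply/eqP; rewrite eq_le probability_le1//=.
have [N [mN PN0 sN]] := hF.
suff sub : ~` N `<=` wF @^-1` A.
  have <- : P (~` N) = 1.
    by apply: (etrans (probability_setC P mN)); rewrite PN0 sube0.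
  by apply: le_measure; rewrite ?inE//; exact: measurableC.
move=> w Nw; have hw : \sum_(0 <= j <oo) (((F 0%N j w) ^- 2)%R)%:E = +oo.
  by apply: contrapT => h; apply: Nw; exact: sN.
move=> L _; apply: contrapT => hL.
suff : \sum_(0 <= j <oo) (((F 0%N j w) ^- 2)%R)%:E <= L%:R%:E by rewrite hw.
apply: lime_le.
  apply: is_cvg_nneseries => i _ _; rewrite lee_fin invr_ge0 exprn_ge0//.
  exact/ltW/F_gt0.
apply: nearW => n; rewrite big_mkord sumEFin lee_fin leNgt; apply/negP => lt.
by apply: hL; exists n => //=; exact: ltW.
Qed.

(** Exchanging u and v shows that v is at least as fast as u with probability at least 1/2; by
    divergence, K can be taken so large that the variance stays below L with probability at most
    1/4. *)
Lemma fresh_lower u v m (L : R) : u != v ->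
  {ae P, forall w, \sum_(0 <= j <oo) (((F 0%N j w) ^- 2)%R)%:E = +oo} ->
  exists2 K, (m < K)%N & (1 / 4)%:E <= P [set w |
    (\sum_(m <= j < K) (wF w v j)^-1 <= \sum_(m <= j < K) (wF w u j)^-1)%R &&
    (L <= \sum_(m <= j < K) (wF w u j) ^- 2)%R].
Proof.
move=> uv hF.
have wmA w j K : wmeas (fun f : weights R => \sum_(j <= i < K) (f w i)^-1)%R.
  apply: measurable_sum_nat => i _; apply: measurable_funV => //.
  exact: measurable_coord.
have wmQ w j K : wmeas (fun f : weights R => \sum_(j <= i < K) (f w i) ^- 2)%R.
  apply: measurable_sum_nat => i _; apply: measurable_funV => //.
  by apply: measurable_funX; exact: measurable_coord.
have mcomp (h : weights R -> R) : wmeas h -> measurable_fun setT (fun w => h (wF w)).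
  by move=> mh; exact: (measurableT_comp mh (@measurable_wmap _ _ _ F predT mF)).
pose D K := [set w | (\sum_(m <= j < m.+1 + K) (wF w u j) ^- 2 < L)%R].
have mD K : measurable (D K).
  apply: measurable_setb; apply: measurable_fun_ltr => //.
  exact: (mcomp (fun f => \sum_(m <= i < m.+1 + K) (f u i) ^- 2)%R).
have [K0 hK] : exists K, P (D K) <= (1 / 4)%:E.
  apply: P_bigcap_le => //.
    move=> a b ab; apply/subsetPset => w; apply: le_lt_trans.
    rewrite [leRHS](big_cat_nat _ (n := m.+1 + a))//=; [|lia..].
    rewrite lerDl; apply: sumr_ge0 => i _; rewrite invr_ge0 exprn_ge0//; exact/ltW/posF.
  have Q1 := ae_qS_unbounded u hF.
  have mQ : measurable [set w | forall L : nat, exists k, (L%:R <= qS (wF w) u k)%R].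
    have -> : [set w | forall L : nat, exists k, (L%:R <= qS (wF w) u k)%R] =
        \bigcap_(L : nat) \bigcup_k [set w | (L%:R <= qS (wF w) u k)%R].
      apply/seteqP; split => w h L0; first by move=> _; have [k hk] := h L0; exists k.
      by have [k _ hk] := h L0 I; exists k.
    apply: bigcapT_measurable => L0; apply: bigcupT_measurable => k.
    apply: measurable_setb; apply: measurable_fun_ler => //.
    by apply: (mcomp (fun f => qS f u k)); exact: measurable_qS.
  apply: (@le_lt_trans _ _ 0); last by rewrite lte_fin; lra.
  have <- : P (~` [set w | forall L : nat, exists k, (L%:R <= qS (wF w) u k)%R]) = 0.
    by apply: (etrans (probability_setC P mQ)); rewrite Q1 subee.
  apply: le_measure; rewrite ?inE.
  - by apply: bigcapT_measurable.
  - exact: measurableC.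
  - move=> w hD hQ; have [k] := hQ (Num.truncn (L + qS (wF w) u m)).+1.
    have := hD k I; rewrite /D /= => lt; apply/negP; rewrite -ltNge.
    apply: (@le_lt_trans _ _ (qS (wF w) u (m.+1 + k))).
      by apply: qS_le; [exact: posF|lia].
    rewrite (@qSB _ _ u m); last lia.
    apply: (@lt_trans _ _ (L + qS (wF w) u m)%R); first lra.
    exact: truncnS_gt.
pose K := (m.+1 + K0)%N; exists K; first lia.
pose A : set (weights R) :=
  [set f : weights R | (\sum_(m <= j < K) (f v j)^-1 <= \sum_(m <= j < K) (f u j)^-1)%R].
have mA : (wcyl predT).-sigma.-measurable A.
  apply: (@measurable_setb _ (wT R predT) (fun f : weights R =>
    \sum_(m <= j < K) (f v j)^-1 <= \sum_(m <= j < K) (f u j)^-1)%R).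
  exact: measurable_fun_ler.
have mpA : measurable (wF @^-1` A) by exact: (@measurable_pre _ _ _ F mF predT).
have eA := P_law mF indF idF (@swapnK u v) mA; rewrite -/wF in eA.
have mF' j k : measurable_fun setT (F (swapn u v j) k) by exact: mF.
have mpA' : measurable (wmap (fun j => F (swapn u v j)) @^-1` A).
  by rewrite -[X in measurable X]setTI; exact: (@measurable_wmap _ _ _ _ predT mF' measurableT _ mA).
have halfA : (1 / 2)%:E <= P (wF @^-1` A).
  have : 1 <= P (wF @^-1` A) + P (wmap (fun j => F (swapn u v j)) @^-1` A).
    apply: le_trans (@measureU2 _ _ _ P _ _ mpA mpA').
    rewrite -(@probability_setT _ _ _ P); apply: le_measure; rewrite ?inE//.
      exact: measurableU.
    move=> w _; have [h|h] := lerP (\sum_(m <= j < K) (wF w v j)^-1)%R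
      (\sum_(m <= j < K) (wF w u j)^-1)%R; first by left.
    right; rewrite /A /wmap /= /swapn eqxx [v == u]eq_sym (negPf uv) eqxx.
    exact: ltW.
  rewrite eA; have fin : P (wF @^-1` A) \is a fin_num by rewrite fin_num_measure.
  by rewrite -(fineK fin) -EFinD !lee_fin; lra.
have mG : measurable [set w | (\sum_(m <= j < K) (wF w v j)^-1 <= \sum_(m <= j < K) (wF w u j)^-1)%R &&
    (L <= \sum_(m <= j < K) (wF w u j) ^- 2)%R].
  apply: measurable_setb; apply: measurable_and; apply: measurable_fun_ler => //.
  - exact: (mcomp (fun f => \sum_(m <= i < K) (f v i)^-1)%R).
  - exact: (mcomp (fun f => \sum_(m <= i < K) (f u i)^-1)%R).
  - exact: (mcomp (fun f => \sum_(m <= i < K) (f u i) ^- 2)%R).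
set G := [set w | _] in mG *.
have : P (wF @^-1` A) <= P G + P (D K0).
  apply: le_trans (@measureU2 _ _ _ P _ _ mG (mD K0)).
  apply: le_measure; rewrite ?inE//; first exact: measurableU.
  move=> w Aw; have [h|h] := lerP L (\sum_(m <= j < K) (wF w u j) ^- 2)%R; last by right.
  by left; rewrite /G /= h andbT.
have finG : P G \is a fin_num by rewrite fin_num_measure.
have finD : P (D K0) \is a fin_num by rewrite fin_num_measure.
have finA : P (wF @^-1` A) \is a fin_num by rewrite fin_num_measure.
move: halfA hK; rewrite -(fineK finG) -(fineK finD) -(fineK finA) -EFinD !lee_fin.
by lra.
Qed.

End fresh.

Lemma ae_and d (T : measurableType d) (R : realType) (P : probability T R)
  (A B : T -> Prop) :
  {ae P, forall w, A w} -> {ae P, forall w, B w} -> {ae P, forall w, A w /\ B w}.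
Proof. by move=> hA hB; apply: filterS2 hA hB => w; split. Qed.

Lemma paths_count0 n s p : s \in paths n -> (n <= p)%N -> count_mem p s = 0%N.
Proof.
move=> sp np; apply/count_memPn; apply/negP => /(nthP 0%N)[i].
rewrite (size_paths sp) => ilt e; move: sp; rewrite mem_paths => /andP[_ /allP /(_ i)].
by rewrite mem_iota /= e => /(_ ilt); lia.
Qed.

Lemma is_max_degP T (par : nat -> T -> nat) u n w :
  is_max_deg (par^~ w) u n -> (u <= n)%N /\
  forall v, (v <= n)%N -> (count_mem v (hist par n w) <= count_mem u (hist par n w))%N.
Proof.
move=> /andP[un /forallP h]; split => // v vn.
by have := h (Ordinal (vn : (v < n.+1)%N)); rewrite /= !outdeg_hist.
Qed.

(** * Part 1: no node leads forever *)

Section race_divergent.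
Context d (T : measurableType d) (R : realType) (P : probability T R).
Variables (F : nat -> nat -> T -> R) (par : nat -> T -> nat).
Hypothesis mF : forall j k, measurable_fun setT (F j k).
Hypothesis F_gt0 : forall j k w, (0 < F j k w)%R.
Hypothesis indF : mutually_independent P F.
Hypothesis idF : forall j k (B : set R), measurable B ->
  P (F j k @^-1` B) = P (F 0%N k @^-1` B).
Hypothesis gpa : gpa_tree P F par.

Let wF := wmap F.
Local Notation path n w := (hist par n w).
Local Notation wmeas h := (measurable_fun (setT : set (wT R predT)) h).
Let posF w : posw (wF w). Proof. exact: (posF F_gt0). Qed.
Let mpath dU (U : measurableType dU) n (g : seq nat -> weights R -> U)
  (mg : forall s, wmeas (g s)) : measurable_fun setT (fun w => g (path n w) (wF w)) :=
  measurable_path mF gpa n mg.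

Let PR (A : set T) : R := fine (P A).
Let PRE A : measurable A -> P A = (PR A)%:E.
Proof. by move=> mA; rewrite /PR fineK// fin_num_measure. Qed.
Let PR0 A : (0 <= PR A)%R. Proof. by rewrite fine_ge0. Qed.
Let PR_le A B : measurable A -> measurable B -> A `<=` B -> (PR A <= PR B)%R.
Proof. by move=> mA mB AB; rewrite -lee_fin -!PRE//; apply: le_measure; rewrite ?inE. Qed.
Let PR_U A B : measurable A -> measurable B -> (PR (A `|` B) <= PR A + PR B)%R.
Proof.
move=> mA mB; rewrite -lee_fin EFinD -!PRE//; last exact: measurableU.
exact: (@measureU2 _ _ _ P).
Qed.

Section pair.
Variables (u v : nat).
Hypothesis uv : u != v.

(** The gap when the finish is at degree m. It involves only the weights before m, and [fresh] only
    those from m on, so the two are independent. *)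
Let x0 m s (f : weights R) : R :=
  (aS f u (count_mem u s) - aS f v (count_mem v s) - (aS f u m - aS f v m))%R.
Let fresh m K (L : R) (f : weights R) :=
  ((\sum_(m <= j < K) (f v j)^-1 <= \sum_(m <= j < K) (f u j)^-1) &&
    (L <= \sum_(m <= j < K) (f u j) ^- 2))%R.

Let mx0 (J : pred (nat * nat)) m s : (forall w j, (j < maxn m (size s))%N -> J (w, j)) ->
  measurable_fun (setT : set (wT R J)) (x0 m s).
Proof.
move=> h.
have m1 w : measurable_fun (setT : set (wT R J)) (fun f : weights R => aS f w (count_mem w s)).
  by apply: measurable_aS => j jk; apply: h; have := count_size (pred1 w) s; lia.
have m2 w : measurable_fun (setT : set (wT R J)) (fun f : weights R => aS f w m).
  by apply: measurable_aS => j jk; apply: h; lia.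
by apply: measurable_funB; apply: measurable_funB.
Qed.

Let mfresh (J : pred (nat * nat)) m K L : (forall w j, (m <= j)%N -> J (w, j)) ->
  measurable_fun (setT : set (wT R J)) (fresh m K L).
Proof.
move=> h; apply: measurable_and; apply: measurable_fun_ler => //;
  apply: measurable_sum_nat => j /andP[mj _]; apply: measurable_funV => //.
- by apply: measurable_coord; exact: h.
- by apply: measurable_coord; exact: h.
- by apply: measurable_funX; apply: measurable_coord; exact: h.
Qed.

Let S K (s : seq nat) := (K <= count_mem u s)%N || (K <= count_mem v s)%N.
Let S' K (s : seq nat) := (count_mem u s < K)%N && (K <= count_mem v s)%N.

(** Moving the finish from m to K subtracts the fresh advantage of v from the gap, which therefore
    stays below L, and lifts [gapY] to at least (28 L)^2, as [overtake_bound] demands. *)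
Lemma fresh_overtake w s m K (L : nat) n : (u <= size s)%N -> (v <= size s)%N ->
  m = (size s).+1 -> (m < K)%N ->
  (x0 m s (wF w) <= L%:R)%R -> fresh m K ((28 * L%:R) ^+ 2)%R (wF w) ->
  (1 / 704 <= Ex (wF w) pred0 n (fun s' => (hit (S' K) (size s) s')%:R) s
    + (1 - Ex (wF w) pred0 n (fun s' => (hit (S K) (size s) s')%:R) s))%R.
Proof.
move=> us vs mE mK xL /andP[fr1 fr2].
have um : (count_mem u s < m)%N by rewrite mE ltnS count_size.
have vm : (count_mem v s < m)%N by rewrite mE ltnS count_size.
have := @overtake_bound _ (wF w) (posF w) u v K n s uv us vs (ltn_trans um mK) (ltn_trans vm mK).
set Delta := (_ - _)%R; set V := (_ + _)%R => /(_ _)/le_trans; apply.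
  have -> : gapX (wF w) u v Delta s = (x0 m s (wF w) -
      (\sum_(m <= j < K) (wF w u j)^-1 - \sum_(m <= j < K) (wF w v j)^-1))%R.
    by rewrite /gapX /Delta /x0 !(@aSB _ _ _ m K) ?(ltnW mK)//; ring.
  apply: (@le_trans _ _ (28 * L%:R)%R); first by lra.
  rewrite -(ger0_norm (_ : 0 <= 28 * L%:R)%R)// -sqrtr_sqr ler_wsqrtr//.
  apply: (le_trans fr2); rewrite /gapY /varR /V !(@qSB _ _ _ m K) ?(ltnW mK)//.
  have := qS_le (posF w) u (ltnW um); have := qS_le (posF w) v (ltnW vm).
  have := sqr_ge0 (gapX (wF w) u v Delta s).
  have : (0 <= \sum_(m <= j < K) (wF w v j) ^- 2)%R.
    by apply: sumr_ge0 => j _; rewrite invr_ge0 exprn_ge0//; exact/ltW/posF.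
  by lra.
apply: lerD.
  by apply: (Ex_hit_ge (posF w)) => s'; rewrite /S /S' => /andP[_ ->]; rewrite orbT.
by rewrite lerD2l lerN2; exact: Ex_hit.
Qed.

Variable N : nat.
Let lead := \bigcap_n [set w | (N <= n)%N ==> (count_mem v (path n w) <= count_mem u (path n w))%N].
Let unb := \bigcap_k \bigcup_n [set w | (k <= count_mem u (path n w))%N].
Let n1 := maxn N (maxn u v).

Let path_approx_lead : path_approx P par n1 (lead `&` unb).
Proof.
have -> : lead `&` unb = \bigcap_k (if k is 0 then lead else unb).
  apply/seteqP; split => w; first by move=> [h1 h2] [|k].
  by move=> h; split; [exact: (h 0%N)|exact: (h 1%N)].
apply: (path_approx_bigcap gpa) => -[|_]; apply: (path_approx_bigcap gpa) => i.
  exact: (path_approx_pathset gpa n1 i (fun s => (N <= i)%N ==> (count_mem v s <= count_mem u s)%N)).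
apply: (path_approx_bigcup gpa) => n.
exact: (path_approx_pathset gpa n1 n (fun s => (i <= count_mem u s)%N)).
Qed.

Lemma no_persistent_lead :
  {ae P, forall w, \sum_(0 <= j <oo) (((F 0%N j w) ^- 2)%R)%:E = +oo} ->
  P (lead `&` unb) = 0.
Proof.
move=> hF; set A := lead `&` unb.
have mA : measurable A by have [] := path_approx_lead.
have [c c0 c704] : exists2 c : R, (0 < c)%R & (c <= 1 / 704)%R.
  by exists (1 / 704)%R; rewrite ?divr_gt0.
have c8 : (0 < c / 8)%R by rewrite divr_gt0.
apply: (@path_zero_one _ _ _ P F par gpa n1 A (c / 8)%R) => //.
move=> n0 beta n1n0; set B := pathset par n0 beta.
have mB : measurable B by exact: (measurable_pathset gpa).
have mBA : measurable (B `\` A) by exact: measurableD.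
rewrite !PRE// -EFinM lee_fin.
(* Degrees at time n0 are at most n0, so weights of degree index m and above have not been
   consulted. *)
pose m := n0.+1.
have un0 : (u <= n0)%N by move: n1n0; rewrite /n1; lia.
have vn0 : (v <= n0)%N by move: n1n0; rewrite /n1; lia.
have Nn0 : (N <= n0)%N by move: n1n0; rewrite /n1; lia.
pose b (L : nat) s f := beta s && (x0 m s f <= L%:R)%R.
have mb L s : wmeas (b L s).
  by apply: measurable_and => //; apply: measurable_fun_ler => //; exact: mx0.
have mbL L : measurable [set w | b L (path n0 w) (wF w)].
  by apply: measurable_setb; exact: mpath.
(* Fresh weights are favourable with probability at least 1/4, and each of the two outcomes of the
   race is charged to [B] minus [A], up to a vanishing error: 8 = 4 * 2. *)
have key (L : nat) : (c * PR [set w | b L (path n0 w) (wF w)] <= 8 * PR (B `\` A))%R.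
  have [K mK frK] := fresh_lower mF F_gt0 indF idF m ((28 * L%:R) ^+ 2)%R uv hF.
  rewrite -/wF in frK.
  pose g (f : weights R) : R := Ex f pred0 n0 (fun s => (b L s f)%:R) [::].
  pose h (f : weights R) : R := (fresh m K ((28 * L%:R) ^+ 2) f)%:R.
  have mh : wmeas h by apply: measurable_natmulb; exact: mfresh.
  have mfr : measurable_fun setT (fun w => fresh m K ((28 * L%:R) ^+ 2)%R (wF w)).
    apply: (measurableT_comp _ (@measurable_wmap _ _ _ F predT mF)).
    exact: mfresh.
  have mfrS := measurable_setb mfr.
  have g0 w : (0 <= g (wF w))%R.
    by rewrite -(Ex_cst (posF w) pred0 n0 0%R [::]); exact: ler_Ex_paths.
  have eg : \int[P]_w (g (wF w))%:E = (PR [set w | b L (path n0 w) (wF w)])%:E.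
    rewrite -PRE// (P_boolE P (mpath n0 (mb L))).
    rewrite (integral_Ex mF F_gt0 gpa (g := fun s f => (b L s f)%:R))//.
    by move=> s; exact: measurable_natmulb.
  have eh : \int[P]_w (h (wF w))%:E = P [set w | fresh m K ((28 * L%:R) ^+ 2)%R (wF w)].
    by rewrite (P_boolE P mfr).
  have egh : \int[P]_w (g (wF w) * h (wF w))%:E =
      (PR [set w | b L (path n0 w) (wF w)])%:E * P [set w | fresh m K ((28 * L%:R) ^+ 2)%R (wF w)].
    rewrite (@integral_indep_pos _ _ _ P F mF indF (fun x => x.2 < m)%N g h)//.
    - by rewrite eg eh.
    - apply: measurable_Ex => [j k _ kn|s sp]; first exact: leqW.
      apply: measurable_natmulb; apply: measurable_and => //.
      apply: measurable_fun_ler => //; apply: mx0 => w j /=.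
      by rewrite (size_paths sp) /m; lia.
    - apply: measurable_natmulb; apply: mfresh => w j /= mj; by rewrite -leqNgt.
    - by rewrite eg ltry.
  (* [E1]: v reaches K while u is below it, which ends the lead of u. [E2]: nobody has reached K by
     time n0 + n; on [A] this becomes improbable as n grows, because the degree of u is unbounded
     there. *)
  pose E1 n w := beta (path n0 w) && hit (S' K) n0 (path (n0 + n) w).
  pose E2 n w := beta (path n0 w) && ~~ hit (S K) n0 (path (n0 + n) w).
  have mE1 n : measurable_fun setT (E1 n).
    apply: measurable_and; first exact: (mpath n0 (g := fun s _ => beta s)).
    exact: (mpath (n0 + n) (g := fun s _ => hit (S' K) n0 s)).
  have mE2 n : measurable_fun setT (E2 n).
    apply: measurable_and; first exact: (mpath n0 (g := fun s _ => beta s)).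
    exact: (mpath (n0 + n) (g := fun s _ => ~~ hit (S K) n0 s)).
  have gE n : (c%:E * \int[P]_w (g (wF w) * h (wF w))%:E <=
      P [set w | E1 n w] + P [set w | E2 n w]).
    pose g1 (s : seq nat) (_ : weights R) : R := ((beta (take n0 s))%:R * (hit (S' K) n0 s)%:R)%R.
    pose g2 (s : seq nat) (_ : weights R) : R := ((beta (take n0 s))%:R * (~~ hit (S K) n0 s)%:R)%R.
    have g10 s f : (0 <= g1 s f)%R by rewrite mulr_ge0.
    have g20 s f : (0 <= g2 s f)%R by rewrite mulr_ge0.
    have mg1 s : wmeas (g1 s) by exact: measurable_cst.
    have mg2 s : wmeas (g2 s) by exact: measurable_cst.
    have -> : P [set w | E1 n w] = \int[P]_w (Ex (wF w) pred0 (n0 + n) (g1^~ (wF w)) [::])%:E.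
      rewrite (P_boolE P (mE1 n)) -(integral_Ex mF F_gt0 gpa _ mg1)//.
      by apply: eq_integral => w _; rewrite /E1 /g1 take_hist ?leq_addr// -mulnb natrM.
    have -> : P [set w | E2 n w] = \int[P]_w (Ex (wF w) pred0 (n0 + n) (g2^~ (wF w)) [::])%:E.
      rewrite (P_boolE P (mE2 n)) -(integral_Ex mF F_gt0 gpa _ mg2)//.
      by apply: eq_integral => w _; rewrite /E2 /g2 take_hist ?leq_addr// -mulnb natrM.
    have Ex0 k (g' : seq nat -> R) w : (forall s, 0 <= g' s)%R -> (0 <= Ex (wF w) pred0 k g' [::])%R.
      by move=> h0; rewrite -(Ex_cst (posF w) pred0 k 0%R [::]); exact: ler_Ex_paths.
    have mgh : measurable_fun setT (fun w => (g (wF w) * h (wF w))%:E).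
      apply/measurable_EFinP; apply: measurable_funM; last exact: measurable_natmulb.
      apply/measurable_EFinP; apply: (@measurable_Ex_wF _ _ _ F mF n0 (fun s f => (b L s f)%:R)).
      by move=> s; exact: measurable_natmulb.
    rewrite -ge0_integralZl_EFin//; last 2 first.
    - by move=> w _; rewrite lee_fin mulr_ge0.
    - exact: ltW.
    rewrite -ge0_integralD//; last 4 first.
    - by move=> w _; rewrite lee_fin Ex0.
    - exact: (measurable_Ex_wF mF (n0 + n) mg1).
    - by move=> w _; rewrite lee_fin Ex0.
    - exact: (measurable_Ex_wF mF (n0 + n) mg2).
    apply: ge0_le_integral => //.
    - by move=> w _; rewrite -EFinM lee_fin mulr_ge0// ?(ltW c0)// mulr_ge0.
    - exact: measurable_funeM.
    - by apply: emeasurable_funD; [exact: (measurable_Ex_wF mF (n0 + n) mg1)|exact: (measurable_Ex_wF mF (n0 + n) mg2)].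
    move=> w _; rewrite -EFinM -EFinD lee_fin.
    rewrite /g1 /g2 !(@Ex_split _ (wF w) n0 n (fun s => (beta s)%:R))//.
    rewrite /h; case: (boolP (fresh _ _ _ _)) => fr; last first.
      rewrite !mulr0 addr_ge0//; apply: Ex0 => s; rewrite mulr_ge0//.
        rewrite -(Ex_cst (posF w) pred0 n 0%R s); exact: (ler_Ex0 (posF w)).
      rewrite -(Ex_cst (posF w) pred0 n 0%R s); exact: (ler_Ex0 (posF w)).
    rewrite mulr1 -[leLHS]addr0 -[X in (_ + X <= _)%R](mul0r (g (wF w))).
    rewrite -[X in (_ <= X + _)%R]mul1r -[X in (_ <= _ + X)%R]mul1r /g -!Ex_lin//.
    apply: ler_Ex_paths => // s sp; rewrite mul0r addr0 !mul1r -mulrDr.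
    have -> : Ex (wF w) pred0 n (fun s' => (~~ hit (S K) n0 s')%:R) s =
        (1 - Ex (wF w) pred0 n (fun s' => (hit (S K) n0 s')%:R) s)%R.
      rewrite -{2}(Ex_cst (posF w) pred0 n 1%R s) -mulN1r -[X in (_ = X + _)%R]mul1r -Ex_lin//.
      by apply: eq_Ex => s'; case: (hit _ _ _); rewrite /= ?mulr0 ?mulr1; lra.
    have sn := size_paths sp.
    rewrite /b; case: (boolP (beta s)) => bs /=; last by rewrite mulr0 mul0r.
    have ge : (0 <= Ex (wF w) pred0 n (fun s' => (hit (S' K) n0 s')%:R) s +
       (1 - Ex (wF w) pred0 n (fun s' => (hit (S K) n0 s')%:R) s))%R.
      rewrite addr_ge0//.
        rewrite -(Ex_cst (posF w) pred0 n 0%R s); exact: (ler_Ex0 (posF w)).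
      rewrite subr_ge0 -[leRHS](Ex_cst (posF w) pred0 n 1%R s).
      apply: (ler_Ex0 (posF w)) => s' _ _; by rewrite lern1 leq_b1.
    rewrite mul1r; case: (boolP (x0 m s (wF w) <= L%:R)%R) => xL; last by rewrite mulr0.
    rewrite mulr1; apply: (le_trans c704).
    by have := @fresh_overtake w s m K L n; rewrite sn; apply.
  have unE n : (PR [set w | E2 n w] <= PR (B `\` A) + PR (A `&` [set w | (count_mem u (path (n0 + n) w) < K)%N]))%R.
    have mC : measurable (A `&` [set w | (count_mem u (path (n0 + n) w) < K)%N]).
      apply: measurableI => //; apply: measurable_setb.
      exact: (mpath (n0 + n) (g := fun s _ => (count_mem u s < K)%N)).
    apply: le_trans (PR_U mBA mC); apply: PR_le => //.
    - exact: measurable_setb.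
    - exact: measurableU.
    - move=> w /= /andP[bw nh]; have [Aw|Aw] := pselect (A w); last by left.
      right; split => //=; rewrite ltnNge; apply: contra nh => Ku.
      apply/hitP; exists (n0 + n)%N; first by rewrite size_hist leq_addr leqnn.
      by rewrite take_hist// /S Ku.
  have E1A n : (PR [set w | E1 n w] <= PR (B `\` A))%R.
    apply: PR_le => //; first exact: measurable_setb.
    move=> w /= /andP[bw /hitP[i]]; rewrite size_hist => /andP[n0i iN].
    rewrite take_hist// => /andP[h1 h2]; split => // -[/(_ i I) /=].
    rewrite (leq_trans Nn0 n0i) /= => le _.
    by have := leq_trans h2 le; rewrite leqNgt h1.
  have half : (PR [set w | b L (path n0 w) (wF w)] / 4 <= fine (\int[P]_w (g (wF w) * h (wF w))%:E))%R.
    rewrite egh PRE// -EFinM /= ler_wpM2l//.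
    by rewrite -lee_fin -PRE// -[X in (X^-1)%:E]/(4%R) -div1r.
  apply/ler_addgt0Pr => e e0; have e1 : (0 < e / 4)%R by rewrite divr_gt0.
  have [n hn] : exists n, P (A `&` [set w | (count_mem u (path (n0 + n) w) < K)%N]) <= (e / 4)%:E.
    apply: P_bigcap_le.
    - move=> n; apply: measurableI => //; apply: measurable_setb.
      exact: (mpath (n0 + n) (g := fun s _ => (count_mem u s < K)%N)).
    - move=> i j ij; apply/subsetPset => w [Aw /= h1]; split => //=.
      by apply: leq_ltn_trans h1; apply: count_hist_le; rewrite leq_add2l.
    - rewrite (_ : \bigcap_n _ = set0) ?measure0 ?lte_fin//.
      apply/seteqP; split => // w hw; have [[_ +] _] := hw 0%N I.
      move=> /(_ K I)[i _ /= Ki]; have [_ /=] := hw i I.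
      by rewrite ltnNge (leq_trans Ki)// count_hist_le// leq_addl.
  have := gE n; have := unE n; have := E1A n; move: (ler_wpM2l (ltW c0) half) hn.
  rewrite egh PRE// -EFinM (PRE (measurable_setb (mE1 n))) (PRE (measurable_setb (mE2 n))).
  rewrite -EFinM -EFinD /= PRE; last first.
    apply: measurableI => //; apply: measurable_setb.
    exact: (mpath (n0 + n) (g := fun s _ => (count_mem u s < K)%N)).
  by rewrite !lee_fin; lra.
apply/ler_addgt0Pr => e e0.
pose D (L : nat) := B `\` [set w | b L (path n0 w) (wF w)].
have mD L : measurable (D L) by exact: measurableD.
have [L hL] : exists L, P (D L) <= e%:E.
  apply: P_bigcap_le => //.
  - move=> i j ij; apply/subsetPset => w [Bw nb]; split => //; apply: contra_not nb.
    by rewrite /b /= => /andP[-> /le_trans ->//]; rewrite ler_nat.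
  - rewrite (_ : \bigcap_n _ = set0) ?measure0 ?lte_fin//.
    apply/seteqP; split => // w hw.
    have [Bw nb] := hw (Num.truncn (x0 m (path n0 w) (wF w))).+1 I; apply: nb.
    by rewrite /b /=; apply/andP; split => //; rewrite ltW// truncnS_gt.
have : (PR B <= PR [set w | b L (path n0 w) (wF w)] + PR (D L))%R.
  apply: le_trans (PR_U (mbL L) (mD L)); apply: PR_le => //; first exact: measurableU.
  by move=> w Bw; have [?|?] := pselect (b L (path n0 w) (wF w)); [left|right].
move=> /(ler_wpM2l (ltW c8)); have := key L; move: hL; rewrite PRE// lee_fin.
move=> /(ler_wpM2l (ltW c8)); have : (c / 8 * e <= e)%R by rewrite ler_piMl ?ltW//; lra.
by lra.
Qed.

End pair.

(** A hub u must in particular stay ahead of node u+1. If the degree of u were bounded, so would be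
    all degrees; but then the truncated potential makes the clock diverge and all degrees
    unbounded. *)
Lemma no_persistent_hub :
  {ae P, forall w, \sum_(0 <= j <oo) (((F 0%N j w) ^- 2)%R)%:E = +oo} ->
  {ae P, forall w, ~ has_persistent_hub (par^~ w)}.
Proof.
move=> hF.
have race : {ae P, forall w, forall u N, ~ ((forall n, (N <= n)%N ->
    (count_mem u.+1 (path n w) <= count_mem u (path n w))%N) /\
    (forall k, exists n, (k <= count_mem u (path n w))%N))}.
  apply: ae_foralln => u; apply: ae_foralln => N.
  have uv : u != u.+1 by lia.
  have := no_persistent_lead uv N hF.
  set A := _ `&` _ => PA0.
  have mA : measurable A.
    apply: measurableI.
      apply: bigcapT_measurable => n.
      exact: (measurable_pathset gpa n (fun s => (N <= n)%N ==> (count_mem u.+1 s <= count_mem u s)%N)).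
    apply: bigcapT_measurable => k; apply: bigcupT_measurable => n.
    exact: (measurable_pathset gpa n (fun s => (k <= count_mem u s)%N)).
  exists A; split => // w /= /contrapT[h1 h2]; split.
    by move=> n _; apply/implyP; exact: h1.
  by move=> k _; have [n hn] := h2 k; exists n.
have tree : {ae P, forall w, forall M, (forall n, alive M.+1 (path n w)) ->
    forall B, exists n, (B < tS (wmap F w) (path n w))%R}.
  apply: ae_foralln => M.
  have [lam lam0 hlam] := Hrec_er_bounded mF F_gt0 idF M.+1.
  exact: (ae_tS_unbounded mF F_gt0 indF idF gpa lam0 (ltn0Sn M) hlam).
have deg := ae_deg_unbounded mF F_gt0 gpa.
have leg := as_paths mF F_gt0 gpa.
apply: filterS3 race tree (ae_and deg leg) => w {}race {}tree [{}deg {}leg] [u [N hub]].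
have hubP n p : (N <= n)%N -> (count_mem p (path n w) <= count_mem u (path n w))%N.
  move=> Nn; have [_ h] := @is_max_degP _ par u n w (hub n Nn).
  have [pn|pn] := leqP p n; first exact: h.
  by rewrite (paths_count0 (leg n) (ltnW pn)).
apply: (race u N); split => [n Nn|]; first exact: hubP.
apply: contrapT => /existsNP[k hk].
have uk n : (count_mem u (path n w) < k)%N.
  by rewrite ltnNge; apply/negP => ?; apply: hk; exists n.
have al n : alive k.-1.+1 (path n w).
  have k0 : (0 < k)%N by exact: leq_ltn_trans (uk 0%N).
  rewrite prednK//; apply/aliveP => // p.
  apply: leq_ltn_trans (uk (maxn n N)); apply: leq_trans (hubP _ p (leq_maxr _ _)).
  by apply: count_hist_le; exact: leq_maxl.
by apply: hk; apply: deg; exact: tree al.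
Qed.

End race_divergent.

(** * Exponential concentration for sums of reciprocal weights *)

Lemma expR_le_quad (R : realType) (y : R) :
  (y <= 1 / 2 -> expR y <= 1 + y + 2 * y ^+ 2)%R.
Proof.
(* Squaring this tangent bound gives exp(- y) >= (1 - y / 2)^2, sharp enough to second order. No
   lower bound on y is imposed, which later permits large negative exponents. *)
move=> y2; have h1 : (1 - y / 2 <= expR (- (y / 2)))%R := expR_ge1Dx (- (y / 2)).
have e : (expR (- y) = expR (- (y / 2)) ^+ 2)%R.
  by rewrite expr2 -expRD; congr expR; field.
have h : ((1 - y / 2) ^+ 2 <= expR (- y))%R.
  by rewrite e ler_sqr ?nnegrE ?expR_ge0//; lra.
have Q0 : (0 < 1 + y + 2 * y ^+ 2)%R by nra.
rewrite -[y in expR y]opprK expRN -[leLHS]mul1r ler_pdivrMr ?expR_gt0//.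
apply: le_trans (ler_wpM2l (ltW Q0) h); rewrite -subr_ge0.
have -> : ((1 + y + 2 * y ^+ 2) * (1 - y / 2) ^+ 2 - 1 =
  y ^+ 2 * ((1 / 2 - y) * (5 / 2 - y) / 2 + (5 / 8 - y / 4)))%R by field.
by rewrite mulr_ge0 ?sqr_ge0//; nra.
Qed.

Section stopped_product.
Context d (T : measurableType d) (R : realType) (P : probability T R).
Variable F : nat -> nat -> T -> R.
Hypothesis mF : forall j k, measurable_fun setT (F j k).
Hypothesis indF : mutually_independent P F.
Let wF := wmap F.

Variables (u : nat) (y : nat -> weights R -> R) (a : R) (m : nat).
Hypothesis a0 : (0 < a)%R.
Hypothesis my : forall (J : pred (nat * nat)) j, J (u, j) ->
  measurable_fun (setT : set (wT R J)) (y j).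
Hypothesis y0 : forall j f, (0 <= y j f)%R.
Hypothesis Ey : forall j, (m <= j)%N -> \int[P]_w (y j (wF w))%:E <= 1.

(* the partial product of the [y (m + j)], frozen once it exceeds [a] *)
Let V := fix V n (f : weights R) : R := if n is n'.+1 then
  (if a <= V n' f then V n' f else V n' f * y (m + n') f)%R else 1%R.

Let V0 n f : (0 <= V n f)%R.
Proof. by elim: n => //= n IH; case: ifP => // _; rewrite mulr_ge0. Qed.

Let mV (J : pred (nat * nat)) n : (forall j, (j < m + n)%N -> J (u, j)) ->
  measurable_fun (setT : set (wT R J)) (V n).
Proof.
elim: n => [|n IH] Jn /=; first exact: measurable_cst.
have mVn : measurable_fun (setT : set (wT R J)) (V n).
  by apply: IH => j jn; apply: Jn; lia.
apply: measurable_fun_ifT => //; first exact: measurable_fun_ler.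
by apply: measurable_funM => //; apply: my; apply: Jn; lia.
Qed.

Let mcomp (h : weights R -> R) : measurable_fun (setT : set (wT R predT)) h ->
  measurable_fun setT (fun w => h (wF w)).
Proof. by move=> mh; exact: (measurableT_comp mh (@measurable_wmap _ _ _ F predT mF)). Qed.

Let EV n : \int[P]_w (V n (wF w))%:E <= 1.
Proof.
elim: n => [|n IH]; first by rewrite P_integral_cst.
(* The part of the product not yet frozen. It involves only indices below m + n, hence is
   independent of the factor that multiplies it next. *)
pose g f : R := (V n f * (V n f < a)%R%:R)%R.
have mVn (J : pred (nat * nat)) : (forall j, (j < m + n)%N -> J (u, j)) ->
    measurable_fun (setT : set (wT R J)) g.
  move=> Jn; apply: measurable_funM; first exact: mV.
  by apply: measurable_natmulb; apply: measurable_fun_ltr => //; exact: mV.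
have mVT := @mV predT n (fun _ _ => isT); have mgT := mVn predT (fun _ _ => isT).
have g0 f : (0 <= g f)%R by rewrite mulr_ge0.
have goo : \int[P]_w (g (wF w))%:E < +oo.
  apply: (@le_lt_trans _ _ 1); last by rewrite ltry.
  apply: le_trans IH; apply: ge0_le_integral => //.
  - by move=> w _; rewrite lee_fin.
  - by apply/measurable_EFinP; exact: mcomp.
  - by apply/measurable_EFinP; exact: mcomp.
  - by move=> w _; rewrite lee_fin ler_piMr// lern1 leq_b1.
have myT : measurable_fun (setT : set (wT R predT)) (y (m + n)) by exact: my.
have e1 : \int[P]_w (V n.+1 (wF w))%:E = \int[P]_w (V n (wF w) * (a <= V n (wF w))%R%:R)%:E
    + \int[P]_w (g (wF w) * y (m + n) (wF w))%:E.
  rewrite -ge0_integralD//.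
  - apply: eq_integral => w _; rewrite -EFinD /g /=; congr (_%:E).
    by case: leP => _; rewrite ?mulr1 ?mulr0 ?mul0r ?addr0 ?add0r.
  - by move=> w _; rewrite lee_fin mulr_ge0.
  - apply/measurable_EFinP; apply: measurable_funM; first exact: mcomp.
    by apply: measurable_natmulb; apply: measurable_fun_ler => //; exact: mcomp.
  - by move=> w _; rewrite lee_fin mulr_ge0.
  - by apply/measurable_EFinP; apply: measurable_funM; exact: mcomp.
have e2 : \int[P]_w (V n (wF w))%:E = \int[P]_w (V n (wF w) * (a <= V n (wF w))%R%:R)%:E
    + \int[P]_w (g (wF w))%:E.
  rewrite -ge0_integralD//.
  - apply: eq_integral => w _; rewrite -EFinD /g /=; congr (_%:E).
    by case: leP => _; rewrite ?mulr1 ?mulr0 ?addr0 ?add0r.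
  - by move=> w _; rewrite lee_fin mulr_ge0.
  - apply/measurable_EFinP; apply: measurable_funM; first exact: mcomp.
    by apply: measurable_natmulb; apply: measurable_fun_ler => //; exact: mcomp.
  - by move=> w _; rewrite lee_fin.
  - by apply/measurable_EFinP; exact: mcomp.
apply: le_trans IH; rewrite e1 e2; apply: leeD2l.
rewrite (@integral_indep _ _ _ P F mF indF (fun x => x.2 < m + n)%N g (y (m + n)))//.
- rewrite -[leRHS]mule1; apply: lee_wpmul2l; last exact: Ey (leq_addr _ _).
  by apply: integral_ge0 => w _; rewrite lee_fin.
- exact: mVn.
- by apply: my => /=; rewrite ltnn.
Qed.

Lemma prod_maximal :
  P [set w | exists n, (a <= \prod_(m <= j < m + n) y j (wF w))%R] <= (a^-1)%:E.
Proof.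
have mVS n : measurable [set w | (a <= V n (wF w))%R].
  apply: measurable_setb; apply: measurable_fun_ler => //; apply: mcomp.
  exact: mV.
have VS n f : (a <= V n f)%R -> (a <= V n.+1 f)%R by move=> h; rewrite /= h.
have prodE n f : (V n f < a)%R -> (V n f = \prod_(m <= j < m + n) y j f)%R.
  elim: n => [|n IH]; first by rewrite addn0 big_geq.
  rewrite /=; case: (leP a (V n f)) => [aV|Va _]; first by move=> /(le_lt_trans aV); rewrite ltxx.
  by rewrite addnS big_nat_recr ?leq_addr//= (IH Va).
have -> : [set w | exists n, (a <= \prod_(m <= j < m + n) y j (wF w))%R]
    = \bigcup_n [set w | (a <= V n (wF w))%R].
  apply/seteqP; split => w /=.
    move=> [n an]; exists n => //=; rewrite leNgt; apply/negP => Va.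
    by move: an; rewrite -prodE// leNgt Va.
  move=> [n _ /=]; elim: n => [|n IH] /=; first by move=> h; exists 0%N; rewrite addn0 big_geq.
  case: (leP a (V n (wF w))) => [aV _|Va aV]; first exact: IH aV.
  by exists n.+1; rewrite addnS big_nat_recr ?leq_addr//= -(prodE _ _ Va).
apply: P_bigcup_le => //.
  move=> i j /subnK <-; apply/subsetPset => w /=; elim: (j - i)%N => // k IH /IH.
  exact: VS.
move=> n; rewrite (P_boolE P (e := fun w => a <= V n (wF w))%R); last first.
  by apply: measurable_fun_ler => //; apply: mcomp; exact: mV.
have mVT : measurable_fun setT (fun w => V n (wF w)) by apply: mcomp; exact: mV.
apply: (@le_trans _ _ (\int[P]_w ((a^-1)%:E * (V n (wF w))%:E))).
  apply: ge0_le_integral => //.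
  - by apply/measurable_EFinP; apply: measurable_natmulb; exact: measurable_fun_ler.
  - by apply: measurable_funeM; apply/measurable_EFinP.
  - move=> w _; rewrite -EFinM lee_fin; case: (leP a (V n (wF w))) => aV.
      by rewrite ler_pdivlMl// mulr1.
    by rewrite mulr_ge0// invr_ge0 ltW.
rewrite ge0_integralZl_EFin//.
- rewrite -[leRHS]mule1; apply: lee_wpmul2l; last exact: EV.
  by rewrite lee_fin invr_ge0 ltW.
- by move=> w _; rewrite lee_fin.
- by apply/measurable_EFinP.
- by rewrite invr_ge0 ltW.
Qed.

End stopped_product.

Lemma measurable_exists d (T : measurableType d) (e : nat -> T -> bool) :
  (forall n, measurable_fun setT (e n)) -> measurable [set w | exists n, e n w].
Proof.
move=> me; have -> : [set w | exists n, e n w] = \bigcup_n [set w | e n w].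
  by apply/seteqP; split => w [n]; exists n.
by apply: bigcupT_measurable => n; exact: measurable_setb.
Qed.

Section deviations.
Context d (T : measurableType d) (R : realType) (P : probability T R).
Variable F : nat -> nat -> T -> R.
Hypothesis mF : forall j k, measurable_fun setT (F j k).
Hypothesis F_gt0 : forall j k w, (0 < F j k w)%R.
Hypothesis indF : mutually_independent P F.
Hypothesis idF : forall j k (B : set R), measurable B ->
  P (F j k @^-1` B) = P (F 0%N k @^-1` B).
Variable x : nat -> R.
Hypothesis x_gt0 : forall j, (0 < x j)%R.
Hypothesis Fx : forall u j w, (x j <= F u j w)%R.

Let wF := wmap F.

Definition mean_inv j : R := fine (\int[P]_w ((F 0%N j w)^-1)%:E).

Let Finv u j w : (0 <= (F u j w)^-1 <= (x j)^-1)%R.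
Proof. by rewrite invr_ge0 (ltW (F_gt0 _ _ _)) /= lef_pV2 ?posrE. Qed.

Let mFinv u j : measurable_fun setT (fun w => (F u j w)^-1)%R.
Proof. exact: measurable_funV. Qed.

Let intFinv u j : P.-integrable setT (EFin \o (fun w => (F u j w)^-1)%R).
Proof.
apply: measurable_bounded_integrable => //.
  by rewrite ltey_eq fin_num_measure.
exists (x j)^-1%R; split; first exact: num_real.
move=> M xM w _ /=; have /andP[h0 h1] := Finv u j w.
by rewrite ger0_norm// (le_trans h1)// ltW.
Qed.

Lemma integral_Finv u j : \int[P]_w ((F u j w)^-1)%:E = (mean_inv j)%:E.
Proof.
rewrite /mean_inv fineK; last exact: (integrable_fin_num measurableT (intFinv 0 j)).
transitivity (\int[P]_w ((fun y => `|y^-1|)%R (F u j w))%:E).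
  by apply: eq_integral => w _; rewrite ger0_norm//; have /andP[] := Finv u j w.
rewrite (integral_id mF idF (phi := fun y => `|y^-1|%R))//.
  by apply: eq_integral => w _; rewrite ger0_norm//; have /andP[] := Finv 0 j w.
by apply: (measurableT_comp (@normr_measurable _ _)); exact: measurable_funV.
Qed.

Definition inv_dev u (m k : nat) (f : weights R) : R :=
  (\sum_(m <= j < k) ((f u j)^-1 - mean_inv j))%R.

Let mdev u m k : measurable_fun setT (fun w => inv_dev u m k (wF w)).
Proof.
have mh : measurable_fun (setT : set (wT R predT)) (inv_dev u m k).
  apply: measurable_sum_nat => j _; apply: measurable_funB => //.
  by apply: measurable_funV => //; exact: measurable_coord.
exact: (measurableT_comp mh (@measurable_wmap _ _ _ F predT mF)).
Qed.

(** With c the quadratic correction, the mean of exp(t / F) is at most 1 + c + t * mean <= exp(c + t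
    * mean). For negative t the hypothesis is automatic. *)
Lemma exp_moment u j (t : R) : (t / x j <= 1 / 2)%R ->
  \int[P]_w (expR (t * ((F u j w)^-1 - mean_inv j) - 2 * t ^+ 2 * x j ^- 2))%:E <= 1.
Proof.
move=> tx; pose c : R := (2 * t ^+ 2 * x j ^- 2)%R.
have mexp : measurable_fun setT (fun w => expR (t * (F u j w)^-1))%R.
  apply: (measurableT_comp (@measurable_expR _)); exact: measurable_funM.
have le w : (expR (t * (F u j w)^-1) <= (1 + c) + t * (F u j w)^-1)%R.
  have /andP[h0 h1] := Finv u j w.
  apply: le_trans (expR_le_quad _) _.
    have [t0|t0] := leP 0%R t; first exact: le_trans (ler_wpM2l t0 h1) tx.
    by rewrite (@le_trans _ _ 0%R)// nmulr_rle0.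
  rewrite addrAC lerD2r lerD2l /c -mulrA ler_pM2l// exprMn ler_wpM2l ?sqr_ge0//.
  by rewrite -exprVn ler_sqr ?nnegrE// invr_ge0 ltW.
have H : \int[P]_w (expR (t * (F u j w)^-1))%:E <= (1 + c + t * mean_inv j)%:E.
  have iZ : P.-integrable setT (fun w => t%:E * ((F u j w)^-1)%:E).
    exact: (integrableZl measurableT t (intFinv u j)).
  have iC : P.-integrable setT (fun=> (1 + c)%:E).
    by apply: finite_measure_integrable_cst.
  apply: (@le_trans _ _ (\int[P]_w ((1 + c)%:E + t%:E * ((F u j w)^-1)%:E))).
    apply: ge0_le_integral => //.
    - by apply/measurable_EFinP.
    - apply: emeasurable_funD => //; apply: measurable_funeM; exact/measurable_EFinP.
    - by move=> w _; rewrite -EFinM -EFinD lee_fin.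
  rewrite (integralD measurableT iC iZ) P_integral_cst.
  rewrite (integralZl measurableT (intFinv u j)) integral_Finv.
  by rewrite -EFinM -EFinD lee_fin.
pose e : R := expR (- (t * mean_inv j + c)).
have -> : \int[P]_w (expR (t * ((F u j w)^-1 - mean_inv j) - 2 * t ^+ 2 * x j ^- 2))%:E
    = e%:E * \int[P]_w (expR (t * (F u j w)^-1))%:E.
  rewrite -ge0_integralZl_EFin//.
    apply: eq_integral => w _; rewrite -EFinM /e -expRD; congr (expR _)%:E.
    by rewrite /c; ring.
  - by apply/measurable_EFinP.
  - exact: expR_ge0.
apply: (@le_trans _ _ (e%:E * (expR (t * mean_inv j + c))%:E)).
  apply: lee_wpmul2l; first by rewrite lee_fin expR_ge0.
  apply: (le_trans H); rewrite lee_fin.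
  by have := expR_ge1Dx (t * mean_inv j + c); lra.
by rewrite -EFinM /e -expRD addrC subrr expR0.
Qed.

Lemma dev_tail u (t : R) m (c z : R) :
  (forall j, (m <= j)%N -> t / x j <= 1 / 2)%R ->
  (forall n, 2 * t ^+ 2 * (\sum_(m <= j < m + n) x j ^- 2) <= c)%R ->
  P [set w | exists n, (z <= t * inv_dev u m (m + n) (wF w))%R] <= (expR (c - z))%:E.
Proof.
move=> tx hc.
pose y j (f : weights R) : R := expR (t * ((f u j)^-1 - mean_inv j) - 2 * t ^+ 2 * x j ^- 2).
have my (J : pred (nat * nat)) j : J (u, j) -> measurable_fun (setT : set (wT R J)) (y j).
  move=> Juj; apply: (measurableT_comp (@measurable_expR _)).
  apply: measurable_funB => //; apply: measurable_funM => //.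
  apply: measurable_funB => //; apply: measurable_funV => //; exact: measurable_coord.
have y0 j f : (0 <= y j f)%R by exact: expR_ge0.
have Ey j : (m <= j)%N -> \int[P]_w (y j (wF w))%:E <= 1.
  by move=> mj; exact: exp_moment (tx j mj).
have a0 : (0 < expR (z - c))%R by exact: expR_gt0.
have := prod_maximal mF indF a0 my y0 Ey; rewrite -expRN opprB; apply: le_trans.
have prodE n w : (\prod_(m <= j < m + n) y j (wF w) =
    expR (t * inv_dev u m (m + n) (wF w) - 2 * t ^+ 2 * (\sum_(m <= j < m + n) x j ^- 2)))%R.
  rewrite /y /inv_dev -expR_sum; congr expR.
  by rewrite sumrB -mulr_sumr -mulr_sumr.
apply: le_measure; rewrite ?inE.
- apply: (measurable_exists (e := fun n w => z <= t * inv_dev u m (m + n) (wF w))%R) => n.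
  by apply: measurable_fun_ler => //; apply: measurable_funM => //; exact: mdev.
- apply: (measurable_exists (e := fun n w => expR (z - c) <= \prod_(m <= j < m + n) y j (wF w))%R) => n.
  apply: measurable_fun_ler => //; under eq_fun do rewrite prodE.
  apply: (measurableT_comp (@measurable_expR _)).
  by apply: measurable_funB => //; apply: measurable_funM => //; exact: mdev.
- by move=> w /= [n zn]; exists n; rewrite prodE ler_expR; have := hc n; lra.
Qed.

Hypothesis x_tail : forall e : R, (0 < e)%R ->
  exists m, forall n, (\sum_(m <= j < m + n) x j ^- 2 <= e)%R.

Lemma ae_dev_cauchy u : {ae P, forall w, forall i : nat, exists m, forall n,
  (`|inv_dev u m (m + n) (wF w)| <= i.+1%:R^-1)%R}.
Proof.
apply: ae_foralln => i.
pose E m := [set w | exists n, (i.+1%:R^-1 < `|inv_dev u m (m + n) (wF w)|)%R].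
have mE m : measurable (E m).
  apply: (measurable_exists (e := fun n w => i.+1%:R^-1 < `|inv_dev u m (m + n) (wF w)|)%R) => n.
  by apply: measurable_fun_ltr => //; apply: measurableT_comp => //; exact: mdev.
have small (k : nat) : exists m, P (E m) <= (k.+1%:R^-1)%:E.
  (* A deviation of 1 / (i+1) becomes q after multiplication by t, so each tail is at most exp(1 -
     q) <= 1 / q, and the two tails add up to 1 / (k+1). The tail of the series is taken below 1 /
     (4 t^2), which yields both the bound on the variance and t / x j <= 1/2. *)
  pose q : R := (2 * k.+1%:R)%R; pose t : R := (q * i.+1%:R)%R.
  have q0 : (0 < q)%R by rewrite mulr_gt0.
  have t0 : (0 < t)%R by rewrite mulr_gt0.
  have t2 : (0 < t ^+ 2)%R by rewrite exprn_gt0.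
  have [|m hm] := x_tail (e := (1 / (4 * t ^+ 2))%R) _; first by rewrite divr_gt0// mulr_gt0.
  have c1 n : (2 * t ^+ 2 * (\sum_(m <= j < m + n) x j ^- 2) <= 1)%R.
    apply: (le_trans (ler_wpM2l _ (hm n))); first by rewrite mulr_ge0// ltW.
    have -> : (2 * t ^+ 2 * (1 / (4 * t ^+ 2)) = 1 / 2)%R by field; rewrite gt_eqF.
    by lra.
  have tx j : (m <= j)%N -> (t / x j <= 1 / 2)%R.
    move=> mj; have xj : (x j ^- 2 <= 1 / (4 * t ^+ 2))%R.
      apply: le_trans (hm (j.+1 - m)%N); rewrite subnKC; last exact: leqW.
      rewrite big_nat_recr//= lerDr; apply: sumr_ge0 => a _.
      by rewrite invr_ge0 exprn_ge0// ltW.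
    rewrite -ler_sqr ?nnegrE; [|by rewrite divr_ge0 ?ltW|by rewrite divr_ge0].
    rewrite exprMn exprVn; apply: (le_trans (ler_wpM2l (ltW t2) xj)).
    have -> : (t ^+ 2 * (1 / (4 * t ^+ 2)) = 1 / 4)%R by field; rewrite gt_eqF.
    by lra.
  have tx' j : (m <= j)%N -> (- t / x j <= 1 / 2)%R.
    move=> _; apply: (@le_trans _ _ 0%R) => //.
    by rewrite mulNr oppr_le0 divr_ge0// ltW.
  have h1 := @dev_tail u t m 1%R q tx c1.
  have h2 := @dev_tail u (- t) m 1%R q tx'; rewrite sqrrN in h2; have {}h2 := h2 c1.
  have ek : (expR (1 - q) <= (2 * k.+1%:R)^-1)%R.
    rewrite -opprB expRN lef_pV2 ?posrE ?expR_gt0//.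
    by have := expR_ge1Dx (q - 1); rewrite /q; lra.
  exists m.
  pose G t := [set w | exists n, (q <= t * inv_dev u m (m + n) (wF w))%R].
  have mG t' : measurable (G t').
    apply: (measurable_exists (e := fun n w => q <= t' * inv_dev u m (m + n) (wF w))%R) => n.
    by apply: measurable_fun_ler => //; apply: measurable_funM => //; exact: mdev.
  apply: (@le_trans _ _ (P (G t `|` G (- t)%R))).
    apply: le_measure; rewrite ?inE//; first exact: measurableU.
    move=> w [n] lt; have tq : (t / i.+1%:R = q)%R by rewrite /t mulfK.
    have [d0|d0] := leP 0%R (inv_dev u m (m + n) (wF w)).
      left; exists n; rewrite -tq ler_pM2l// ltW//; by rewrite ger0_norm in lt.
    right; exists n; rewrite -tq mulNr -mulrN ler_pM2l// ltW//.
    by rewrite ltr0_norm in lt.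
  apply: le_trans (@measureU2 _ _ _ P _ _ (mG t) (mG (- t)%R)) _.
  apply: le_trans (leeD h1 h2) _; rewrite -EFinD lee_fin.
  have : (k.+1%:R^-1 = (2 * k.+1%:R)^-1 + (2 * k.+1%:R)^-1 :> R)%R by field.
  by move=> ->; exact: lerD.
have mI : measurable (\bigcap_m E m) by exact: bigcapT_measurable.
exists (\bigcap_m E m); split => //.
  apply: P_small0 => k; have [m hm] := small k; apply: le_trans hm.
  by apply: le_measure; rewrite ?inE//; exact: bigcap_inf.
move=> w /= h m _; apply: contrapT => hE; apply: h; exists m => n.
by rewrite leNgt; apply/negP => lt; apply: hE; exists n.
Qed.

End deviations.

Lemma measurable_asbool d (T : measurableType d) (A : set T) : measurable A ->
  measurable_fun setT (fun w => `[< A w >]).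
Proof.
move=> mA; apply: (measurable_fun_bool true).
rewrite setTI (_ : _ @^-1` _ = A)//.
by apply/seteqP; split => w /=; [move/asboolP|move=> ?; apply/asboolP].
Qed.

Lemma P_bigcup_sum_le d (T : measurableType d) (R : realType) (P : probability T R)
  (A : (set T)^nat) (a : nat -> R) (c : R) : (forall i, measurable (A i)) ->
  (forall i, P (A i) <= (a i)%:E) -> (forall n, \sum_(i < n) a i <= c)%R ->
  P (\bigcup_i A i) <= c%:E.
Proof.
move=> mA Aa ac; pose B n := \big[setU/set0]_(i < n) A i.
have mB n : measurable (B n) by apply: bigsetU_measurable.
have -> : \bigcup_i A i = \bigcup_n B n.
  apply/seteqP; split => w [i _]; first by exists i.+1 => //; rewrite /B big_ord_recr; right.
  by rewrite /B -bigcup_mkord => -[j _ Aj]; exists j.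
apply: P_bigcup_le => //.
  by move=> m n mn; apply/subsetPset; exact: subset_bigsetU.
move=> n; apply: (@le_trans _ _ (\sum_(i < n) a i)%R%:E); last by rewrite lee_fin.
rewrite /B; elim: n => [|n IH]; first by rewrite !big_ord0 measure0.
rewrite !big_ord_recr /= EFinD.
apply: le_trans (@measureU2 _ _ _ P _ _ (mB n) (mA n)) _.
by apply: leeD; [exact: IH|exact: Aa].
Qed.

Lemma eq_Ex_hit (R : realType) (f : nat -> nat -> R) (S S' : pred (seq nat)) n s :
  (forall s', take (size s) s' = s -> S s' = S' s') ->
  Ex f S n (fun s' => (S s')%:R) s = Ex f S' n (fun s' => (S' s')%:R) s.
Proof.
elim: n s => [|n IH] s SS' /=; rewrite SS' ?take_size//.
case: ifP => [->//|_]; apply: eq_step => j _; apply: IH => s' e; apply: SS'.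
exact: take_rconsW e.
Qed.

(** The upper limit is a measurable functional of every array and agrees with the limit where that
    exists; limits of random sums are encoded this way below. *)
Lemma fine_limn_esup (R : realType) (z : nat -> R) (l : R) :
  (z @ \oo --> l)%R -> fine (limn_esup (EFin \o z)) = l.
Proof.
move=> zl; have /cvg_limn_einf_sup[_ ->//] : EFin \o z @ \oo --> l%:E.
by apply/cvg_EFin => //; exact: nearW.
Qed.

Lemma unique_hub_path T (par : nat -> T -> nat) w :
  (forall n, hist par n w \in paths n) ->
  (exists U, forall u, (U <= u)%N -> forall m, (u.+1 <= m)%N ->
    count_mem u.+1 (hist par m w) <> count_mem 0%N (hist par m w)) ->
  (forall u v : nat, u != v -> exists N, forall n, (N <= n)%N ->
    count_mem u (hist par n w) <> count_mem v (hist par n w)) ->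
  unique_persistent_hub (par^~ w).
Proof.
move=> leg [U comp] ties; pose D (n u : nat) := count_mem u (hist par n w).
have DS n u : D n.+1 u = (D n u + (par n w == u))%N by rewrite /D hist_rcons count_rcons.
have root n : (0 < n)%N -> (0 < D n 0)%N.
  have h1 : D 1%N 0%N = 1%N.
    rewrite DS /D /=; have := leg 1%N.
    by rewrite mem_paths /= leqn0 andbT => ->.
  by move=> n0; apply: leq_trans (count_hist_le par 0%N w n0); rewrite -/(D 1%N 0%N) h1.
have lead u v n m : u != v -> (forall k, (n <= k)%N -> D k u <> D k v) ->
    (D n u < D n v)%N -> (n <= m)%N -> (D m u < D m v)%N.
  move=> uv ne lt /subnK <-; elim: (m - n)%N => // i IH; rewrite addSn.
  have := ne (i + n).+1; rewrite !DS => /(_ (leqW (leq_addl _ _))).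
  by move: IH; move: (par _ w) => p; case: (p =P u) uv => [->|_] uv;
    rewrite ?(negPf uv); lia.
(* A late node is born with degree 0, behind node 0, whose degree is positive from time 1 on, and
   never ties with it afterwards. *)
have late v n : (U < v)%N -> (v <= n)%N -> (D n v < D n 0)%N.
  case: v => // v Uv vn; apply: (lead _ _ v.+1) => //; first by move=> k vk; exact: comp.
  by rewrite {1}/D (paths_count0 (leg v.+1))//; exact: root.
(* Induction on the number of early nodes: each additional one either stays behind the current
   leader or replaces it. *)
have [u [N hN]] : exists u N, forall n, (N <= n)%N -> forall v, (v <= U)%N -> v != u ->
    (D n v < D n u)%N.
  elim: U {comp late} => [|M [u [N hN]]].
    by exists 0%N, 0%N => n _ v; rewrite leqn0 => ->.
  have [uM|uM] := eqVneq u M.+1.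
    exists u, N => n Nn v; rewrite leq_eqVlt => /orP[/eqP ->|]; first by rewrite uM eqxx.
    exact: hN.
  have [K hK] := ties _ _ uM; pose L := maxn N K.
  have ne k : (L <= k)%N -> D k u <> D k M.+1.
    by move=> Lk; apply: hK; apply: leq_trans Lk; exact: leq_maxr.
  have NL n : (L <= n)%N -> (N <= n)%N by apply: leq_trans; exact: leq_maxl.
  have [lt|lt|//] := ltngtP (D L u) (D L M.+1); last by have := ne L (leqnn _).
    exists M.+1, L => n Ln v vM vM'.
    have lu := lead _ _ _ _ uM ne lt Ln.
    have [->//|vu] := eqVneq v u; apply: ltn_trans lu; apply: hN; rewrite ?NL//.
    by move: vM vM'; lia.
  exists u, L => n Ln v vM vu; have [->|vM'] := eqVneq v M.+1.
    by apply: (lead _ _ L) => //; [rewrite eq_sym|move=> k Lk e; exact: (ne k Lk)].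
  by apply: hN; rewrite ?NL//; move: vM vM'; lia.
pose L := maxn (maxn N U.+1) u.
have dom n v : (L <= n)%N -> (v <= n)%N -> v != u -> (D n v < D n u)%N.
  move=> Ln vn vu; have Nn : (N <= n)%N by move: Ln; rewrite /L; lia.
  have [vU|vU] := leqP v U; first exact: hN.
  apply: (leq_trans (late _ _ vU vn)); have [->//|u0] := eqVneq u 0%N.
  by apply/ltnW/hN => //; rewrite eq_sym.
exists u; split.
  exists L => n Ln; apply/andP; split; first by move: Ln; rewrite /L; lia.
  apply/forallP => v; rewrite !outdeg_hist; have [->//|vu] := eqVneq (v : nat) u.
  by apply/ltnW/dom => //; rewrite -ltnS.
move=> v [K hK]; apply/eqP; apply: contrapT => /negP vu.
pose n := maxn L K.
have [vn h] := @is_max_degP _ par v n w (hK n (leq_maxr _ _)).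
have Ln : (L <= n)%N by exact: leq_maxl.
have un : (u <= n)%N by move: Ln; rewrite /L; lia.
by have := dom n v Ln vn vu; rewrite ltnNge h.
Qed.

Lemma summable_bound (R : realType) (x : nat -> R) : (forall j, 0 < x j)%R ->
  \sum_(0 <= j <oo) ((x j ^- 2)%R)%:E < +oo ->
  exists2 X, (forall n, \sum_(j < n) x j ^- 2 <= X)%R &
  forall e : R, (0 < e)%R -> exists m, forall n, (\sum_(m <= j < m + n) x j ^- 2 <= e)%R.
Proof.
move=> x_gt0; have x20 j : (0 <= x j ^- 2)%R by rewrite invr_ge0 exprn_ge0// ltW.
set S := \sum_(0 <= j <oo) _ => Soo.
have S0 : 0 <= S by apply: nneseries_ge0 => j _ _; rewrite lee_fin.
have fS : S \is a fin_num by rewrite ge0_fin_numE.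
have le n : (\sum_(0 <= j < n) x j ^- 2 <= fine S)%R.
  rewrite -lee_fin fineK// -sumEFin.
  by apply: (nneseries_lim_ge (u_ := fun j => (x j ^- 2)%:E)) => j _; rewrite lee_fin.
pose t n : R := (\sum_(0 <= j < n) x j ^- 2)%R.
have ht : has_sup (range t).
  by split; [exists (t 0%N), 0%N|exists (fine S) => _ [n _ <-]; exact: le].
have tle n : (t n <= sup (range t))%R by apply: ub_le_sup; [exact: ht.2|exists n].
exists (sup (range t)) => [n|e e0]; first by have := tle n; rewrite /t big_mkord.
have [_ [m _ <-] hm] := sup_adherent e0 ht.
exists m => n; have := tle (m + n)%N.
by rewrite {1}/t (big_cat_nat _ (n := m)) ?leq_addr//= -/(t m); lra.
Qed.

(** * Part 2: finitely many competitors and finitely many ties *)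

Section race_convergent.
Context d (T : measurableType d) (R : realType) (P : probability T R).
Variables (F : nat -> nat -> T -> R) (par : nat -> T -> nat).
Hypothesis mF : forall j k, measurable_fun setT (F j k).
Hypothesis F_gt0 : forall j k w, (0 < F j k w)%R.
Hypothesis indF : mutually_independent P F.
Hypothesis idF : forall j k (B : set R), measurable B ->
  P (F j k @^-1` B) = P (F 0%N k @^-1` B).
Hypothesis gpa : gpa_tree P F par.
Variables (x : nat -> R) (X : R).
Hypothesis x_gt0 : forall j, (0 < x j)%R.
Hypothesis Fx : forall u j w, (x j <= F u j w)%R.
Hypothesis x_sum : forall n, (\sum_(j < n) x j ^- 2 <= X)%R.

Let wF := wmap F.
Local Notation path n w := (hist par n w).
Local Notation wmeas h := (measurable_fun (setT : set (wT R predT)) h).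
Let posF w : posw (wF w). Proof. exact: (posF F_gt0). Qed.
Let mpath dU (U : measurableType dU) n (g : seq nat -> weights R -> U)
  (mg : forall s, wmeas (g s)) : measurable_fun setT (fun w => g (path n w) (wF w)) :=
  measurable_path mF gpa n mg.
Local Notation dev := (inv_dev P F).

Variable lam : R.
Hypothesis lam0 : (0 < lam)%R.
Hypothesis rho : forall M, (Hrec (er P F lam) M 0 <= 1 / 2)%R.

Lemma qS_le_X w u k : (qS (wF w) u k <= X)%R.
Proof.
apply: le_trans (x_sum k); apply: ler_sum => j _.
have f0 := posF w u j; rewrite lef_pV2 ?posrE ?exprn_gt0//.
by apply: lerXn2r; rewrite ?nnegrE ?(ltW f0) ?(ltW (x_gt0 j))//; exact: Fx.
Qed.

Let low u (i : nat) : set (weights R) := [set f | exists k, (i%:R <= - dev u 0 k f)%R].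

Let mdev (J : pred (nat * nat)) u k : (forall j, J (u, j)) ->
  measurable_fun (setT : set (wT R J)) (dev u 0 k).
Proof.
move=> Ju; apply: measurable_sum_nat => j _; apply: measurable_funB => //.
by apply: measurable_funV => //; exact: measurable_coord.
Qed.

Let mlow (J : pred (nat * nat)) u i : (forall j, J (u, j)) ->
  (wcyl J).-sigma.-measurable (low u i).
Proof.
move=> Ju; apply: (@measurable_exists _ (wT R J) (fun k f => i%:R <= - dev u 0 k f)%R) => k.
apply: measurable_fun_ler => //; apply: measurable_funN; exact: mdev.
Qed.

Let C1 : R := expR (8 * lam ^+ 2 * X).

(** The exponent is -2 lam because a dip of depth i will cost a factor exp(lam i) in the tie bound;
    half of the decay survives. *)
Let P_low u i : P (wF @^-1` low u i) <= (C1 * expR (- (2 * lam * i%:R)))%:E.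
Proof.
have h := @dev_tail _ _ _ P F mF F_gt0 indF idF x x_gt0 Fx u (- (2 * lam))%R 0
  (8 * lam ^+ 2 * X)%R (2 * lam * i%:R)%R.
apply: le_trans (le_trans (h _ _) _).
- rewrite le_eqVlt; apply/orP; left; apply/eqP; congr (P _).
  apply/seteqP; split => w [k hk]; exists k; rewrite add0n in hk *.
    by move: hk; rewrite mulNr -mulrN ler_pM2l// mulr_gt0.
  by move: hk; rewrite mulNr -mulrN ler_pM2l// mulr_gt0.
- move=> j _; apply: (@le_trans _ _ 0%R) => //.
  by rewrite mulNr oppr_le0 divr_ge0 ?ltW// mulr_gt0.
- move=> n; rewrite add0n big_mkord sqrrN exprMn.
  have := ler_wpM2l (sqr_ge0 lam) (x_sum n); lra.
- by rewrite lee_fin /C1 -expRD.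
Qed.

Section tie_events.
Variable K : nat.
Let bnd0 : set (weights R) := [set f | forall k, (dev 0 0 k f <= K%:R)%R].

Let mbnd0 : (wcyl predT).-sigma.-measurable bnd0.
Proof.
have -> : bnd0 = \bigcap_k [set f | (dev 0 0 k f <= K%:R)%R].
  by apply/seteqP; split => f h k; [move=> _; exact: h|exact: h].
apply: bigcapT_measurable => k.
apply: (@measurable_setb _ (wT R predT) (fun f => dev 0 0 k f <= K%:R)%R).
by apply: measurable_fun_ler => //; exact: mdev.
Qed.

(** The integer i is the depth of the lowest dip of the deviations of node u; sorting by it replaces
    an unbounded random constant by a countable union. *)
Let b u i (s : seq nat) (f : weights R) :=
  [&& `[< bnd0 f >], `[< low u i f >] & ~~ `[< low u i.+1 f >]].
Let S u (s : seq nat) (f : weights R) :=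
  (count_mem u s == count_mem 0%N s) && (tS f s <= aS f 0 (count_mem 0%N s) + K%:R)%R.

Let mb u i s : wmeas (b u i s).
Proof.
have ml j : wmeas (fun f => `[< low u j f >]).
  by apply: (@measurable_asbool _ (wT R predT)); exact: mlow.
apply: measurable_and; first exact: (@measurable_asbool _ (wT R predT)).
by apply: measurable_and => //; exact: measurable_neg.
Qed.

Let mS u s : wmeas (S u s).
Proof.
apply: measurable_and => //; apply: measurable_fun_ler; first exact: measurable_tS.
by apply: measurable_funD => //; exact: measurable_aS.
Qed.

Let cK i : R := expR (lam * (2 * K%:R + i.+1%:R) + lam ^+ 2 * X).

(** At a tie of degree k, the sums of u and of node 0 have the same mean part, so the clock is at
    most [aS u k] + 2 K + i + 1, and the martingale [Pu * CS] is at least [(cK i)^-1]. It starts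
    from [CS] at time u, when the degree of u is 0. *)
Let tie_Ex u i w s n : s \in paths u -> b u i s (wF w) ->
  (Ex (wF w) ((S u)^~ (wF w)) n (fun s' => (S u s' (wF w))%:R) s
    <= cK i * CS (wF w) lam s)%R.
Proof.
move=> sp /and3P[/asboolP b0 _ /asboolPn lowi].
have us : (u <= size s)%N by rewrite (size_paths sp).
have -> : (cK i * CS (wF w) lam s = cK i * Ex (wF w) ((S u)^~ (wF w)) n
    (fun s => Pu (wF w) lam u (count_mem u s) * CS (wF w) lam s) s
    + 0 * Ex (wF w) ((S u)^~ (wF w)) n (fun=> 0) s)%R.
  rewrite (Ex_PuCS (posF w) lam0)//.
  by rewrite (paths_count0 sp (leqnn _)) /Pu big_ord0 mul1r mul0r addr0.
rewrite -Ex_lin//; apply: (ler_Ex (posF w) (Inv := fun=> true)) => // s' _.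
rewrite mul0r addr0.
have CS0 : (0 < CS (wF w) lam s')%R by apply: CS_gt0 => //; exact: posF.
case: (boolP (S u s' (wF w))) => [/andP[/eqP uk tK]|_]; last first.
  rewrite mulr_ge0 ?expR_ge0// mulr_ge0 ?(ltW CS0)//; apply: prodr_ge0 => j _.
  by rewrite addr_ge0// divr_ge0 ?ltW//; exact: posF.
set k := count_mem 0%N s' in uk tK *; rewrite uk.
have h1 := Pu_ge_exp (posF w) lam0 u k; have h2 := CS_ge_exp (posF w) lam0 s'.
apply: (@le_trans _ _ (cK i * (expR (lam * aS (wF w) u k - lam ^+ 2 * qS (wF w) u k)
    * expR (- (lam * tS (wF w) s'))))%R); last first.
  by rewrite ler_wpM2l ?expR_ge0// ler_pM ?expR_ge0.
rewrite /cK -!expRD -[leLHS]expR0 ler_expR.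
have aE v : aS (wF w) v k = (dev v 0 k (wF w) + \sum_(j < k) mean_inv P F j)%R.
  by rewrite /inv_dev sumrB !big_mkord subrK.
have d0 := b0 k.
have d1 : (- i.+1%:R <= dev u 0 k (wF w))%R.
  by rewrite lerNl leNgt; apply/negP => lt; apply: lowi; exists k; exact: ltW.
have q := ler_wpM2l (sqr_ge0 lam) (qS_le_X w u k).
have a0 := aE 0%N; have a1 := aE u.
have t1 : (tS (wF w) s' <= aS (wF w) u k + 2 * K%:R + i.+1%:R)%R by lra.
have := ler_wpM2l (ltW lam0) t1; lra.
Qed.

Definition tie_event u := \bigcup_i [set w | b u i (path u w) (wF w) /\
  exists2 m, (u <= m)%N & S u (path m w) (wF w)].

Lemma measurable_tie_event u : measurable (tie_event u).
Proof. by apply: bigcupT_measurable => i; apply: (measurable_hitset mF gpa). Qed.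

Let EC u : R := fine (\int[P]_w (CS (wF w) lam (path u w))%:E).

Let ECE u : \int[P]_w (CS (wF w) lam (path u w))%:E = (EC u)%:E.
Proof.
rewrite /EC fineK// ge0_fin_numE; last first.
  by apply: integral_ge0 => w _; rewrite lee_fin; apply/ltW/CS_gt0 => //; exact: posF.
apply: (@le_lt_trans _ _ (\int[P]_w 1%:E)); last by rewrite P_integral_cst ltry.
apply: ge0_le_integral => //.
- by move=> w _; rewrite lee_fin; apply/ltW/CS_gt0 => //; exact: posF.
- apply/measurable_EFinP; apply: (@mpath _ _ u (fun s f => CS f lam s)) => s.
  exact: measurable_CS.
- by move=> w _; rewrite lee_fin; apply: CS_le1 => //; exact: posF.
Qed.

(** The history up to time u involves only nodes below u, so [CS] at that time is independent of the
    dip of node u. *)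
Let P_tie_i u i : P [set w | b u i (path u w) (wF w) /\
  exists2 m, (u <= m)%N & S u (path m w) (wF w)]
  <= (cK i * (EC u * (C1 * expR (- (2 * lam * i%:R)))))%:E.
Proof.
pose h (f : weights R) : R := (`[< low u i f >])%:R.
have mCSs s : wmeas (fun f : weights R => CS f lam s) by exact: measurable_CS.
have mh (J : pred (nat * nat)) : (forall j, J (u, j)) -> measurable_fun (setT : set (wT R J)) h.
  move=> Ju; apply: (@measurable_natmulb _ (wT R J)); apply: (@measurable_asbool _ (wT R J)).
  exact: mlow.
have mhT := mh predT (fun _ => isT).
have mhw : measurable_fun setT (fun w => h (wF w)).
  exact: (measurableT_comp mhT (@measurable_wmap _ _ _ F predT mF)).
have mCS : measurable_fun setT (fun w => CS (wF w) lam (path u w)).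
  exact: (@mpath _ _ u (fun s f => CS f lam s)).
have CS0 w s : (0 <= CS (wF w) lam s)%R by apply/ltW/CS_gt0 => //; exact: posF.
apply: (le_trans (@hit_le _ _ _ P F par mF F_gt0 gpa u (b u i) (S u)
  (fun s f => `|cK i * CS f lam s|)%R _ _ _ _ _)) => //.
- move=> s; apply: (measurableT_comp (@normr_measurable _ _)); exact: measurable_funM.
- move=> w s n sp bs; apply: le_trans (ler_norm _); exact: tie_Ex.
apply: (@le_trans _ _ (\int[P]_w ((cK i)%:E * (CS (wF w) lam (path u w) * h (wF w))%:E))).
  apply: ge0_le_integral => //.
  - apply/measurable_EFinP; apply: measurable_funM.
      by apply: measurable_natmulb; exact: mpath.
    apply: (measurableT_comp (@normr_measurable _ _)); exact: measurable_funM.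
  - apply: measurable_funeM; apply/measurable_EFinP; exact: measurable_funM.
  - move=> w _; rewrite -EFinM lee_fin ger0_norm; last by rewrite mulr_ge0 ?expR_ge0.
    rewrite /h /b [leRHS]mulrA [leLHS]mulrC; apply: ler_wpM2l; first by rewrite mulr_ge0 ?expR_ge0.
    by rewrite ler_nat; case: `[< low u i _ >]; rewrite ?andbF ?leq_b1.
rewrite ge0_integralZl_EFin//; last 3 first.
- by move=> w _; rewrite lee_fin mulr_ge0.
- by apply/measurable_EFinP; exact: measurable_funM.
- exact: expR_ge0.
rewrite EFinM; apply: lee_wpmul2l; first by rewrite lee_fin expR_ge0.
have -> : \int[P]_w (CS (wF w) lam (path u w) * h (wF w))%:E =
    \int[P]_w (Ex (wF w) pred0 u (CS (wF w) lam) [::] * h (wF w))%:E.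
  rewrite (@integral_Ex_pos _ _ _ P F par mF F_gt0 gpa (fun s f => CS f lam s * h f)%R)//.
  - apply: eq_integral => w _; congr (_%:E).
    rewrite -[RHS]addr0 mulrC -[X in (_ = _ + X)%R](mul0r (Ex (wF w) pred0 u (CS (wF w) lam) [::])).
    by rewrite -Ex_lin//; apply: eq_Ex => s; rewrite mul0r addr0 mulrC.
  - by move=> s; apply: measurable_funM.
  - by move=> s w; rewrite mulr_ge0.
have eE : \int[P]_w (Ex (wF w) pred0 u (CS (wF w) lam) [::])%:E = (EC u)%:E.
  by rewrite -ECE -(@integral_Ex_pos _ _ _ P F par mF F_gt0 gpa (fun s f => CS f lam s)).
rewrite (@integral_indep_pos _ _ _ P F mF indF (fun y => y.1 < u)%N
  (fun f => Ex f pred0 u (CS f lam) [::]) h)//.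
- rewrite eE EFinM; apply: lee_wpmul2l.
    by rewrite -ECE; apply: integral_ge0 => w _; rewrite lee_fin.
  have -> : \int[P]_w (h (wF w))%:E = P (wF @^-1` low u i).
    rewrite /h -(P_boolE P (e := fun w => `[< low u i (wF w) >])).
      by congr (P _); apply/seteqP; split => w /= /asboolP.
    apply: measurable_asbool; apply: (@measurable_pre _ _ _ F mF predT); exact: mlow.
  exact: P_low.
- apply: (@measurable_Ex _ _ u (fun s f => CS f lam s)) => [j k //|s sp].
  by apply: measurable_CS => j k; rewrite (size_paths sp).
- by apply: mh => j /=; rewrite ltnn.
- by move=> w; rewrite -(Ex_cst (posF w) pred0 u 0%R [::]); exact: ler_Ex_paths.
- by rewrite eE ltry.
Qed.

(** For fixed u the bounds over i form a geometric series of ratio exp(- lam); what remains is a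
    multiple of E[C_u], summed from u = 1 by [CS_sum]. Borel-Cantelli concludes. *)
Lemma tie_event_io : P (lim_sup_set (fun u => tie_event u.+1)) = 0.
Proof.
pose q : R := expR (- lam); pose D0 : R := (C1 * expR (lam * (2 * K%:R + 1) + lam ^+ 2 * X))%R.
have q1 : (q < 1)%R by rewrite /q -expR0 ltr_expR oppr_lt0.
have q0 : (0 < q)%R by exact: expR_gt0.
have geo n : (\sum_(i < n) q ^+ i <= 1 / (1 - q))%R.
  rewrite ler_pdivlMr ?subr_gt0//.
  have -> : ((\sum_(i < n) q ^+ i) * (1 - q) = 1 - q ^+ n)%R.
    elim: n => [|n IH]; first by rewrite big_ord0 mul0r expr0 subrr.
    by rewrite big_ord_recr /= mulrDl IH exprS; ring.
  by rewrite lerBlDr lerDl exprn_ge0// ltW.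
have D00 : (0 <= D0)%R by rewrite mulr_ge0 ?expR_ge0.
have EC0 u : (0 <= EC u)%R.
  rewrite /EC fine_ge0//; apply: integral_ge0 => w _; rewrite lee_fin.
  by apply/ltW/CS_gt0 => //; exact: posF.
have Ptie u : P (tie_event u) <= (EC u * (D0 / (1 - q)))%:E.
  apply: (@P_bigcup_sum_le _ _ _ P _ (fun i => EC u * D0 * q ^+ i)%R).
  - by move=> i; apply: (measurable_hitset mF gpa).
  - move=> i; apply: le_trans (P_tie_i u i) _; rewrite lee_fin le_eqVlt; apply/orP; left.
    apply/eqP; rewrite /cK /D0 /q -expRM_natl mulrCA -[RHS]mulrA; congr (_ * _)%R.
    rewrite [LHS]mulrCA -[RHS]mulrA; congr (_ * _)%R; rewrite -!expRD; congr expR.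
    by rewrite -natr1; ring.
  - move=> n; rewrite -mulr_sumr -[leLHS]mulrA; do 2![apply: ler_wpM2l => //].
    by rewrite -div1r; exact: geo.
apply: lim_sup_set_cvg0; first by move=> u; exact: measurable_tie_event.
apply: (@le_lt_trans _ _ (D0 / (1 - q))%:E); last by rewrite ltry.
apply: lime_le; first by apply: is_cvg_nneseries => u _ _; exact: measure_ge0.
apply: nearW => n; rewrite big_mkord.
apply: (@le_trans _ _ (\sum_(u < n) (EC u.+1 * (D0 / (1 - q)))%:E)).
  by apply: lee_sum => u _; exact: Ptie.
rewrite sumEFin lee_fin -mulr_suml ler_piMl//; first by rewrite divr_ge0// subr_ge0 ltW.
exact: (CS_sum mF F_gt0 indF idF gpa n lam0 rho).
Qed.

End tie_events.

Hypothesis x_tail : forall e : R, (0 < e)%R ->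
  exists m, forall n, (\sum_(m <= j < m + n) x j ^- 2 <= e)%R.

Lemma ae_drift_bounded : {ae P, forall w, exists a : R, forall m,
  (tS (wF w) (path m w) <= aS (wF w) 0 (count_mem 0%N (path m w)) + a)%R}.
Proof.
pose r k : R := (X - \sum_(j < k) x j ^- 2)%R.
pose Y s (f : weights R) : R := ((aS f 0 (count_mem 0%N s) - tS f s) ^+ 2 + r (count_mem 0%N s))%R.
have r0 k : (0 <= r k)%R by rewrite subr_ge0.
have h := @ae_supermart_bounded _ _ _ P F par mF F_gt0 gpa 0 (fun _ _ => true) Y.
apply: filterS (h _ _ _ _) => //.
- move=> w /(_ isT)[a ha]; exists (1 + a)%R => m.
  have := ha m (leq0n _); rewrite /Y.
  have := r0 (count_mem 0%N (path m w)).
  move: (aS _ _ _) (tS _ _) (r _) => A B C hC hY.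
  have : (2 * (B - A) <= (A - B) ^+ 2 + 1)%R by have := sqr_ge0 (A - B + 1)%R; lra.
  have [AB|AB] := leP B A; last by lra.
  by have := sqr_ge0 (A - B)%R; lra.
- move=> s; apply: measurable_funD => //; apply: measurable_funX.
  by apply: measurable_funB; [exact: measurable_aS|exact: measurable_tS].
- by move=> w s; rewrite addr_ge0// sqr_ge0.
- move=> w s _ _; apply: step_drift => // k.
  have -> : (r k - r k.+1 = x k ^- 2)%R by rewrite /r big_ord_recr /=; ring.
  have f0 := posF w 0%N k; rewrite lef_pV2 ?posrE ?exprn_gt0//.
  by apply: lerXn2r; rewrite ?nnegrE ?(ltW f0) ?(ltW (x_gt0 k))//; exact: Fx.
Qed.

Lemma ae_dev_bounded : {ae P, forall w, forall u, exists B : nat, forall k,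
  (`|dev u 0 k (wF w)| <= B%:R)%R}.
Proof.
apply: ae_foralln => u.
apply: filterS (ae_dev_cauchy mF F_gt0 indF idF x_gt0 Fx x_tail u) => w /(_ 0%N)[m hm].
pose B : R := (\sum_(k < m.+1) `|dev u 0 k (wF w)| + 1)%R.
exists (Num.truncn B).+1 => k; apply: (@le_trans _ _ B); last by rewrite ltW// truncnS_gt.
have le i : (i <= m)%N -> (`|dev u 0 i (wF w)| <= \sum_(k < m.+1) `|dev u 0 k (wF w)|)%R.
  move=> im; have im' : (i < m.+1)%N by [].
  rewrite (bigD1 (Ordinal im'))//= lerDl; by apply: sumr_ge0.
have [km|km] := leqP k m; first by rewrite (le_trans (le k km))// lerDl.
have -> : dev u 0 k (wF w) = (dev u 0 m (wF w) + dev u m (m + (k - m)) (wF w))%R.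
  rewrite subnKC; last exact: ltnW.
  by rewrite /inv_dev [LHS](big_cat_nat _ (n := m))//= ltnW.
apply: le_trans (ler_normD _ _) _; apply: lerD; first exact: le.
by apply: le_trans (hm _) _; rewrite invr1.
Qed.

Lemma ae_finite_competitors : {ae P, forall w, exists U, forall u, (U <= u)%N ->
  forall m, (u.+1 <= m)%N -> count_mem u.+1 (path m w) <> count_mem 0%N (path m w)}.
Proof.
have io : {ae P, forall w, forall K : nat, ~ lim_sup_set (fun u => tie_event K u.+1) w}.
  apply: ae_foralln => K.
  exists (lim_sup_set (fun u => tie_event K u.+1)); split => //.
  - apply: bigcapT_measurable => n; apply: bigcup_measurable => u _.
    exact: measurable_tie_event.
  - exact: tie_event_io.
  - by move=> w /= /contrapT.
apply: filterS3 io ae_drift_bounded ae_dev_bounded => w io [a ha] hdev.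
have [B0 hB0] := hdev 0%N.
(* One integer dominates both random constants: the deviations of node 0 and the excess of the clock
   over its sum. *)
pose K := maxn B0 (Num.truncn a).+1.
have aK : (a <= K%:R)%R.
  by rewrite (@le_trans _ _ (Num.truncn a).+1%:R)// ?ler_nat ?leq_maxr// ltW// truncnS_gt.
have B0K : (B0%:R <= K%:R :> R)%R by rewrite ler_nat leq_maxl.
have /existsNP[U hU] := io K; exists U => u Uu m um e.
apply: hU => _; exists u => //; have [B hB] := hdev u.+1.
pose lowb i := `[< exists k, (i%:R <= - dev u.+1 0 k (wF w))%R >].
have ex_low : exists i, lowb i.
  by exists 0%N; apply/asboolP; exists 0%N; rewrite /inv_dev big_geq// oppr0.
have ub_low i : lowb i -> (i <= B)%N.
  move=> /asboolP[k hk]; rewrite -(ler_nat R); apply: (le_trans hk).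
  by apply: le_trans (hB k); rewrite -normrN ler_norm.
case: (ex_maxnP ex_low ub_low) => i li maxi; exists i => //; split.
  apply/and3P; split.
  - by apply/asboolP => k; apply: le_trans B0K; apply: le_trans (hB0 k); exact: ler_norm.
  - exact: li.
  - by apply/negP => /maxi; rewrite ltnn.
exists m => //; apply/andP; split; first exact/eqP.
by apply: (le_trans (ha m)); rewrite lerD2l.
Qed.

Lemma ae_dev_cvg : {ae P, forall w, forall u, cvgn (fun k => dev u 0 k (wF w))}.
Proof.
apply: ae_foralln => u.
apply: filterS (ae_dev_cauchy mF F_gt0 indF idF x_gt0 Fx x_tail u) => w hw.
apply/cauchy_cvgP; apply: cauchy_exP => e e0.
have [m hm] := hw (Num.truncn e^-1).
exists (dev u 0 m (wF w)); exists m => // k /= mk.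
rewrite -ball_normE /= distrC -normrN opprB.
have -> : (dev u 0 m (wF w) - dev u 0 k (wF w) = - dev u m (m + (k - m)) (wF w))%R.
  rewrite subnKC// /inv_dev [X in (_ - X)%R](big_cat_nat _ (n := m))//=; ring.
rewrite normrN; apply: le_lt_trans (hm _) _.
by rewrite invf_plt ?posrE// truncnS_gt.
Qed.

Section finite_ties.
Variables (u v : nat).
Hypothesis uv : u != v.

Let Dl (f : weights R) : R := fine (limn_esup (EFin \o (fun k => aS f u k - aS f v k)%R)).
Let Ql (f : weights R) z : R := fine (limn_esup (EFin \o (fun k => qS f z k))).
Let Vl (f : weights R) : R := (Ql f u + Ql f v)%R.

Let mDl : wmeas Dl.
Proof.
apply: measurableT_comp; first exact: fine_measurable.
apply: (@measurable_fun_limn_esup _ (wT R predT) R setT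
  (fun k (f : weights R) => (aS f u k - aS f v k)%:E)) => k.
by apply/measurable_EFinP; apply: measurable_funB; exact: measurable_aS.
Qed.

Let mQl z : wmeas (Ql^~ z).
Proof.
apply: measurableT_comp; first exact: fine_measurable.
apply: (@measurable_fun_limn_esup _ (wT R predT) R setT
  (fun k (f : weights R) => (qS f z k)%:E)) => k.
by apply/measurable_EFinP; exact: measurable_qS.
Qed.

Let qS_cvg w z : (qS (wF w) z @ \oo --> Ql (wF w) z)%R.
Proof.
have c : cvgn (qS (wF w) z).
  apply: nondecreasing_is_cvgn; first by move=> k l kl; exact: (qS_le (posF w)).
  by exists X => _ [k _ <-]; exact: (qS_le_X).
by rewrite /Ql (fine_limn_esup c).
Qed.

(** Strictness matters: it keeps [Y] positive, so that halving its value is a genuine decrease. *)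
Let qS_lt w z k : (qS (wF w) z k < Ql (wF w) z)%R.
Proof.
apply: (@lt_le_trans _ _ (qS (wF w) z k.+1)).
  by rewrite qS_S ltrDl invr_gt0 exprn_gt0//; exact: posF.
rewrite -(cvg_lim _ (@qS_cvg w z))//; apply: nondecreasing_cvgn_le.
  by move=> i j ij; exact: (qS_le (posF w)).
exact: cvgP (@qS_cvg w z).
Qed.

Let Y s (f : weights R) : R := gapY f u v (Dl f) (Vl f) s.

Let mY s : wmeas (Y s).
Proof.
have ma z k : wmeas (fun f : weights R => aS f z k) by exact: measurable_aS.
have mq z k : wmeas (fun f : weights R => qS f z k) by exact: measurable_qS.
apply: measurable_funD; last first.
  by apply: measurable_funB => //; apply: measurable_funB => //; apply: measurable_funD.
by apply: measurable_funX; apply: measurable_funB => //; apply: measurable_funB.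
Qed.

Let Y_gt0 w s : (0 < Y s (wF w))%R.
Proof.
rewrite /Y /gapY /varR /Vl ltr_wpDl ?sqr_ge0//.
by have := qS_lt w u (count_mem u s); have := qS_lt w v (count_mem v s); lra.
Qed.

Let A := \bigcap_N \bigcup_n [set w | (N <= n)%N && (count_mem u (path n w) == count_mem v (path n w))].
Let n1 := maxn u v.

Let path_approx_ties : path_approx P par n1 A.
Proof.
apply: (path_approx_bigcap gpa) => N; apply: (path_approx_bigcup gpa) => n.
exact: (path_approx_pathset gpa n1 n (fun s => (N <= n)%N && (count_mem u s == count_mem v s))).
Qed.

(** At a tie of degree k the value of [Y] is a function of k alone, which tends to 0. The difference
    of the two sums converges although each may diverge, since their means cancel. *)
Let small_tie w n0 : (forall z, cvgn (fun k => dev z 0 k (wF w))) ->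
  (forall z k, exists n, (k <= count_mem z (path n w))%N) -> A w ->
  exists2 n, (n0 <= n)%N & (Y (path n w) (wF w) <= Y (path n0 w) (wF w) / 2)%R.
Proof.
move=> cdev unb Aw.
pose g k : R := ((aS (wF w) u k - aS (wF w) v k - Dl (wF w)) ^+ 2 +
  (Vl (wF w) - qS (wF w) u k - qS (wF w) v k))%R.
have cD : ((fun k => aS (wF w) u k - aS (wF w) v k) @ \oo --> Dl (wF w))%R.
  suff c : cvgn (fun k => (aS (wF w) u k - aS (wF w) v k)%R) by rewrite /Dl (fine_limn_esup c).
  rewrite (_ : (fun k => _) = (fun k => dev u 0 k (wF w) - dev v 0 k (wF w))%R).
    by apply: is_cvgB.
  apply/funext => k; rewrite /inv_dev /aS !sumrB !big_mkord; ring.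
have g0 : (g @ \oo --> (0 : R))%R.
  have -> : (0 : R)%R = ((Dl (wF w) - Dl (wF w)) ^+ 2 + (Vl (wF w) - Ql (wF w) u - Ql (wF w) v))%R.
    by rewrite /Vl; ring.
  apply: cvgD.
    rewrite expr2 /g; under eq_fun do rewrite expr2.
    by apply: cvgM; apply: cvgB => //; exact: cvg_cst.
  apply: cvgB; last exact: qS_cvg.
  by apply: cvgB; [exact: cvg_cst|exact: qS_cvg].
have e0 : (0 < Y (path n0 w) (wF w) / 2)%R by rewrite divr_gt0.
have [K _ hK] := cvgr0_norm_lt _ g0 _ e0.
have [m Km] := unb u K.
have [n _ /andP[mn /eqP e]] := Aw (maxn n0 m) I.
exists n; first by move: mn; rewrite geq_max => /andP[].
apply: le_trans (ltW (hK (count_mem u (path n w)) _)) => /=.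
  by rewrite /Y /gapY /gapX /varR -e; exact: ler_norm.
apply: leq_trans Km _; apply: count_hist_le.
by move: mn; rewrite geq_max => /andP[].
Qed.

Lemma ae_finite_ties :
  {ae P, forall w, forall z k, exists n, (k <= count_mem z (path n w))%N} ->
  {ae P, forall w, exists N, forall n, (N <= n)%N ->
    count_mem u (path n w) <> count_mem v (path n w)}.
Proof.
move=> unb; have mA : measurable A by have [] := path_approx_ties.
suff A0 : P A = 0.
  exists A; split => // w /= h N _; apply: contrapT => h'; apply: h; exists N => n Nn e.
  by apply: h'; exists n => //=; rewrite Nn e eqxx.
have c0 : (0 < 1 / 68 :> R)%R by rewrite divr_gt0.
apply: (@path_zero_one _ _ _ P F par gpa n1 A (1 / 68)%R) => // n0 beta n1n0.
have mB := measurable_pathset gpa n0 beta; set B := pathset par n0 beta in mB *.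
(* The target is relative to the value at time n0, so the bound 67/68 of [tie_bound] holds after
   every history. *)
pose S s f := (Y s f <= Y (take n0 s) f / 2)%R.
have mS s : wmeas (S s).
  by apply: measurable_fun_ler => //; apply: measurable_funM => //; exact: mY.
pose H := [set w | beta (path n0 w) /\ exists2 m, (n0 <= m)%N & S (path m w) (wF w)].
have hH : P H <= \int[P]_w ((beta (path n0 w))%:R * (67 / 68))%:E.
  apply: (@hit_le _ _ _ P F par mF F_gt0 gpa n0 (fun s _ => beta s) S (fun _ _ => (67 / 68)%R)) => //.
  move=> w s n sp _; have sn := size_paths sp.
  rewrite (@eq_Ex_hit _ _ (S^~ (wF w)) (fun s' => Y s' (wF w) <= Y s (wF w) / 2)%R).
    apply: (tie_bound (posF w)) => //.
    - by rewrite sn; move: n1n0; rewrite /n1; lia.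
    - by rewrite sn; move: n1n0; rewrite /n1; lia.
    - by move=> k l; rewrite /Vl ltrD.
  by move=> s' e; rewrite /S -sn e.
have eB : \int[P]_w ((beta (path n0 w))%:R * (67 / 68))%:E = (67 / 68)%:E * P B.
  rewrite /B /pathset (P_boolE P (mpath n0 (g := fun s _ => beta s) (fun s => measurable_cst _))).
  rewrite -ge0_integralZl_EFin//.
    by apply: eq_integral => w _; rewrite -EFinM mulrC.
  apply/measurable_EFinP; apply: measurable_natmulb.
  exact: (mpath n0 (g := fun s _ => beta s)).
have mH : measurable H by exact: (measurable_hitset mF gpa n0 (b := fun s _ => beta s)).
have BA : P (B `&` A) <= P H.
  have [C [mC C0 hC]] : {ae P, forall w, (B `&` A) w -> H w}.
    apply: filterS2 ae_dev_cvg unb => w h1 h2 [Bw Aw]; split => //.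
    have [n n0n h] := small_tie n0 h1 h2 Aw; exists n => //.
    by rewrite /S take_hist.
  apply: (@le_trans _ _ (P (H `|` C))).
    apply: le_measure; rewrite ?inE//; [exact: measurableI|exact: measurableU|].
    by move=> w BAw; have [?|nH] := pselect (H w); [left|right; apply: hC => /= /(_ BAw)].
  by apply: le_trans (@measureU2 _ _ _ P _ _ mH mC) _; rewrite [X in _ + X]C0 adde0.
have eD : P B = P (B `\` A) + P (B `&` A).
  exact: (@measureDI _ _ _ P).
have : P (B `&` A) <= (67 / 68)%:E * P B by rewrite -eB; exact: le_trans BA hH.
have fB : P B \is a fin_num by rewrite fin_num_measure.
have fD : P (B `\` A) \is a fin_num by rewrite fin_num_measure//; exact: measurableD.
have fI : P (B `&` A) \is a fin_num by rewrite fin_num_measure//; exact: measurableI.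
move: eD; rewrite -(fineK fB) -(fineK fD) -(fineK fI) -!EFinM -EFinD !lee_fin => -[e].
by lra.
Qed.

End finite_ties.

Lemma ae_unique_hub : {ae P, forall w, unique_persistent_hub (par^~ w)}.
Proof.
have unb : {ae P, forall w, forall z k, exists n, (k <= count_mem z (hist par n w))%N}.
  have h : {ae P, forall w, (forall n, predT (hist par n w)) ->
      forall B, exists n, (B < tS (wmap F w) (hist par n w))%R}.
    apply: (ae_tS_unbounded_summable mF F_gt0 gpa lam0) => N.
    apply: le_trans (CS_sum mF F_gt0 indF idF gpa N lam0 rho); apply: ler_sum => n _.
    by rewrite (eq_integral (fun w => (CS (wmap F w) lam (hist par n.+1 w))%:E))// => w _; rewrite mul1r.
  by apply: filterS2 h (ae_deg_unbounded mF F_gt0 gpa) => w h1 h2; apply: h2; exact: h1.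
have ties : {ae P, forall w, forall u v : nat, u != v -> exists N, forall n, (N <= n)%N ->
    count_mem u (hist par n w) <> count_mem v (hist par n w)}.
  apply: ae_foralln => u; apply: ae_foralln => v.
  have [->|uv] := eqVneq u v; first by apply: aeW => w /eqP.
  apply: filterS (ae_finite_ties uv unb) => w h _.
  exact: h.
apply: filterS3 (as_paths mF F_gt0 gpa) ae_finite_competitors ties.
by move=> w h1 h2 h3; exact: unique_hub_path.
Qed.

End race_convergent.

Lemma P_ae_eq d (T : measurableType d) (R : realType) (P : probability T R) (A B : set T) :
  measurable A -> measurable B -> {ae P, forall w, A w <-> B w} -> P A = P B.
Proof.
move=> mA mB [C [mC C0 h]].
have le A' B' : measurable A' -> measurable B' -> (forall w, ~ C w -> A' w -> B' w) ->
    P A' <= P B'.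
  move=> mA' mB' AB; apply: (@le_trans _ _ (P (B' `|` C))).
    apply: le_measure; rewrite ?inE//; first exact: measurableU.
    by move=> w A'w; have [?|nC] := pselect (C w); [right|left; exact: AB].
  by apply: le_trans (@measureU2 _ _ _ P _ _ mB' mC) _; rewrite [X in _ + X]C0 adde0.
have AB w : ~ C w -> A w <-> B w by move=> nC; apply: contrapT => nAB; apply: nC; exact: h.
by apply/eqP; rewrite eq_le !le// => w /AB[].
Qed.

(** * Changing the weights on a null set *)

Section modification.
Context d (T : measurableType d) (R : realType) (P : probability T R).
Variables (F G : nat -> nat -> T -> R) (par : nat -> T -> nat).
Hypothesis mF : forall j k, measurable_fun setT (F j k).
Hypothesis mG : forall j k, measurable_fun setT (G j k).
Hypothesis FG : {ae P, forall w, forall j k, F j k w = G j k w}.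

Let mpre (H : nat -> nat -> T -> R) (B : set R) j k :
  (forall j k, measurable_fun setT (H j k)) -> measurable B -> measurable (H j k @^-1` B).
Proof. by move=> mH mB; rewrite -[X in measurable X]setTI; exact: mH. Qed.

Lemma P_preimage_modification j k (B : set R) : measurable B ->
  P (F j k @^-1` B) = P (G j k @^-1` B).
Proof.
move=> mB; apply: P_ae_eq; try exact: mpre.
by apply: filterS FG => w e; rewrite /preimage /= e.
Qed.

Let mfin (H : nat -> nat -> T -> R) (s : seq (nat * nat)) (B : nat * nat -> set R) :
  (forall j k, measurable_fun setT (H j k)) -> (forall x, measurable (B x)) ->
  measurable (\bigcap_(x in [set x | x \in s]) (H x.1 x.2 @^-1` B x)).
Proof.
move=> mH mB; apply: fin_bigcap_measurable => [|x _]; last exact: mpre.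
exact: finite_seq.
Qed.

Lemma mutually_independent_modification :
  mutually_independent P F -> mutually_independent P G.
Proof.
move=> indF s B us mB; transitivity (P (\bigcap_(x in [set x | x \in s]) (F x.1 x.2 @^-1` B x))).
  apply: P_ae_eq; try exact: mfin.
  apply: filterS FG => w e; split => h x xs; have := h x xs; by rewrite /preimage /= e.
by rewrite indF//; apply: eq_bigr => x _; exact: P_preimage_modification.
Qed.

Lemma gpa_tree_modification : gpa_tree P F par -> gpa_tree P G par.
Proof.
move=> gpa; split; first exact: gpa.1.
move=> n j s B v jn mB; set cG := cylinder G par n s B v.
pose cF := cylinder F par n s B v.
have mcyl (H : nat -> nat -> T -> R) : (forall j k, measurable_fun setT (H j k)) ->
    measurable (cylinder H par n s B v).
  move=> mH; have -> : cylinder H par n s B v =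
      (\bigcap_(x in [set x | x \in s]) (H x.1 x.2 @^-1` B x)) `&`
      (\bigcap_(i in [set i | (i < n)%N]) [set w | par i w = v i]).
    by apply/seteqP; split => w.
  apply: measurableI; first exact: mfin.
  apply: fin_bigcap_measurable => [|i _]; last exact: gpa.1.
  exact: finite_II.
have mcF : measurable cF by exact: mcyl.
have mcG : measurable cG by exact: mcyl.
have cFG : {ae P, forall w, cG w <-> cF w}.
  apply: filterS FG => w e; rewrite /cF /cG /cylinder /=.
  by split=> -[h1 h2]; split => // x /h1; rewrite e.
have mq (H : nat -> nat -> T -> R) : (forall j k, measurable_fun setT (H j k)) ->
    measurable_fun setT (fun w => (H j (outdeg (par^~ w) j n) w / Zweight H par n w)%R).
  move=> mH; rewrite (_ : (fun w => _) = (fun w => pr (wmap H w) (hist par n w) j)).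
    apply: (measurable_hist_fun gpa n (g := fun s w => pr (wmap H w) s j)) => s'.
    have mpr : measurable_fun (setT : set (wT R predT)) (fun f : weights R => pr f s' j).
      apply: measurable_funM; first exact: measurable_coord.
      by apply: measurable_funV => //; exact: measurable_Zw.
    exact: (measurableT_comp mpr (@measurable_wmap _ _ _ H predT mH)).
  apply/funext => w; rewrite /pr /Zw /Zweight size_hist outdeg_hist; congr (_ / _)%R.
  by apply: eq_bigr => i _; rewrite outdeg_hist.
transitivity (P (cF `&` [set w | par n w = j])).
  apply: P_ae_eq; try by apply: measurableI => //; exact: gpa.1.
  apply: filterS cFG => w [h1 h2]; split => -[h3 h4]; split => //; [exact: h1|exact: h2].
apply: etrans (gpa.2 n j s B v jn mB) _.
apply: etrans (integral_setE P _ mcF) _; apply: etrans _ (esym (integral_setE P _ mcG)).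
apply: ae_eq_integral => //.
- by apply/measurable_EFinP; apply: measurable_funM; [exact: measurable_indic|exact: mq].
- by apply/measurable_EFinP; apply: measurable_funM; [exact: measurable_indic|exact: mq].
apply: filterS2 FG cFG => w e [h1 h2] _; congr (_%:E); congr (_ * _)%R.
  rewrite !indicE (_ : (w \in cF) = (w \in cG))//.
  by apply/idP/idP; rewrite !inE.
rewrite e; congr (_ / _)%R; apply: eq_bigr => i _; exact: e.
Qed.

End modification.

Unset Implicit Arguments.

Theorem theorem2p11 (d : measure_display) (T : measurableType d)
  (R : realType) (P : probability T R)
  (F : nat -> nat -> T -> R) (par : nat -> T -> nat) :
  (* weights: measurable, positive *)
  (forall j k, measurable_fun setT (F j k)) ->
  (forall j k w, (0 < F j k w)%R) ->
  (* (F_j(k))_{j,k} mutually independent, and the sequences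
     (F_j(k))_k identically distributed over j *)
  mutually_independent P F ->
  (forall j k (B : set R), measurable B ->
     P (F j k @^-1` B) = P (F 0%N k @^-1` B)) ->
  (* the tree process *)
  gpa_tree P F par ->
  (* Part 1 *)
  ({ae P, forall w, \sum_(0 <= j <oo) (((F 0%N j w) ^- 2)%R)%:E = +oo} ->
   {ae P, forall w, ~ has_persistent_hub (par^~ w)})
  /\
  (* Part 2 *)
  (forall x : nat -> R,
     (forall j, (0 < x j)%R) ->
     \sum_(0 <= j <oo) (((x j) ^- 2)%R)%:E < +oo ->
     (forall j, {ae P, forall w, (x j <= F 0%N j w)%R}) ->
     (exists lam : R, (0 < lam)%R /\
        \sum_(0 <= i <oo)
          (\prod_(j < i.+1) 'E_P[(fun w => F 0%N j w / (F 0%N j w + lam))%R]) < +oo) ->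
     {ae P, forall w, unique_persistent_hub (par^~ w)}).
Proof.
move=> mF F_gt0 indF idF gpa; split; first exact: (no_persistent_hub mF F_gt0 indF idF gpa).
move=> x x_gt0 xoo xF [lam0 [lam0_gt0 hlam]].
have [X x_sum x_tail] := summable_bound x_gt0 xoo.
(* [G] differs from [F] on a null set only, and dominates [x] everywhere. *)
pose G j k w := Num.max (F j k w) (x k).
have mG j k : measurable_fun setT (G j k) by exact: measurable_maxr.
have G_gt0 j k w : (0 < G j k w)%R by rewrite lt_max F_gt0.
have FG : {ae P, forall w, forall j k, F j k w = G j k w}.
  apply: ae_foralln => j; apply: ae_foralln => k.
  have mB : measurable (`]-oo, x k[ : set R) by exact: measurable_itv.
  have mpre i : measurable (F i k @^-1` (`]-oo, x k[ : set R)).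
    by rewrite -[X in measurable X]setTI; exact: mF.
  (* The lower bound is assumed for node 0 only; equality of laws makes the exceptional set of every
     node null. *)
  exists (F j k @^-1` `]-oo, x k[); split => //.
    apply: etrans (idF j k _ mB) _; apply: (iffLR (negligibleP _ (mpre 0%N))).
    have [C [mC C0 hC]] := xF k; exists C; split => // w; rewrite /preimage /= in_itv /= => lt.
    by apply: hC => /=; rewrite leNgt lt.
  move=> w /= ne; rewrite in_itv /= ltNge; apply/negP => le; apply: ne.
  by rewrite /G max_l.
have indG := mutually_independent_modification mF mG FG indF.
have idG j k (B : set R) : measurable B -> P (G j k @^-1` B) = P (G 0%N k @^-1` B).
  by move=> mB; rewrite -!(P_preimage_modification mF mG FG)// idF.
have gpaG := gpa_tree_modification mF mG FG gpa.
have [lam lam_gt0 rho] : exists2 lam : R, (0 < lam)%R & forall M, (Hrec (er P G lam) M 0 <= 1 / 2)%R.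
  apply: (Hrec_er_summable mG G_gt0 idG lam0_gt0).
  have mr (H : nat -> nat -> T -> R) j : (forall j k, measurable_fun setT (H j k)) ->
      measurable_fun setT (fun w => (H 0%N j w / (H 0%N j w + lam0))%:E).
    move=> mH; apply/measurable_EFinP; apply: measurable_funM => //.
    by apply: measurable_funV => //; exact: measurable_funD.
  apply: le_lt_trans hlam; rewrite le_eqVlt; apply/orP; left; apply/eqP.
  apply: eq_eseriesr => i _; apply: eq_bigr => j _.
  rewrite -(integral_ratio mG G_gt0 idG lam0_gt0 0%N j) unlock; apply: ae_eq_integral => //.
  - exact: mr.
  - exact: mr.
  by apply: filterS FG => w e _; rewrite /ratio /wmap /= e.
apply: (ae_unique_hub mG G_gt0 indG idG gpaG x_gt0 _ x_sum lam_gt0 rho x_tail).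
by move=> u j w; rewrite le_max lexx orbT.
Qed.
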